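(* Let $A$ be a separable amenable unital $C^*$-algebra. Then $A$ has strong property $(T)$ if and only if $A=B\oplus C$ where $B$ is finite dimensional and $C$ has no tracial states.
   Context: A unital Hilbert bimodule over $A$ is a Hilbert space $H$ with commuting unital left and right actions of $A$ coming from a non-degenerate $*$-representation of $A\otimes_{\max}A^{\rm op}$, with $(a\otimes b^{\rm op})\xi=a\cdot\xi\cdot b$ ($A^{\rm op}$ is the opposite $C^*$-algebra). For such $H$, $H^A:=\{\xi\in H: a\cdot\xi=\xi\cdot a\text{ for all }a\in A\}$ and $P^A_H:H\to H^A$ is the orthogonal projection. For a non-empty finite $Q\subseteq A$ and $\beta>0$, $V_H(Q,\beta):=\{\xi\in H:\|\xi\|=1,\ \|x\cdot\xi-\xi\cdot x\|<\beta\text{ for all }x\in Q\}$. $A$ has strong property $(T)$ if for any $\alpha>0$ there exist a non-empty finite $Q\subseteq A$ and $\beta>0$ such that for any unital Hilbert bimodule $H$ over $A$ and any $\xi\in V_H(Q,\beta)$, $\|\xi-P^A_H(\xi)\|<\alpha$. The decomposition $A=B\oplus C$ is a $C^*$-algebra direct sum, in which a summand may be zero. Amenable is equivalent to nuclear for $C^*$-algebras. *)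

(* Defs.v *)
From HB Require Import structures.
From mathcomp Require Import all_boot all_order all_algebra.
From mathcomp Require Import sesquilinear complex.
From mathcomp Require Import all_classical all_reals all_analysis.

Set Implicit Arguments.
Unset Strict Implicit.
Unset Printing Implicit Defensive.

Import Order.TTheory GRing.Theory Num.Theory.
Import numFieldNormedType.Exports.

Local Open Scope classical_set_scope.
Local Open Scope ring_scope.
Local Open Scope complex_scope.

(* Norms take values in R[i], where [0 <= z] implies that z is real; a real
   number b is compared with a norm as [b%:C].                                *)

(* Unital C*-algebras, the zero algebra included.  The multiplication is part
   of the mixin because Hierarchy Builder admits no join of the ring and the
   normed module structures below [numDomainType]; the ring structure is
   recovered by the instance declared afterwards.                             *)
HB.mixin Record isCStarAlgebra (R : realType) A
    of CompleteNormedModule R[i] A := {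
  cstar_one : A;
  cstar_mul : A -> A -> A;
  star : A -> A;
  cstar_mulA : associative cstar_mul;
  cstar_mul1x : left_id cstar_one cstar_mul;
  cstar_mulx1 : right_id cstar_one cstar_mul;
  cstar_mulDl : left_distributive cstar_mul +%R;
  cstar_mulDr : right_distributive cstar_mul +%R;
  cstar_scalerAl : forall (k : R[i]) (x y : A),
    k *: cstar_mul x y = cstar_mul (k *: x) y;
  cstar_scalerAr : forall (k : R[i]) (x y : A),
    k *: cstar_mul x y = cstar_mul x (k *: y);
  starK : involutive star;
  starD : {morph star : x y / x + y};
  starZ : forall (k : R[i]) (x : A), star (k *: x) = Num.conj k *: star x;
  starM : forall x y : A, star (cstar_mul x y) = cstar_mul (star y) (star x);
  cstar_normM : forall x y : A, `|cstar_mul x y| <= `|x| * `|y|;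
  cstar_norm : forall x : A, `|cstar_mul (star x) x| = `|x| ^+ 2
}.

#[short(type="cstarAlgType")]
HB.structure Definition CStarAlgebra (R : realType) :=
  {A of CompleteNormedModule R[i] A & isCStarAlgebra R A}.

#[non_forgetful_inheritance]
HB.instance Definition _ (R : realType) (A : cstarAlgType R) :=
  GRing.Zmodule_isPzRing.Build A (@cstar_mulA R A) (@cstar_mul1x R A)
    (@cstar_mulx1 R A) (@cstar_mulDl R A) (@cstar_mulDr R A).

(* The inner product is linear in the first variable.                         *)
HB.mixin Record isHilbert (R : realType) H
    of CompleteNormedModule R[i] H := {
  hdot : {dot H for Num.conj};
  hdotE : forall x : H, hdot x x = `|x| ^+ 2
}.

#[short(type="hilbertType")]
HB.structure Definition Hilbert (R : realType) :=
  {H of CompleteNormedModule R[i] H & isHilbert R H}.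

(* C*-algebra direct sum: the norm of [B * C] is the maximum of the two norms. *)
Section CStarProduct.
Variables (R : realType) (B C : cstarAlgType R).
Implicit Types x y z : (B * C)%type.

Let one : B * C := (1, 1).
Let mul x y : B * C := (x.1 * y.1, x.2 * y.2).
Let pstar x : B * C := (star x.1, star x.2).

Let mulA : associative mul.
Proof. by move=> x y z; rewrite /mul /= !mulrA. Qed.

Let mul1x : left_id one mul.
Proof. by case=> a b; rewrite /mul /= !mul1r. Qed.

Let mulx1 : right_id one mul.
Proof. by case=> a b; rewrite /mul /= !mulr1. Qed.

Let mulDl : left_distributive mul +%R.
Proof. by move=> x y z; rewrite /mul /= !mulrDl. Qed.

Let mulDr : right_distributive mul +%R.
Proof. by move=> x y z; rewrite /mul /= !mulrDr. Qed.

Let mulAl (k : R[i]) x y : k *: mul x y = mul (k *: x) y.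
Proof. by congr pair; exact: cstar_scalerAl. Qed.

Let mulAr (k : R[i]) x y : k *: mul x y = mul x (k *: y).
Proof. by congr pair; exact: cstar_scalerAr. Qed.

Let pstarK : involutive pstar.
Proof. by case=> a b; rewrite /pstar /= !starK. Qed.

Let pstarD : {morph pstar : x y / x + y}.
Proof. by move=> x y; rewrite /pstar /= !starD. Qed.

Let pstarZ (k : R[i]) x : pstar (k *: x) = Num.conj k *: pstar x.
Proof. by rewrite /pstar /= !starZ. Qed.

Let pstarM x y : pstar (mul x y) = mul (pstar y) (pstar x).
Proof. by congr pair; exact: starM. Qed.

Let norm_cmp (V W : normedModType R[i]) (v : V) (w : W) : `|v| >=< `|w|.
Proof. exact: real_comparable (normr_real _) (normr_real _). Qed.

Let normM x y : `|mul x y| <= `|x| * `|y|.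
Proof.
rewrite prod_normE comparable_ge_max ?norm_cmp//.
apply/andP; split; apply: (le_trans (cstar_normM _ _)); apply: ler_pM => //;
  by rewrite prod_normE comparable_le_max ?norm_cmp// lexx ?orbT.
Qed.

Let norm_star x : `|mul (pstar x) x| = `|x| ^+ 2.
Proof.
rewrite [LHS]prod_normE [`|x|]prod_normE /= !cstar_norm.
have [le12|le21] := comparable_leP (norm_cmp x.1 x.2).
  by rewrite max_r// ler_pXn2r// nnegrE.
by rewrite max_l// ltW// ltr_pXn2r// nnegrE.
Qed.

HB.saturate prod.

Let complete (F : set_system (B * C)) :
  ProperFilter F -> cauchy F -> cvg F.
Proof.
move=> FF /(@cauchyP R[i]) Fc.
have c1 : cauchy (fst @ F).
  apply/(@cauchyP R[i]) => e e0; have [x Fx] := Fc e e0.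
  by exists x.1; apply: (@filterS _ F _ (ball x e)) Fx => y [].
have c2 : cauchy (snd @ F).
  apply/(@cauchyP R[i]) => e e0; have [x Fx] := Fc e e0.
  by exists x.2; apply: (@filterS _ F _ (ball x e)) Fx => y [].
have cb : cvg (fst @ F) by exact: cauchy_cvg c1.
have cc : cvg (snd @ F) by exact: cauchy_cvg c2.
apply: (@cvgP _ F (lim (fst @ F), lim (snd @ F))).
have cbc := cvg_pair cb cc => P /cbc; rewrite !nbhs_simpl.
by apply: (@filterS _ F _) => -[].
Qed.

HB.instance Definition _ := Uniform_isComplete.Build (B * C)%type complete.
HB.instance Definition _ := isCStarAlgebra.Build R (B * C)%type
  mulA mul1x mulx1 mulDl mulDr mulAl mulAr pstarK pstarD pstarZ pstarM
  normM norm_star.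

End CStarProduct.

(* A *-isomorphism between C*-algebras is automatically isometric.            *)
Definition star_isomorphic (R : realType) (A B : cstarAlgType R) : Prop :=
  exists f : A -> B, [/\ bijective f, linear f, f 1 = 1,
    {morph f : x y / x * y} & {morph f : x / star x}].

Definition separable_space (T : topologicalType) : Prop :=
  exists2 S : set T, countable S & dense S.

Definition finite_dimensional (K : numFieldType) (V : lmodType K) : Prop :=
  exists (n : nat) (e : 'I_n -> V),
    forall v, exists c : 'I_n -> K, v = \sum_(i < n) c i *: e i.

Definition tracial_state (R : realType) (A : cstarAlgType R)
    (tau : {scalar A}) : Prop :=
  [/\ forall x, 0 <= tau (star x * x), tau 1 = 1
    & forall x y, tau (x * y) = tau (y * x)].

Section Amenability.
Variables (R : realType) (A : cstarAlgType R).

(* The actions of a Banach bimodule are not required to be unital.            *)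
Record banach_bimodule (X : completeNormedModType R[i]) := BanachBimodule {
  blact : {bilinear A -> X -> X};
  bract : {bilinear X -> A -> X};
  blactM : forall a b x, blact (a * b) x = blact a (blact b x);
  bractM : forall a b x, bract x (a * b) = bract (bract x a) b;
  blractA : forall a b x, bract (blact a x) b = blact a (bract x b);
  blact_bounded : exists K : R, forall a x, `|blact a x| <= K%:C * `|a| * `|x|;
  bract_bounded : exists K : R, forall a x, `|bract x a| <= K%:C * `|a| * `|x|
}.

(* A bounded linear map D from A to the dual X^* is encoded as the bounded
   bilinear form (a, x) |-> D(a)(x).  The dual bimodule structure on X^* is
   (a . phi)(x) = phi(x . a) and (phi . a)(x) = phi(a . x).                   *)
Definition dual_derivation (X : completeNormedModType R[i])
    (M : banach_bimodule X) (D : {bilinear A -> X -> R[i] | *%R & *%R}) : Prop :=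
  (exists K : R, forall a x, `|D a x| <= K%:C * `|a| * `|x|) /\
  (forall a b x, D (a * b) x = D b (bract M x a) + D a (blact M b x)).

Definition inner_derivation (X : completeNormedModType R[i])
    (M : banach_bimodule X) (D : {bilinear A -> X -> R[i] | *%R & *%R}) : Prop :=
  exists2 phi : {scalar X},
    exists K : R, forall x, `|phi x| <= K%:C * `|x|
    & forall a x, D a x = phi (bract M x a) - phi (blact M a x).

Definition amenable : Prop :=
  forall (X : completeNormedModType R[i]) (M : banach_bimodule X)
    (D : {bilinear A -> X -> R[i] | *%R & *%R}),
    dual_derivation M D -> inner_derivation M D.

End Amenability.

Section StrongPropertyT.
Variables (R : realType) (A : cstarAlgType R).

(* By the universal property of the maximal tensor product, the non-degenerate
   *-representations of A (x)_max A^op on H are exactly the pairs of commuting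
   unital *-representations of A and A^op on H.                               *)
Record hilbert_bimodule (H : hilbertType R) := HilbertBimodule {
  lact : {bilinear A -> H -> H};
  ract : {bilinear H -> A -> H};
  lact_continuous : forall a, continuous (lact a);
  ract_continuous : forall a, continuous (ract ^~ a);
  lact1 : forall xi, lact 1 xi = xi;
  ract1 : forall xi, ract xi 1 = xi;
  lactM : forall a b xi, lact (a * b) xi = lact a (lact b xi);
  ractM : forall a b xi, ract xi (a * b) = ract (ract xi a) b;
  lact_star : forall a xi eta,
    hdot (lact a xi) eta = hdot xi (lact (star a) eta);
  ract_star : forall a xi eta,
    hdot (ract xi a) eta = hdot xi (ract eta (star a));
  lractA : forall a b xi, ract (lact a xi) b = lact a (ract xi b)
}.

Definition central_vectors (H : hilbertType R) (M : hilbert_bimodule H) :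
  set H := [set xi | forall a, lact M a xi = ract M xi a].

(* The default value 0 of [xget] is never used when L is a closed subspace.   *)
Definition orth_proj (H : hilbertType R) (L : set H) (xi : H) : H :=
  xget 0 [set p | L p /\ forall eta, L eta -> hdot (xi - p) eta = 0].

Definition almost_central_unit (H : hilbertType R) (M : hilbert_bimodule H)
    (Q : set A) (beta : R) : set H :=
  [set xi | `|xi| = 1 /\
    forall x, Q x -> `|lact M x xi - ract M xi x| < beta%:C].

Definition strong_property_T : Prop :=
  forall alpha : R, 0 < alpha ->
  exists (Q : set A) (beta : R),
    [/\ Q !=set0, finite_set Q, 0 < beta &
      forall (H : hilbertType R) (M : hilbert_bimodule H) (xi : H),
        almost_central_unit M Q beta xi ->
        `|xi - orth_proj (central_vectors M) xi| < alpha%:C].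

End StrongPropertyT.

(* Main.v *)
Require Import Defs.
From HB Require Import structures.
From mathcomp Require Import all_boot all_order all_algebra.
From mathcomp Require Import sesquilinear complex spectral.
From mathcomp Require Import all_classical all_reals all_analysis.
From mathcomp Require Import ring lra.

(* (=>) A spectral gap Q, beta makes the powers of a fixed element of A (x) A^op,
   applied to 1 (x) 1, converge uniformly over all coarse bimodules
   L^2(F) (x) L^2(tau), where tau is a tracial state and F a state.  Slicing by
   tau gives a central element t of A with [|x t| <= |x|_2] whose multiplication
   operator is Hilbert-Schmidt on L^2(tau).  If [tau (t^* t) <> 0], the spectral
   ideal of [t^* t] above a positive level is therefore finite dimensional, and
   its unit is a central projection e with [e A] finite dimensional and
   [tau e <> 0].  If [tau (t^* t) = 0], the coarse bimodule of tau has a spectral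
   gap; but amenability (a virtual trace, the Hahn-Banach theorem and the
   Powers-Stormer inequality) provides almost central Hilbert-Schmidt operators.
   By compactness of the state space some finite-dimensional central summand
   then has a complement without tracial states.
   (<=) On B a Casimir element projects an almost central vector onto a nearby
   central one; on C an almost central vector of positive norm would give an
   almost tracial state.                                                      *)

Set Implicit Arguments.
Unset Strict Implicit.
Unset Printing Implicit Defensive.

Import Order.TTheory GRing.Theory Num.Theory.
Import numFieldNormedType.Exports.

Local Open Scope classical_set_scope.
Local Open Scope ring_scope.
Local Open Scope complex_scope.

(** * Noncommutative polynomial identities *)

Section FreeAlgebra.
Variables (K : comNzRingType) (V : lmodType K) (mul : V -> V -> V) (one : V).
Hypothesis mulA : associative mul.
Hypothesis mul1v : left_id one mul.
Hypothesis mulv1 : right_id one mul.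
Hypothesis mulDl : left_distributive mul +%R.
Hypothesis mulDr : right_distributive mul +%R.
Hypothesis scaleAl : forall k x y, k *: mul x y = mul (k *: x) y.
Hypothesis scaleAr : forall k x y, k *: mul x y = mul x (k *: y).

Inductive fexpr :=
  FVar of nat | FZero | FOne | FAdd of fexpr & fexpr | FOpp of fexpr
| FMul of fexpr & fexpr | FScale of K & fexpr.

Fixpoint feval (env : seq V) (e : fexpr) : V :=
  match e with
  | FVar n => nth 0 env n
  | FZero => 0
  | FOne => one
  | FAdd a b => feval env a + feval env b
  | FOpp a => - feval env a
  | FMul a b => mul (feval env a) (feval env b)
  | FScale k a => k *: feval env a
  end.

Fixpoint fcat {T : Type} (s t : list T) : list T :=
  match s with nil => t | cons x s' => cons x (fcat s' t) end.

Fixpoint fmap {S T : Type} (f : S -> T) (s : list S) : list T :=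
  match s with nil => nil | cons x s' => cons (f x) (fmap f s') end.

Fixpoint fprod (s t : list (K * list nat)) : list (K * list nat) :=
  match s with
  | nil => nil
  | cons p s' =>
      fcat (fmap (fun q => (fst p * fst q, fcat (snd p) (snd q))) t) (fprod s' t)
  end.

Fixpoint fnorm (e : fexpr) : list (K * list nat) :=
  match e with
  | FVar n => cons (1, cons n nil) nil
  | FZero => nil
  | FOne => cons (1, nil) nil
  | FAdd a b => fcat (fnorm a) (fnorm b)
  | FOpp a => fmap (fun p => (- fst p, snd p)) (fnorm a)
  | FMul a b => fprod (fnorm a) (fnorm b)
  | FScale k a => fmap (fun p => (k * fst p, snd p)) (fnorm a)
  end.

Fixpoint fmono (env : seq V) (m : list nat) : V :=
  match m with nil => one | cons n m' => mul (nth 0 env n) (fmono env m') end.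

Fixpoint fsem (env : seq V) (l : list (K * list nat)) : V :=
  match l with
  | nil => 0
  | cons p l' => fst p *: fmono env (snd p) + fsem env l'
  end.

Fixpoint fnat_eq (m n : nat) : bool :=
  match m, n with
  | 0, 0 => true | S m', S n' => fnat_eq m' n' | _, _ => false
  end.

Fixpoint fmono_eq (s t : list nat) : bool :=
  match s, t with
  | nil, nil => true
  | cons x s', cons y t' => if fnat_eq x y then fmono_eq s' t' else false
  | _, _ => false
  end.

Fixpoint fcoef (m : list nat) (l : list (K * list nat)) : K :=
  match l with
  | nil => 0
  | cons p l' => if fmono_eq m (snd p) then fst p + fcoef m l' else fcoef m l'
  end.

Fixpoint frest (m : list nat) (l : list (K * list nat)) : list (K * list nat) :=
  match l with
  | nil => nil
  | cons p l' => if fmono_eq m (snd p) then frest m l' else cons p (frest m l')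
  end.

Fixpoint fcheck (fuel : list (K * list nat)) (l : list (K * list nat)) : Prop :=
  match l with
  | nil => True
  | cons p l' =>
      match fuel with
      | nil => False
      | cons _ fuel' => fcoef (snd p) l = 0 /\ fcheck fuel' (frest (snd p) l')
      end
  end.

Lemma fnat_eqP m n : fnat_eq m n -> m = n.
Proof. by elim: m n => [|m ih] [|n] //= /ih ->. Qed.

Lemma fmono_eqP s t : fmono_eq s t -> s = t.
Proof.
by elim: s t => [|x s ih] [|y t] //=; case: ifP => // /fnat_eqP -> /ih ->.
Qed.

Lemma fsem_cat env s t : fsem env (fcat s t) = fsem env s + fsem env t.
Proof. by elim: s => [|p s ih] /=; rewrite ?add0r// ih addrA. Qed.

Lemma fmono_cat env s t : fmono env (fcat s t) = mul (fmono env s) (fmono env t).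
Proof. by elim: s => [|n s ih] /=; rewrite ?mul1v// ih mulA. Qed.

Lemma mul0v x : mul 0 x = 0.
Proof. by have := scaleAl 0 0 x; rewrite !scale0r. Qed.

Lemma mulv0 x : mul x 0 = 0.
Proof. by have := scaleAr 0 x 0; rewrite !scale0r. Qed.

Lemma fnormP env e : feval env e = fsem env (fnorm e).
Proof.
elim: e => [n|||a iha b ihb|a iha|a iha b ihb|k a iha] //=.
- by rewrite mulv1 scale1r addr0.
- by rewrite scale1r addr0.
- by rewrite fsem_cat iha ihb.
- rewrite iha; elim: (fnorm a) => [|p l ih] /=; first by rewrite oppr0.
  by rewrite opprD ih scaleNr.
- rewrite iha ihb; elim: (fnorm a) => [|p l ih] /=; first by rewrite mul0v.
  rewrite mulDl ih fsem_cat; congr (_ + _).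
  elim: (fnorm b) => [|q t iht] /=; first by rewrite mulv0.
  by rewrite mulDr iht fmono_cat -scalerA scaleAr scaleAl.
- rewrite iha; elim: (fnorm a) => [|p l ih] /=; first by rewrite scaler0.
  by rewrite scalerDr ih scalerA.
Qed.

Lemma fcoefP env m l :
  fsem env l = fcoef m l *: fmono env m + fsem env (frest m l).
Proof.
elim: l => [|p l ih] /=; first by rewrite scale0r addr0.
case: ifP => [/fmono_eqP <-|_] /=; first by rewrite ih scalerDl addrA.
by rewrite ih addrCA.
Qed.

Lemma fcheckP env fuel l : fcheck fuel l -> fsem env l = 0.
Proof.
elim: fuel l => [|u fuel ih] [|p l] //= [c0 /ih r0].
have mm : forall m, fmono_eq m m.
  have nn : forall n, fnat_eq n n by elim.
  by elim=> //= n m ->; rewrite nn.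
have := fcoefP env (snd p) (cons p l); rewrite /= mm => ->.
by move: c0; rewrite mm => ->; rewrite scale0r add0r.
Qed.

Lemma fexprP env a b :
  (let l := fnorm (FAdd a (FOpp b)) in fcheck l l) -> feval env a = feval env b.
Proof.
move=> /= /(fcheckP env); rewrite -[X in fsem env X]/(fnorm (FAdd a (FOpp b))).
by rewrite -fnormP /= => /eqP; rewrite subr_eq0 => /eqP.
Qed.

End FreeAlgebra.

Section CStarExpr.
Variables (R : realType) (A : cstarAlgType R).

Lemma scaleMl (k : R[i]) (x y : A) : k *: (x * y) = (k *: x) * y.
Proof. exact: cstar_scalerAl. Qed.

Lemma scaleMr (k : R[i]) (x y : A) : k *: (x * y) = x * (k *: y).
Proof. exact: cstar_scalerAr. Qed.

Lemma cstar_exprP env a b :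
  (let l := fnorm (FAdd a (FOpp b)) in fcheck l l) ->
  feval (@GRing.mul A) (1 : A) env a = feval (@GRing.mul A) 1 env b.
Proof.
apply: fexprP; [exact: mulrA|exact: mul1r|exact: mulr1|exact: mulrDl
  |exact: mulrDr|exact: scaleMl|exact: scaleMr].
Qed.

End CStarExpr.

Ltac mem_env x env :=
  match env with
  | nil => constr:(false)
  | cons x _ => constr:(true)
  | cons _ ?e => mem_env x e
  end.
Ltac add_env x env :=
  match mem_env x env with
  | true => env
  | false => constr:(cons x env)
  end.
Ltac atoms env t :=
  match t with
  | @GRing.zero _ => env
  | GRing.one _ => env
  | GRing.add ?a ?b => let e := atoms env a in atoms e b
  | GRing.opp ?a => atoms env a
  | GRing.mul ?a ?b => let e := atoms env a in atoms e b
  | GRing.scale _ ?a => atoms env a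
  | _ => add_env t env
  end.
Ltac index x env :=
  match env with
  | cons x _ => constr:(0%N)
  | cons _ ?e => let n := index x e in constr:(S n)
  end.
Ltac reify K env t :=
  match t with
  | @GRing.zero _ => constr:(@FZero K)
  | GRing.one _ => constr:(@FOne K)
  | GRing.add ?a ?b =>
      let x := reify K env a in let y := reify K env b in constr:(@FAdd K x y)
  | GRing.opp ?a => let x := reify K env a in constr:(@FOpp K x)
  | GRing.mul ?a ?b =>
      let x := reify K env a in let y := reify K env b in constr:(@FMul K x y)
  | GRing.scale ?k ?a => let x := reify K env a in constr:(@FScale K k x)
  | _ => let n := index t env in constr:(@FVar K n)
  end.
(* Decides identities between noncommutative polynomials in a C*-algebra,
   leaving one equation between complex coefficients per monomial.            *)
Ltac cstar_red :=
  rewrite ?expr2;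
  match goal with
  | |- @eq ?T ?a ?b =>
      let A := open_constr:(_ : cstarAlgType _) in
      unify T (CStarAlgebra.sort A);
      match A with
      | ?B =>
        match type of B with
        | CStarAlgebra.type ?R =>
          let K := constr:(complex R : comNzRingType) in
          let e1 := atoms (@nil (CStarAlgebra.sort B)) a in
          let env := atoms e1 b in
          let x := reify K env a in
          let y := reify K env b in
          apply: (@cstar_exprP R B env x y);
          cbv [fnorm fcheck fcoef frest fmono_eq fnat_eq fprod fmap fcat fst snd]
        end
      end
  end.
Ltac cstar := cstar_red; repeat split; try ring.

(** * Norms and limits *)

Section RealNorm.
Variable R : realType.
Implicit Types (a b z : R[i]) (r : R).

(* The norm of Defs takes values in R[i]; nr is the same norm with values in R. *)
Definition nr (V : normedZmodType R[i]) (x : V) : R := complex.Re `|x|.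

Lemma nrE (V : normedZmodType R[i]) (x : V) : `|x| = (nr x)%:C.
Proof. by rewrite /nr RRe_real// ger0_real. Qed.

Lemma nr_ge0 (V : normedZmodType R[i]) (x : V) : 0 <= nr x.
Proof. by rewrite -lecR -nrE normr_ge0. Qed.

Lemma nrD (V : normedZmodType R[i]) (x y : V) : nr (x + y) <= nr x + nr y.
Proof. by rewrite -lecR rmorphD /= -!nrE ler_normD. Qed.

Lemma nrN (V : normedZmodType R[i]) (x : V) : nr (- x) = nr x.
Proof. by rewrite /nr normrN. Qed.

Lemma nrB (V : normedZmodType R[i]) (x y : V) : nr (x - y) <= nr x + nr y.
Proof. by apply: le_trans (nrD _ _) _; rewrite nrN. Qed.

Lemma nr_dist (V : normedZmodType R[i]) (x y : V) : nr (x - y) = nr (y - x).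
Proof. by rewrite -nrN opprB. Qed.

Lemma nr_trans (V : normedZmodType R[i]) (y x z : V) :
  nr (x - z) <= nr (x - y) + nr (y - z).
Proof. by apply: le_trans (nrD _ _); rewrite addrA subrK. Qed.

Lemma nr_sub (V : normedZmodType R[i]) (x y : V) : nr x - nr y <= nr (x - y).
Proof. by rewrite lerBlDr; apply: le_trans (nrD _ _); rewrite subrK. Qed.

Lemma nr0 (V : normedZmodType R[i]) : nr (0 : V) = 0.
Proof. by rewrite /nr normr0. Qed.

Lemma nr_eq0 (V : normedZmodType R[i]) (x : V) : (nr x == 0) = (x == 0).
Proof. by rewrite -(inj_eq (@complexI R)) -nrE normr_eq0. Qed.

Lemma nr0_eq (V : normedZmodType R[i]) (x : V) : nr x = 0 -> x = 0.
Proof. by move/eqP; rewrite nr_eq0 => /eqP. Qed.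

Lemma nr_le0 (V : normedZmodType R[i]) (x : V) : nr x <= 0 -> x = 0.
Proof. by move=> h; apply: nr0_eq; apply/eqP; rewrite eq_le h nr_ge0. Qed.

Lemma nrZ (V : normedModType R[i]) (k : R[i]) (x : V) : nr (k *: x) = nr k * nr x.
Proof. by apply: complexI; rewrite rmorphM /= -!nrE normrZ. Qed.

Lemma nrM a b : nr (a * b) = nr a * nr b.
Proof. by apply: complexI; rewrite rmorphM /= -!nrE normrM. Qed.

Lemma nr_real r : nr (r%:C) = `|r|.
Proof. by rewrite /nr normc_def /= expr0n addr0 sqrtr_sqr. Qed.

Lemma nrZr (V : normedModType R[i]) r (x : V) : nr (r%:C *: x) = `|r| * nr x.
Proof. by rewrite nrZ nr_real. Qed.

Lemma nr_conj z : nr (conjc z) = nr z.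
Proof. by rewrite /nr normcJ. Qed.

Lemma cjD a b : conjc (a + b) = conjc a + conjc b.
Proof. exact: rmorphD. Qed.
Lemma cjN a : conjc (- a) = - conjc a.
Proof. exact: rmorphN. Qed.
Lemma cjM a b : conjc (a * b) = conjc a * conjc b.
Proof. exact: rmorphM. Qed.
Lemma cjr r : conjc r%:C = r%:C.
Proof. exact: conjc_real. Qed.
Lemma cj1 : conjc 1 = 1 :> R[i].
Proof. exact: conjc1. Qed.
Lemma nr1C : nr (1 : R[i]) = 1.
Proof. by rewrite -[1]/(1%:C) nr_real normr1. Qed.
Lemma cj_sum (I : Type) (s : seq I) (P : pred I) (F : I -> R[i]) :
  conjc (\sum_(i <- s | P i) F i) = \sum_(i <- s | P i) conjc (F i).
Proof. exact: rmorph_sum. Qed.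

Lemma inv_small (e : R) : 0 < e ->
  exists N, forall n, (N <= n)%N -> n.+1%:R^-1 < e.
Proof.
move=> e0; exists (Num.trunc e^-1) => n Nn.
rewrite invf_plt ?posrE//; apply: lt_le_trans (truncnS_gt _) _.
by rewrite ler_nat.
Qed.

Lemma nr_i : nr ('i : R[i]) = 1.
Proof. by rewrite /nr normc_def /= expr0n expr1n add0r sqrtr1. Qed.

Lemma sqr_nr z : (nr z ^+ 2)%:C = z * conjc z.
Proof. by rewrite rmorphXn /= -nrE sqr_normc. Qed.

Lemma nr2 z : nr z ^+ 2 = complex.Re z ^+ 2 + complex.Im z ^+ 2.
Proof. by apply: complexI; rewrite rmorphXn /= -nrE add_Re2_Im2. Qed.

Lemma Re_le_nr z : `|complex.Re z| <= nr z.
Proof. by rewrite -lecR -nrE normc_ge_Re. Qed.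

Lemma Re_nr z : complex.Re z <= nr z.
Proof. exact: le_trans (ler_norm _) (Re_le_nr _). Qed.

Lemma nr_ReIm z : nr z <= `|complex.Re z| + `|complex.Im z|.
Proof.
rewrite -(ler_pXn2r (ltn0Sn 1)) ?nnegrE ?nr_ge0 ?addr_ge0 ?normr_ge0//.
by rewrite nr2 sqrrD !real_normK ?num_real// lerD2r lerDl mulrn_wge0.
Qed.

Definition lim_to (V : normedZmodType R[i]) (u : nat -> V) (l : V) :=
  forall e : R, 0 < e -> exists N, forall n, (N <= n)%N -> nr (u n - l) < e.

Lemma lim_cst (V : normedZmodType R[i]) (l : V) : lim_to (fun=> l) l.
Proof. by move=> e e0; exists 0%N => n _; rewrite subrr nr0. Qed.

Lemma lim_uniq (V : normedZmodType R[i]) (u : nat -> V) (l l' : V) :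
  lim_to u l -> lim_to u l' -> l = l'.
Proof.
move=> ul ul'; apply/eqP; rewrite -subr_eq0 -nr_eq0 eq_le nr_ge0 andbT.
apply/ler_addgt0Pr => e e0; rewrite add0r; have e2 : 0 < e / 2 by rewrite divr_gt0.
have [N hN] := ul _ e2; have [M hM] := ul' _ e2.
apply: le_trans (nr_trans (u (maxn N M)) _ _) _.
rewrite nr_dist [leRHS]splitr lerD// ltW//; [exact/hN/leq_maxl|exact/hM/leq_maxr].
Qed.

Lemma lim_lip (V W : normedZmodType R[i]) (f : V -> W) (C : R) (u : nat -> V) l :
  (forall x y, nr (f x - f y) <= C * nr (x - y)) ->
  lim_to u l -> lim_to (f \o u) (f l).
Proof.
move=> fC ul e e0.
have C0 : 0 < `|C| + 1 by rewrite ltr_wpDl.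
have [N hN] := ul (e / (`|C| + 1)) (divr_gt0 e0 C0).
exists N => n /hN; rewrite ltr_pdivlMr// => h.
apply: le_lt_trans (fC _ _) (le_lt_trans _ h); rewrite mulrC.
rewrite ler_wpM2l ?nr_ge0// (le_trans (ler_norm C))//.
by rewrite lerDl.
Qed.

Lemma limD (V : normedZmodType R[i]) (u v : nat -> V) l m :
  lim_to u l -> lim_to v m -> lim_to (fun n => u n + v n) (l + m).
Proof.
move=> ul vm e e0; have e2 : 0 < e / 2 by rewrite divr_gt0.
have [N hN] := ul _ e2; have [M hM] := vm _ e2.
exists (maxn N M) => n; rewrite geq_max => /andP[/hN h1 /hM h2].
rewrite opprD addrACA; apply: le_lt_trans (nrD _ _) _.
by rewrite [ltRHS]splitr ltrD.
Qed.

Lemma limN (V : normedZmodType R[i]) (u : nat -> V) l :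
  lim_to u l -> lim_to (fun n => - u n) (- l).
Proof.
by apply: (@lim_lip _ _ -%R 1) => x y; rewrite mul1r -opprD nrN.
Qed.

Lemma limB (V : normedZmodType R[i]) (u v : nat -> V) l m :
  lim_to u l -> lim_to v m -> lim_to (fun n => u n - v n) (l - m).
Proof. by move=> ul /limN vm; exact: limD. Qed.

Lemma limZ (V : normedModType R[i]) k (u : nat -> V) l :
  lim_to u l -> lim_to (fun n => k *: u n) (k *: l).
Proof.
by apply: (@lim_lip _ _ ( *:%R k) (nr k)) => x y; rewrite -scalerBr nrZ.
Qed.

Lemma lim_shift (V : normedZmodType R[i]) (u : nat -> V) l :
  lim_to u l -> lim_to (u \o S) l.
Proof.
by move=> ul e /ul[N hN]; exists N => n Nn; exact/hN/(leq_trans Nn).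
Qed.

Lemma lim_le (V : normedZmodType R[i]) (u : nat -> V) l M :
  lim_to u l -> (exists N, forall n, (N <= n)%N -> nr (u n) <= M) -> nr l <= M.
Proof.
move=> ul [N0 uM]; apply/ler_addgt0Pr => e e0; have [N hN] := ul _ e0.
have h1 := ltW (hN (maxn N N0) (leq_maxl _ _)).
have h2 := uM (maxn N N0) (leq_maxr _ _).
have := nr_sub l (u (maxn N N0)); rewrite nr_dist.
by move: h1 h2; lra.
Qed.

Lemma lim_le0 (V : normedZmodType R[i]) (u : nat -> V) (c : nat -> R) :
  (forall n, nr (u n) <= c n) ->
  (forall e, 0 < e -> exists N, forall n, (N <= n)%N -> c n < e) -> lim_to u 0.
Proof.
move=> uc c0 e /c0[N hN]; exists N => n /hN; rewrite subr0.
exact: le_lt_trans.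
Qed.

Lemma seq_complete (V : completeNormedModType R[i]) (u : nat -> V) :
  (forall e : R, 0 < e -> exists N, forall m n, (N <= m)%N -> (N <= n)%N ->
     nr (u m - u n) < e) -> exists l, lim_to u l.
Proof.
move=> uc.
have cu : cauchy (u @ \oo).
  apply/(@cauchy_ballP R[i]) => e e0.
  have er : e = (complex.Re e)%:C by rewrite RRe_real// gtr0_real.
  have er0 : 0 < complex.Re e by rewrite -ltcR -er.
  have [N hN] := uc _ er0.
  exists (u @` [set n | (N <= n)%N], u @` [set n | (N <= n)%N]) => /=.
    by split; exists N => // n /= Nn; exists n.
  move=> [x y] /= [[m Nm <-] [n Nn <-]].
  by rewrite -ball_normE /= nrE er ltcR hN.
have ul : u @ \oo --> lim (u @ \oo) by exact: (cauchy_cvg _ cu).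
exists (lim (u @ \oo)) => e e0.
have e0' : (0 : R[i]) < e%:C by rewrite ltcR.
move/cvgrPdist_lt : ul => /(_ _ e0')[N _ hN].
by exists N => n Nn; move: (hN n Nn) => /=; rewrite nrE ltcR nr_dist.
Qed.

Lemma real_bounded_incr_cauchy (s : nat -> R) M :
  (forall n, s n <= s n.+1) -> (forall n, s n <= M) ->
  forall e, 0 < e -> exists N, forall m n, (N <= m)%N -> (m <= n)%N ->
     s n - s m < e.
Proof.
move=> s1 sM e e0.
have hs : has_sup (range s).
  by split; [exists (s 0%N), 0%N|exists M => _ [n _ <-]].
have [_ [N _ <-]] := sup_adherent e0 hs => hN.
have smono m n : (m <= n)%N -> s m <= s n.
  by apply: (homo_leq (r := fun x y => x <= y)) => // x y z; exact: le_trans.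
exists N => m n Nm mn; have := smono _ _ Nm.
have : s n <= sup (range s) by apply: ub_le_sup; [exact: hs.2|exists n].
by move: hN; lra.
Qed.

Lemma seq_complete_dom (V : completeNormedModType R[i]) (u : nat -> V)
    (s : nat -> R) M :
  (forall n, nr (u n.+1 - u n) <= s n.+1 - s n) -> (forall n, s n <= M) ->
  exists l, lim_to u l.
Proof.
move=> us sM; apply: seq_complete => e e0.
have s1 n : s n <= s n.+1 by rewrite -subr_ge0 (le_trans (nr_ge0 _) (us n)).
have [N hN] := real_bounded_incr_cauchy s1 sM e0.
have key m n : (m <= n)%N -> nr (u n - u m) <= s n - s m.
  elim: n => [|n ih]; first by rewrite leqn0 => /eqP ->; rewrite !subrr nr0.
  rewrite leq_eqVlt => /orP[/eqP ->|/ih h]; first by rewrite !subrr nr0.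
  apply: le_trans (nr_trans (u n) _ _) _.
  by have := us n; move: h; lra.
exists N => m n Nm Nn; case: (leqP m n) => [mn|/ltnW nm].
  by rewrite nr_dist; exact: le_lt_trans (key _ _ mn) (hN _ _ Nm mn).
exact: le_lt_trans (key _ _ nm) (hN _ _ Nn nm).
Qed.

End RealNorm.

Section CStarOrder.
Variables (R : realType) (A : cstarAlgType R).
Implicit Types (x y z w h a b : A) (r s l M : R).

Local Notation "r %:1" := (r%:C *: (1 : A)) (at level 2, format "r %:1").

Lemma starZc (k : R[i]) x : star (k *: x) = conjc k *: star x.
Proof. exact: starZ. Qed.

Lemma starZr r x : star (r%:C *: x) = r%:C *: star x.
Proof. by rewrite starZc conjc_real. Qed.

Lemma star1 : star 1 = 1 :> A.
Proof.
have h : star (star 1 * 1 : A) = star 1 * star (star 1) := starM _ _.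
by move: h; rewrite mulr1 !starK mulr1 => h; rewrite -h.
Qed.

Lemma star0 : star 0 = 0 :> A.
Proof. by have := starZc 0 (0 : A); rewrite !scale0r conjc0 scale0r. Qed.

Lemma starN x : star (- x) = - star x.
Proof. by apply: (@addrI _ (star x)); rewrite -starD !subrr star0. Qed.

Lemma starB x y : star (x - y) = star x - star y.
Proof. by rewrite starD starN. Qed.

Lemma starMr x y : star (x * y) = star y * star x.
Proof. exact: starM. Qed.

Lemma starr r : star (r%:1) = r%:1.
Proof. by rewrite starZr star1. Qed.

Lemma nr_mul x y : nr (x * y) <= nr x * nr y.
Proof. by rewrite -lecR rmorphM /= -!nrE; exact: cstar_normM. Qed.

Lemma nr_starM x : nr (star x * x) = nr x ^+ 2.
Proof. by apply: complexI; rewrite rmorphXn /= -!nrE; exact: cstar_norm. Qed.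

Lemma nr_star x : nr (star x) = nr x.
Proof.
suff le y : nr y <= nr (star y).
  by apply/eqP; rewrite eq_le le andbT -{2}(starK x) le.
have [->|y0] := eqVneq y 0; first by rewrite star0.
have ny : 0 < nr y by rewrite lt_def nr_eq0 y0 nr_ge0.
by rewrite -(ler_pM2r ny) -expr2 -nr_starM nr_mul.
Qed.

Lemma nr1_le : nr (1 : A) <= 1.
Proof.
have [e|n0] := eqVneq (nr (1 : A)) 0; first by rewrite e.
have n0' : 0 < nr (1 : A) by rewrite lt_def n0 nr_ge0.
by rewrite -(ler_pM2r n0') mul1r -expr2 -nr_starM star1 mul1r.
Qed.

Lemma nr_r r : 0 <= r -> nr (r%:1) <= r.
Proof.
by move=> r0; rewrite nrZr ger0_norm// -[leRHS]mulr1 ler_wpM2l// nr1_le.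
Qed.

Lemma limMl x (u : nat -> A) (l : A) : lim_to u l -> lim_to (fun n => x * u n) (x * l).
Proof.
by apply: (@lim_lip _ _ _ ( *%R x) (nr x)) => y z; rewrite -mulrBr nr_mul.
Qed.

Lemma limMr x (u : nat -> A) (l : A) : lim_to u l -> lim_to (fun n => u n * x) (l * x).
Proof.
apply: (@lim_lip _ _ _ (fun y : A => y * x) (nr x)) => y z.
by rewrite -mulrBl mulrC nr_mul.
Qed.

Lemma lim_star (u : nat -> A) (l : A) :
  lim_to u l -> lim_to (fun n => star (u n)) (star l).
Proof.
by apply: (@lim_lip _ _ _ (@star R A) 1) => y z; rewrite mul1r -starB nr_star.
Qed.

Lemma limM (u v : nat -> A) (l m : A) K : (forall n, nr (u n) <= K) ->
  lim_to u l -> lim_to v m -> lim_to (fun n => u n * v n) (l * m).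
Proof.
move=> uK ul vm; have K0 : 0 <= K by apply: le_trans (uK 0%N); exact: nr_ge0.
have h1 : lim_to (fun n => (u n - l) * m) 0.
  have h0 : lim_to (fun n => u n - l) 0.
    by have := limB ul (lim_cst l); rewrite subrr.
  by have := limMr m h0; rewrite mul0r.
have h2 : lim_to (fun n => u n * (v n - m)) 0.
  move=> e e0; have K1 : 0 < K + 1 by rewrite ltr_wpDl.
  have [N hN] := vm _ (divr_gt0 e0 K1).
  exists N => n /hN; rewrite subr0 ltr_pdivlMr// => h.
  apply: le_lt_trans (nr_mul _ _) (le_lt_trans _ h); rewrite mulrC.
  by rewrite ler_wpM2l ?nr_ge0// (le_trans (uK n))// lerDl.
have := limD (limD h1 h2) (lim_cst (l * m)); rewrite !add0r.
by congr lim_to; apply/funext => n; cstar.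
Qed.

Definition sa x := star x = x.

Lemma saD x y : sa x -> sa y -> sa (x + y).
Proof. by rewrite /sa starD => -> ->. Qed.
Lemma saN x : sa x -> sa (- x).
Proof. by rewrite /sa starN => ->. Qed.
Lemma saB x y : sa x -> sa y -> sa (x - y).
Proof. by move=> hx hy; apply: saD => //; exact: saN. Qed.
Lemma saZ r x : sa x -> sa (r%:C *: x).
Proof. by rewrite /sa starZr => ->. Qed.
Lemma sar r : sa (r%:1).
Proof. exact: starr. Qed.
Lemma sa1 : sa 1.
Proof. exact: star1. Qed.
Lemma saM x y : sa x -> sa y -> x * y = y * x -> sa (x * y).
Proof. by rewrite /sa starMr => -> -> ->. Qed.
Lemma sa_sq x : sa x -> sa (x * x).
Proof. by move=> hx; exact: saM. Qed.
Lemma sa_star x : sa (star x * x).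
Proof. by rewrite /sa starMr starK. Qed.
Lemma sa_star' x : sa (x * star x).
Proof. by rewrite /sa starMr starK. Qed.
Lemma lim_sa (u : nat -> A) (l : A) : (forall n, sa (u n)) -> lim_to u l -> sa l.
Proof.
move=> hu ul; apply: (lim_uniq (lim_star ul)).
by move=> e /ul[N hN]; exists N => n /hN; rewrite hu.
Qed.

(* [1 - x] has the square root [1 - z], where [z = (x + z^2) / 2] is found by
   iteration, dominated by the iteration for the scalar [x = 1].              *)
Fixpoint sqrt_iter x n : A :=
  if n is m.+1 then (2^-1)%:C *: (x + sqrt_iter x m * sqrt_iter x m) else 0.
Fixpoint sqrt_bound n : R :=
  if n is m.+1 then 2^-1 * (1 + sqrt_bound m ^+ 2) else 0.

Lemma sqrt_bound_itv n : 0 <= sqrt_bound n <= 1.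
Proof.
elim: n => [|n /andP[h0 h1]] /=; first by rewrite lexx ler01.
by apply/andP; split; nra.
Qed.

Lemma sqrt_iter_comm x w n : w * x = x * w -> w * sqrt_iter x n = sqrt_iter x n * w.
Proof.
move=> c; elim: n => [|n ih] /=; first by rewrite mulr0 mul0r.
by rewrite -scaleMr -scaleMl mulrDr mulrDl c mulrA ih -!mulrA ih.
Qed.

Lemma sqrt_exists x : sa x -> nr x <= 1 -> exists z,
  [/\ sa z, nr z <= 1, (1 - z) * (1 - z) = 1 - x &
      forall w, w * x = x * w -> w * z = z * w].
Proof.
move=> sx x1; pose u := sqrt_iter x.
have half : `|(2^-1 : R)| = 2^-1 by rewrite ger0_norm// invr_ge0.
have ub n : nr (u n) <= sqrt_bound n.
  elim: n => [|n ih] /=; first by rewrite nr0.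
  rewrite nrZr half ler_pM2l ?invr_gt0//.
  apply: le_trans (nrD _ _) _; apply: lerD => //.
  apply: le_trans (nr_mul _ _) _; rewrite expr2.
  by apply: ler_pM => //; exact: nr_ge0.
have u1 n : nr (u n) <= 1.
  by have /andP[_ h] := sqrt_bound_itv n; exact: le_trans (ub n) h.
have cu m n : u m * u n = u n * u m.
  by apply: sqrt_iter_comm; apply/esym; apply: sqrt_iter_comm.
have du n : nr (u n.+1 - u n) <= sqrt_bound n.+1 - sqrt_bound n.
  elim: n => [|n ih].
    rewrite /u /= !subr0 mulr0 expr0n /= !addr0 nrZr half mulr1 -[leRHS]mulr1.
    by rewrite ler_pM2l ?invr_gt0.
  have -> : u n.+2 - u n.+1 = (2^-1)%:C *: ((u n.+1 + u n) * (u n.+1 - u n)).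
    have e k : u k.+1 = (2^-1)%:C *: (x + u k * u k) by [].
    rewrite (e n.+1) [X in _ - X](e n) -scalerBr; congr (_ *: _).
    rewrite mulrDl !mulrBr (cu n n.+1) addrA subrK.
    by rewrite opprD addrACA subrr add0r.
  rewrite nrZr half.
  have -> : sqrt_bound n.+2 - sqrt_bound n.+1 =
     2^-1 * ((sqrt_bound n.+1 + sqrt_bound n) * (sqrt_bound n.+1 - sqrt_bound n)).
    have e k : sqrt_bound k.+1 = 2^-1 * (1 + sqrt_bound k ^+ 2) by [].
    by rewrite (e n.+1) [X in _ - X](e n); ring.
  rewrite ler_pM2l ?invr_gt0//; apply: le_trans (nr_mul _ _) _.
  apply: ler_pM; rewrite ?nr_ge0//.
  by apply: le_trans (nrD _ _) _; apply: lerD.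
have [z uz] : exists z, lim_to u z.
  apply: (@seq_complete_dom _ _ _ sqrt_bound 1) => // n.
  by have /andP[] := sqrt_bound_itv n.
have ez : z = (2^-1)%:C *: (x + z * z).
  apply: (lim_uniq (lim_shift uz)); apply: limZ; apply: limD; first exact: lim_cst.
  exact: (limM u1 uz uz).
exists z; split.
- apply: (lim_sa _ uz); elim=> [|n ih] /=; first exact: star0.
  by apply: saZ; apply: saD => //; exact: sa_sq.
- by apply: (lim_le uz); exists 0%N => n _.
- have e2 : 2%:C *: z = x + z * z.
    by rewrite {1}ez scalerA -rmorphM /= divff// scale1r.
  have -> : (1 - z) * (1 - z) = 1 - 2%:C *: z + z * z by cstar.
  by rewrite e2 opprD -addrA subrK.
- move=> w c; apply: (lim_uniq (limMl w uz)).
  have e : (fun n => w * u n) = (fun n => u n * w).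
    by apply/funext => n; exact: sqrt_iter_comm.
  by rewrite e; exact: limMr.
Qed.

Lemma conj_i : conjc 'i = - 'i :> R[i].
Proof. by apply/eqP; rewrite eq_complex /= oppr0 !eqxx. Qed.

Lemma ii : 'i * 'i = -1 :> R[i].
Proof. by rewrite -expr2 sqr_i. Qed.

Lemma cartesian_le (a b : A) r : sa a -> sa b -> a * b = b * a -> 0 <= r ->
  a * a + b * b = (r ^+ 2)%:1 -> nr a <= r.
Proof.
move=> ha hb ab r0 e.
have e1 : star (a + 'i *: b) * (a + 'i *: b) = (r ^+ 2)%:1.
  rewrite -e starD starZc ha hb conj_i.
  transitivity (a * a - ('i * 'i) *: (b * b) + 'i *: (a * b - b * a)).
    by cstar.
  by rewrite ab subrr scaler0 addr0 ii scaleN1r opprK.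
have n1 : nr (a + 'i *: b) <= r.
  rewrite -(ler_pXn2r (ltn0Sn 1)) ?nnegrE ?nr_ge0// -nr_starM e1.
  by apply: nr_r; exact: sqr_ge0.
have -> : a = (2^-1)%:C *: ((a + 'i *: b) + star (a + 'i *: b)).
  rewrite starD starZc ha hb conj_i scaleNr addrACA subrr addr0.
  rewrite scalerDr -scalerDl -rmorphD /= (_ : 2^-1 + 2^-1 = 1) ?scale1r//.
  by field.
rewrite nrZr ger0_norm ?invr_ge0// mulrC ler_pdivrMr//.
apply: le_trans (nrD _ _) _; rewrite nr_star; move: n1; lra.
Qed.

End CStarOrder.

(** * Positive elements *)

Section Positivity.
Variables (R : realType) (A : cstarAlgType R).
Implicit Types (x y z w h a b : A) (r s l M : R).

Local Notation "r %:1" := (r%:C *: (1 : A)) (at level 2, format "r %:1").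

(* Equivalently h is the square of a self-adjoint element; this form of
   positivity makes sums of positive elements obviously positive.             *)
Definition Pos h := sa h /\ exists2 l : R, 0 < l & nr (l%:1 - h) <= l.

Lemma pos_sa h : Pos h -> sa h.
Proof. by case. Qed.

Lemma pos_sqrt h : Pos h -> exists y,
  [/\ sa y, Pos y, y * y = h & forall w, w * h = h * w -> w * y = y * w].
Proof.
case=> sh [l l0 hl].
have l0' : l != 0 by rewrite gt_eqF.
pose x := (l^-1)%:C *: (l%:1 - h).
have sx : sa x by apply: saZ; apply: saB => //; exact: sar.
have x1 : nr x <= 1.
  by rewrite nrZr ger0_norm ?invr_ge0 ?(ltW l0)// mulrC ler_pdivrMr// mul1r.
have [z [sz z1 zz cz]] := sqrt_exists sx x1.
pose r := Num.sqrt l.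
have rr : r * r = l by rewrite -expr2 sqr_sqrtr// ltW.
have r0 : 0 < r by rewrite sqrtr_gt0.
have hx : h = l%:C *: (1 - x).
  by rewrite /x scalerBr scalerA -rmorphM /= divff// scale1r opprB addrC subrK.
exists (r%:C *: (1 - z)); split.
- by apply: saZ; apply: saB => //; exact: sa1.
- split; first by apply: saZ; apply: saB => //; exact: sa1.
  exists r => //; rewrite scalerBr opprB addrC subrK nrZr ger0_norm ?(ltW r0)//.
  by rewrite -[leRHS]mulr1 ler_pM2l.
- by rewrite -scaleMl -scaleMr scalerA -rmorphM /= rr zz -hx.
- move=> w c; have cx : w * x = x * w.
    rewrite /x -scaleMr -scaleMl; congr (_ *: _).
    by rewrite mulrBr mulrBl c -scaleMr -scaleMl mulr1 mul1r.
  by rewrite -scaleMr -scaleMl mulrBr mulrBl (cz _ cx) mulr1 mul1r.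
Qed.

Lemma sq_near1 a : sa a -> nr a <= 1 -> nr (1 - a * a) <= 1.
Proof.
move=> sa_a a1.
have aa1 : nr (a * a) <= 1.
  by apply: le_trans (nr_mul _ _) _; rewrite mulr_ile1// nr_ge0.
have [z [sz z1 zz cz]] := sqrt_exists (sa_sq sa_a) aa1.
rewrite -zz; have cb : (1 - z) * a = a * (1 - z).
  by rewrite mulrBr mulrBl mul1r mulr1 (cz a) ?mulrA.
have : nr (1 - z) <= 1.
  apply: (@cartesian_le _ _ (1 - z) a) => //; first by apply: saB => //; exact: sa1.
  by rewrite zz subrK expr1n scale1r.
move=> b1; apply: le_trans (nr_mul _ _) _.
by rewrite mulr_ile1// nr_ge0.
Qed.

Lemma sq_near a l : sa a -> nr a ^+ 2 <= l -> nr (l%:1 - a * a) <= l.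
Proof.
move=> sa_a; have [l0|l0] := ltP 0 l; last first.
  move=> h; have a0 : a = 0.
    apply: nr0_eq; apply/eqP; rewrite -sqrf_eq0 eq_le sqr_ge0 andbT.
    exact: le_trans h l0.
  have -> : l = 0.
    by apply/eqP; rewrite eq_le l0 (le_trans (sqr_ge0 _) h).
  by rewrite a0 mul0r subr0 scale0r nr0.
move=> al; pose r := Num.sqrt l.
have rr : r * r = l by rewrite -expr2 sqr_sqrtr// ltW.
have r0 : 0 < r by rewrite sqrtr_gt0.
have r0' : r != 0 by rewrite gt_eqF.
have ar : nr a <= r.
  by rewrite -(ler_pXn2r (ltn0Sn 1)) ?nnegrE ?nr_ge0 ?(ltW r0)// [r ^+ 2]expr2 rr.
have h : nr (1 - ((r^-1)%:C *: a) * ((r^-1)%:C *: a)) <= 1.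
  apply: sq_near1; first exact: saZ.
  by rewrite nrZr ger0_norm ?invr_ge0 ?(ltW r0)// mulrC ler_pdivrMr// mul1r.
have -> : l%:1 - a * a = l%:C *: (1 - ((r^-1)%:C *: a) * ((r^-1)%:C *: a)).
  rewrite scalerBr; congr (_ - _); rewrite -scaleMl -scaleMr !scalerA -!rmorphM /=.
  by rewrite -rr (_ : r * r * (r^-1 * r^-1) = 1) ?scale1r//; field.
by rewrite nrZr ger0_norm ?(ltW l0)// -[leRHS]mulr1 ler_pM2l.
Qed.

Lemma pos_sq a : sa a -> Pos (a * a).
Proof.
move=> sa_a; split; first exact: sa_sq.
exists (nr a ^+ 2 + 1); first by rewrite ltr_wpDl// sqr_ge0.
by apply: sq_near => //; rewrite lerDl.
Qed.

Lemma pos_near h l : Pos h -> nr h <= l -> nr (l%:1 - h) <= l.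
Proof.
move=> /pos_sqrt[y [sy _ <- _]] hl; apply: sq_near => //.
by rewrite -nr_starM sy.
Qed.

Lemma pos0 : Pos 0.
Proof. by have := pos_sq (star0 A : sa 0); rewrite mul0r. Qed.

Lemma pos_add h k : Pos h -> Pos k -> Pos (h + k).
Proof.
move=> [sh [l l0 hl]] [sk [m m0 km]]; split; first exact: saD.
exists (l + m); first exact: addr_gt0.
rewrite rmorphD /= scalerDl opprD addrACA.
by apply: le_trans (nrD _ _) _; exact: lerD.
Qed.

Lemma pos_mul h k : Pos h -> Pos k -> h * k = k * h -> Pos (h * k).
Proof.
move=> /pos_sqrt[y [sy _ yy cy]] /pos_sqrt[z [sz _ zz cz]] c.
have hz : h * z = z * h by exact: cz.
have yz : z * y = y * z by apply: cy.
have -> : h * k = (y * z) * (y * z).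
  by rewrite -yy -zz !mulrA -(mulrA y z y) yz !mulrA.
by apply: pos_sq; apply: saM.
Qed.

Lemma pos_r r : 0 <= r -> Pos (r%:1).
Proof.
move=> r0; have -> : r%:1 = ((Num.sqrt r)%:1) * ((Num.sqrt r)%:1).
  by rewrite -scaleMl -scaleMr mulr1 scalerA -rmorphM /= -expr2 sqr_sqrtr.
by apply: pos_sq; exact: sar.
Qed.

Lemma posZ r h : 0 <= r -> Pos h -> Pos (r%:C *: h).
Proof.
move=> r0 ph; have -> : r%:C *: h = r%:1 * h by rewrite -scaleMl mul1r.
apply: pos_mul => //; first exact: pos_r.
by rewrite -scaleMl -scaleMr mul1r mulr1.
Qed.

Lemma pos_order_unit h r : sa h -> nr h <= r -> Pos (r%:1 - h).
Proof.
move=> sh hr; split; first by apply: saB => //; exact: sar.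
exists (r + 1); first by rewrite ltr_wpDl// (le_trans (nr_ge0 _) hr).
have -> : (r + 1)%:1 - (r%:1 - h) = 1%:1 + h.
  by cstar.
apply: le_trans (nrD _ _) _; rewrite addrC; apply: lerD => //.
exact: nr_r.
Qed.

Lemma pos_eps h : (forall e, 0 < e -> Pos (h + e%:1)) -> Pos h.
Proof.
move=> H; have sh : sa h.
  have := saB (pos_sa (H _ ltr01)) (sar A 1).
  by rewrite addrK.
split => //; pose l := nr h + 1.
have l0 : 0 < l by rewrite /l ltr_wpDl// nr_ge0.
exists l => //; apply/ler_addgt0Pr => e0 e0_gt0.
pose e := Num.min 1 (e0 / 2).
have e_gt0 : 0 < e by rewrite lt_min ltr01 divr_gt0.
have e1 : e <= 1 by rewrite ge_min lexx.
have e2 : e + e <= e0 by rewrite [leRHS]splitr lerD// /e ge_min lexx orbT.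
have hn : nr (h + e%:1) <= l.
  by apply: le_trans (nrD _ _) _; rewrite lerD2l (le_trans (nr_r _ (ltW _))).
have := pos_near (H _ e_gt0) hn.
rewrite opprD addrA => h1.
have := nrD (l%:1 - h - e%:1) (e%:1); rewrite subrK.
by have := nr_r A (ltW e_gt0); move: h1 e2 e_gt0; lra.
Qed.

Lemma norm_le_pos h s : 0 <= s -> Pos (s%:1 - h) -> Pos (s%:1 + h) -> nr h <= s.
Proof.
move=> s0 p1 p2.
have sh : sa h.
  have := saB (pos_sa p2) (sar A s).
  by rewrite addrC addrA addNr add0r.
have c : (s%:1 - h) * (s%:1 + h) = (s%:1 + h) * (s%:1 - h) by cstar.
have /pos_sqrt[w [sw _ ww cw]] := pos_mul p1 p2 c.
apply: (@cartesian_le _ _ h w) => //; last by rewrite ww; cstar; rewrite rmorphXn/=; ring.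
by apply: cw; cstar.
Qed.

Lemma posN_eq0 h : Pos h -> Pos (- h) -> h = 0.
Proof.
move=> p1 p2; apply: nr_le0; apply: norm_le_pos => //;
  by rewrite scale0r add0r.
Qed.

Lemma pos_mono r s h : r <= s -> Pos (r%:1 + h) -> Pos (s%:1 + h).
Proof.
move=> rs p; have -> : s%:1 + h = (s - r)%:1 + (r%:1 + h).
  by rewrite addrA -scalerDl -rmorphD /= subrK.
by apply: pos_add => //; apply: pos_r; rewrite subr_ge0.
Qed.

Lemma pos_inv h e : 0 < e -> Pos (h - e%:1) -> exists v, h * v = 1 /\ v * h = 1.
Proof.
move=> e0 [sp [l l0 hl]].
have le0 : 0 < l + e by exact: addr_gt0.
have le0' : l + e != 0 by rewrite gt_eqF.
pose x := ((l + e)^-1)%:C *: (l%:1 - (h - e%:1)).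
pose rho := l / (l + e).
have x1 : nr x <= rho.
  rewrite nrZr ger0_norm ?invr_ge0 ?(ltW le0)// mulrC /rho.
  by rewrite ler_pM2r ?invr_gt0.
have rho0 : 0 <= rho by rewrite divr_ge0// ltW.
have rho1 : rho < 1 by rewrite ltr_pdivrMr// mul1r ltrDl.
have hx : h = (l + e)%:C *: (1 - x).
  rewrite /x scalerBr scalerA -rmorphM /= divff// scale1r.
  by rewrite rmorphD /= scalerDl; cstar.
pose u := fix u n : A := if n is m.+1 then 1 + x * u m else 0.
have cu n : x * u n = u n * x.
  by elim: n => [|n ih] /=; rewrite ?mulr0 ?mul0r// mulrDr mulrDl mulr1 mul1r -mulrA -ih.
have d0 : 1 - rho != 0 by rewrite gt_eqF// subr_gt0.
have du n : nr (u n.+1 - u n) <= (1 - rho ^+ n.+1) / (1 - rho) - (1 - rho ^+ n) / (1 - rho).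
  have -> : (1 - rho ^+ n.+1) / (1 - rho) - (1 - rho ^+ n) / (1 - rho) = rho ^+ n.
    by rewrite exprS; field.
  elim: n => [|n ih]; first by rewrite /= mulr0 addr0 subr0 expr0 nr1_le.
  have -> : u n.+2 - u n.+1 = x * (u n.+1 - u n).
    by rewrite mulrBr /= opprD addrACA subrr add0r.
  apply: le_trans (nr_mul _ _) _; rewrite exprS.
  by apply: ler_pM; rewrite ?nr_ge0.
have [S uS] : exists S, lim_to u S.
  apply: (seq_complete_dom (M := 1 / (1 - rho)) du) => n.
  by rewrite ler_pM2r ?invr_gt0 ?subr_gt0// gerBl exprn_ge0.
have eS : S = 1 + x * S.
  apply: (lim_uniq (lim_shift uS)); apply: limD; first exact: lim_cst.
  exact: limMl.
have cS : x * S = S * x.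
  apply: (lim_uniq (limMl x uS)).
  have e' : (fun n => x * u n) = (fun n => u n * x) by apply/funext => n; exact: cu.
  by rewrite e'; exact: limMr.
have S1 : (1 - x) * S = 1 by rewrite mulrBl mul1r {1}eS addrK.
have S2 : S * (1 - x) = 1 by rewrite mulrBr mulr1 -cS {1}eS addrK.
exists (((l + e)^-1)%:C *: S); rewrite hx; split.
  by rewrite -scaleMl -scaleMr S1 scalerA -rmorphM /= divff// scale1r.
by rewrite -scaleMl -scaleMr S2 scalerA -rmorphM /= mulVf// scale1r.
Qed.

(* The positive part of the spectrum of [star y * y] is that of [y * star y]. *)
Lemma pos_swap y M : 0 <= M -> Pos (M%:1 - star y * y) -> Pos (M%:1 - y * star y).
Proof.
move=> M0 pM; have sk := sa_star' y.
pose S := [set s | Pos (s%:1 - y * star y)].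
have [pS|] := pselect (exists2 s, s < M & S s).
  case: pS => s sM; rewrite /S /= => ps; exact: pos_mono (ltW sM) ps.
move=> nS; have lbS : lbound S M.
  by move=> s Ss; rewrite leNgt; apply/negP => sM; apply: nS; exists s.
have S0 : S !=set0 by exists (nr (y * star y)); exact: pos_order_unit.
have hi : has_inf S by split => //; exists M.
pose r := inf S.
have rM : M <= r by exact: lb_le_inf.
have pr : Pos (r%:1 - y * star y).
  apply: pos_eps => e e0; have [s Ss sr] := inf_adherent e0 hi.
  have := pos_mono (ltW sr) Ss.
  by congr Pos; rewrite /r rmorphD /= scalerDl addrAC.
have [rM'|rM'] := leP r M.
  by have <- : r = M by apply/eqP; rewrite eq_le rM rM'.
exfalso.
have r0 : 0 < r by exact: le_lt_trans M0 rM'.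
have pc : Pos ((r%:1 - star y * y) - (r - M)%:1).
  by move: pM; congr Pos; rewrite rmorphB /= scalerBl; cstar.
have [v [v1 v2]] : exists v, (r%:1 - star y * y) * v = 1 /\ v * (r%:1 - star y * y) = 1.
  by apply: pos_inv pc; rewrite subr_gt0.
have r0' : r != 0 by rewrite gt_eqF.
have rV : (r^-1)%:C * r%:C = 1 :> R[i] by rewrite -rmorphM /= mulVf.
pose w := (r^-1)%:C *: (1 + y * v * star y).
pose g := r%:1 - y * star y.
have w1 : g * w = 1.
  have e1 : y * (r%:1 - star y * y) * v * star y = y * star y by rewrite -(mulrA y) v1 mulr1.
  have -> : g * w = (r^-1)%:C *: (r%:1 - y * star y
       + y * (r%:1 - star y * y) * v * star y) by rewrite /g /w; cstar.
  by rewrite e1 subrK scalerA rV scale1r.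
have w2 : w * g = 1.
  have e1 : y * (v * (r%:1 - star y * y)) * star y = y * star y by rewrite v2 mulr1.
  have -> : w * g = (r^-1)%:C *: (r%:1 - y * star y
       + y * (v * (r%:1 - star y * y)) * star y) by rewrite /g /w; cstar.
  by rewrite e1 subrK scalerA rV scale1r.
have sg : sa g by exact: pos_sa pr.
have sw : sa w.
  by rewrite /sa -[star w]mulr1 -w1 mulrA -{1}sg -starMr w1 star1 mul1r.
pose k := nr w + 1.
have k0 : 0 < k by rewrite /k ltr_wpDl// nr_ge0.
have pk : Pos (k%:1 - w) by apply: pos_order_unit => //; rewrite /k lerDl.
have p1 : Pos (g * (k%:1 - w)).
  by apply: pos_mul => //; rewrite mulrBr [RHS]mulrBl w1 w2 -scaleMl -scaleMr mulr1 mul1r.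
have p2 : S (r - k^-1).
  rewrite /S /=; have := posZ (ltW (_ : 0 < k^-1)) p1.
  rewrite invr_gt0 => /(_ k0); congr Pos.
  rewrite mulrBr w1 -scaleMr mulr1 scalerBr scalerA -rmorphM /= mulVf ?gt_eqF//.
  by rewrite scale1r rmorphB /= scalerBl /g addrAC.
have : inf S <= r - k^-1 by apply: ge_inf => //; exists M.
by rewrite -/r lerBrDl gerDr leNgt invr_gt0 k0.
Qed.

Lemma pos_star_sum y : Pos (star y * y + y * star y).
Proof.
pose a := (2^-1)%:C *: (y + star y).
pose b := ((2^-1)%:C * 'i) *: (y - star y).
have s_a : sa a by rewrite /sa starZr starD starK addrC.
have s_b : sa b.
  rewrite /sa starZc cjM cjr conj_i starB starK.
  by rewrite mulrN scaleNr -scalerN opprB.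
have -> : star y * y + y * star y = 2%:C *: (a * a + b * b).
  have -> : b * b = - ((2^-1)%:C * (2^-1)%:C) *: ((y - star y) * (y - star y)).
    rewrite /b -scaleMl -scaleMr scalerA; congr (_ *: _).
    by rewrite mulrACA ii mulrN1.
  by rewrite /a; cstar_red; repeat split; field.
by apply: posZ => //; apply: pos_add; exact: pos_sq.
Qed.

Lemma pos_star_bound y M : 0 <= M -> Pos (M%:1 - star y * y) ->
  Pos (M%:1 + star y * y).
Proof.
move=> M0 /(pos_swap M0) p.
have := pos_add p (pos_star_sum y); congr Pos.
by rewrite [star y * y + _]addrC addrA subrK.
Qed.

(* If the negative part of [star y * y] were at most [k] times its positive part
   for all [y], then so it would with [4 / 27 * k]: apply the bound to
   [y * (M - star y * y)].                                                    *)
Lemma pos_star_amplify (k : R) :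
  (forall y M, 0 < M -> Pos (M%:1 - star y * y) -> Pos ((k * M)%:1 + star y * y)) ->
  forall y M, 0 < M -> Pos (M%:1 - star y * y) ->
    Pos ((4 / 27 * k * M)%:1 + star y * y).
Proof.
move=> H y M M0 pM; pose h := star y * y.
have sh : sa h := sa_star y.
pose d := M%:1 - h.
have sd : sa d by apply: saB => //; exact: sar.
have hM : 0 <= M / 3 by rewrite divr_ge0// ltW.
have e1 : star (y * d) * (y * d) = d * h * d.
  by rewrite starMr sd /h !mulrA.
have M'0 : 0 < 4 / 27 * M ^+ 3 by rewrite !mulr_gt0 ?exprn_gt0 ?invr_gt0.
have q : Pos ((4 / 27 * M ^+ 3)%:1 - d * h * d).
  have p1 : Pos ((h - (M / 3)%:1) * (h - (M / 3)%:1)).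
    by apply: pos_sq; apply: saB => //; exact: sar.
  have p2 : Pos ((M / 3)%:1 + d) by apply: pos_add => //; exact: pos_r.
  have c : (h - (M / 3)%:1) * (h - (M / 3)%:1) * ((M / 3)%:1 + d)
     = ((M / 3)%:1 + d) * ((h - (M / 3)%:1) * (h - (M / 3)%:1)).
    by rewrite /d; move: h {e1 d sd sh p1 p2 pM} => h; cstar.
  have := pos_mul p1 p2 c; congr Pos; rewrite /d.
  move: h {c e1 d sd sh p1 p2 pM} => h; cstar_red; repeat split; by field.
have := H (y * d) _ M'0; rewrite e1 => /(_ q) p.
have p3 : Pos (h * h * (M%:1 + d)).
  apply: pos_mul; [exact: pos_sq|apply: pos_add => //; exact/pos_r/ltW|].
  by rewrite /d; move: h {p q e1 d sd sh pM} => h; cstar.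
have M20 : M ^+ 2 != 0 by rewrite expf_neq0// gt_eqF.
have M2 : 0 <= (M ^+ 2)^-1 by rewrite invr_ge0 sqr_ge0.
have -> : (4 / 27 * k * M)%:1 + h =
    ((M ^+ 2)^-1)%:C *: ((k * (4 / 27 * M ^+ 3))%:1 + (M ^+ 2)%:C *: h).
  rewrite scalerDr !scalerA -!rmorphM /= mulVf// scale1r; congr (_%:C *: _ + _).
  by field; rewrite gt_eqF.
apply: posZ => //; have := pos_add p p3; congr Pos.
by rewrite /d; move: h {p p3 q e1 d sd sh pM} => h; cstar.
Qed.

Lemma pos_star y : Pos (star y * y).
Proof.
have H n y' M : 0 < M -> Pos (M%:1 - star y' * y') ->
    Pos (((4 / 27) ^+ n * M)%:1 + star y' * y').
  elim: n y' M => [|n ih] y' M M0 p.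
    by rewrite expr0 mul1r; apply: pos_star_bound => //; exact: ltW.
  by rewrite exprS; apply: pos_star_amplify.
pose M := nr (star y * y) + 1.
have M0 : 0 < M by rewrite /M ltr_wpDl// nr_ge0.
have pM : Pos (M%:1 - star y * y).
  by apply: pos_order_unit; [exact: sa_star|rewrite /M lerDl].
apply: pos_eps => e e0.
have [n hn] : exists n, (4 / 27) ^+ n * M <= e.
  have q1 : `|4 / 27 : R| < 1 by rewrite ger0_norm; lra.
  have := cvg_expr q1 => /cvgrPdist_lt /(_ (e / M) (divr_gt0 e0 M0)) [n _ hn].
  exists n; move: (hn n (leqnn n)) => /=; rewrite sub0r normrN ltr_pdivlMr//.
  by move/ltW; apply: le_trans; rewrite ler_wpM2r ?(ltW M0)// ler_norm.
by rewrite addrC; apply: pos_mono hn _; exact: H.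
Qed.

Lemma pos_norm_diff y : Pos ((nr y ^+ 2)%:1 - star y * y).
Proof. by apply: pos_order_unit; [exact: sa_star|rewrite nr_starM]. Qed.

Lemma pos_norm_sqrt y : exists z, sa z /\ z * z = (nr y ^+ 2)%:1 - star y * y.
Proof. by have [z [sz _ zz _]] := pos_sqrt (pos_norm_diff y); exists z. Qed.

End Positivity.

(** * Hahn-Banach theorem and states *)

Definition clinear (R : realType) (W : lmodType R[i]) (F : W -> R[i]) :=
  {morph F : x y / x + y} /\ forall k x, F (k *: x) = k * F x.

Section HahnBanach.
Variables (R : realType) (V : lmodType R[i]).
Implicit Types (x y v : V) (p q : V -> R).

Definition sublinear q :=
  (forall x y, q (x + y) <= q x + q y) /\
  (forall a x, 0 < a -> q (a%:C *: x) <= a * q x).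

Lemma sublinear0 q : sublinear q -> q 0 = 0.
Proof.
case=> _ h; have h1 := h 2 0 (ltr0Sn _ _); have h2 := h (2^-1) 0.
have {}h2 := h2 (_ : 0 < 2^-1); move: h2; rewrite invr_gt0 ltr0Sn => /(_ isT).
by move: h1; rewrite !scaler0; lra.
Qed.

Lemma sublinear_lb q x : sublinear q -> - q (- x) <= q x.
Proof.
move=> sq; have := sq.1 x (- x); rewrite subrr (sublinear0 sq); lra.
Qed.

Lemma sublinear_inf (S : V -> set R) (b : V -> R) :
  (forall x, S x !=set0) -> (forall x, lbound (S x) (b x)) ->
  (forall x y r s, S x r -> S y s -> exists2 t, S (x + y) t & t <= r + s) ->
  (forall a x r, 0 < a -> S x r -> S (a%:C *: x) (a * r)) ->
  sublinear (fun x => inf (S x)).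
Proof.
move=> S0 Sb SD SZ; have hi x : has_inf (S x) by split => //; exists (b x).
split=> [x y|a x a0].
  apply/ler_addgt0Pr => e e0; have e2 : 0 < e / 2 by rewrite divr_gt0.
  have [r Sr hr] := inf_adherent e2 (hi x).
  have [s Ss hs] := inf_adherent e2 (hi y).
  have [t St ht] := SD _ _ _ _ Sr Ss.
  have : inf (S (x + y)) <= t by apply: ge_inf => //; exact: (hi _).2.
  by move: hr hs ht; lra.
apply/ler_addgt0Pr => e e0; have ea : 0 < e / a by rewrite divr_gt0.
have [r Sr hr] := inf_adherent ea (hi x).
have : inf (S (a%:C *: x)) <= a * r by apply: ge_inf (SZ _ _ _ a0 Sr); exact: (hi _).2.
move=> h; apply: le_trans h _; move/ltW : hr; rewrite -(ler_pM2l a0) => h.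
by apply: le_trans h _; rewrite mulrDr mulrCA divff ?mulr1// gt_eqF.
Qed.

Lemma sublinear_minimal q : sublinear q ->
  exists2 p, sublinear p /\ (forall x, p x <= q x) &
  forall p', sublinear p' -> (forall x, p' x <= p x) -> p' = p.
Proof.
move=> sq.
pose T := {p : V -> R | sublinear p /\ forall x, p x <= q x}.
pose le (s t : T) : bool := `[< forall x, sval t x <= sval s x >].
have [||||t ht] := @Zorn T le.
- by move=> t; apply/asboolP.
- move=> r s t /asboolP h1 /asboolP h2; apply/asboolP => x.
  exact: le_trans (h2 x) (h1 x).
- move=> [s hs] [t ht] /asboolP /= h1 /asboolP /= h2.
  have e : s = t by apply/funext => x; apply/eqP; rewrite eq_le h1 h2.
  by move: hs ht h1 h2; rewrite e => hs ht _ _; congr exist; exact: Prop_irrelevance.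
- move=> C tC; have [[c0 Cc0]|nC] := pselect (exists c, C c); last first.
    by exists (exist _ q (conj sq (fun x => lexx (q x)))) => s Cs; case: nC; exists s.
  pose S x := [set r | exists2 t : T, C t & r = sval t x].
  have Sb x : lbound (S x) (- q (- x)).
    move=> _ [t _ ->]; have [st tq] := svalP t.
    by apply: le_trans (sublinear_lb x st); rewrite lerN2.
  have S0 x : S x !=set0 by exists (sval c0 x), c0.
  have ss : sublinear (fun x => inf (S x)).
    apply: (sublinear_inf S0 Sb) => [x y _ _ [t Ct ->] [t' Ct' ->]|a x _ a0 [t Ct ->]].
      have [/asboolP h|/asboolP h] := tC _ _ Ct Ct'.
        exists (sval t' (x + y)); first by exists t'.
        by apply: le_trans ((svalP t').1.1 _ _) _; rewrite lerD2r.
      exists (sval t (x + y)); first by exists t.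
      by apply: le_trans ((svalP t).1.1 _ _) _; rewrite lerD2l.
    exists t => //; apply/eqP; rewrite eq_le ((svalP t).1.2 _ _ a0) andbT.
    have ai : 0 < a^-1 by rewrite invr_gt0.
    have := (svalP t).1.2 _ (a%:C *: x) ai.
    rewrite scalerA -rmorphM /= mulVf ?gt_eqF// scale1r.
    by rewrite -(ler_pM2l a0) mulrA divff ?gt_eqF// mul1r.
  have lq x : inf (S x) <= q x.
    have [_ cq] := svalP c0; apply: le_trans (cq x).
    by apply: ge_inf; [exists (- q (- x))|exists c0].
  pose cl := exist (fun p => sublinear p /\ forall x, p x <= q x)
    (fun x => inf (S x)) (conj ss lq).
  exists cl => s Cs; apply/asboolP => x /=.
  by apply: ge_inf; [exists (- q (- x))|exists s].
- have [st tq] := svalP t; exists (sval t) => // p' sp' pt.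
  have p'q x : p' x <= q x by exact: le_trans (pt x) (tq x).
  pose t' : T := exist (fun p => sublinear p /\ forall x, p x <= q x)
    p' (conj sp' p'q).
  by have /(congr1 sval) : t' = t by apply: ht; apply/asboolP.
Qed.

Lemma sublinear_dominates q : sublinear q ->
  exists f : V -> R, [/\ {morph f : x y / x + y},
    forall a x, f (a%:C *: x) = a * f x & forall x, f x <= q x].
Proof.
move=> /sublinear_minimal[p [sp pq] pmin].
have pZ a x : 0 < a -> p (a%:C *: x) = a * p x.
  move=> a0; apply/eqP; rewrite eq_le sp.2//=.
  have ai : 0 < a^-1 by rewrite invr_gt0.
  have := sp.2 _ (a%:C *: x) ai.
  rewrite scalerA -rmorphM /= mulVf ?gt_eqF// scale1r.
  by rewrite -(ler_pM2l a0) mulrA divff ?gt_eqF// mul1r.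
have padd v x : p (x + v) = p x + p v.
  apply/eqP; rewrite eq_le sp.1 /=.
  pose S y := [set r | exists2 t : R, 0 <= t & r = p (y + t%:C *: v) - t * p v].
  have S0 y : S y !=set0 by exists (p y), 0; rewrite // scale0r addr0 mul0r subr0.
  have Sb y : lbound (S y) (- p (- y)).
    move=> _ [t t0 ->]; have : p (t%:C *: v) <= p (y + t%:C *: v) + p (- y).
      by apply: le_trans (sp.1 _ _); rewrite addrAC subrr add0r.
    have [->|tn] := eqVneq t 0.
      by rewrite scale0r (sublinear0 sp) addr0 mul0r; lra.
    by rewrite pZ ?lt_def ?tn//; lra.
  have sS : sublinear (fun y => inf (S y)).
    apply: (sublinear_inf S0 Sb) => [y z _ _ [t t0 ->] [s s0 ->]|a y _ a0 [t t0 ->]].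
      exists (p (y + z + (t + s)%:C *: v) - (t + s) * p v).
        by exists (t + s) => //; exact: addr_ge0.
      have := sp.1 (y + t%:C *: v) (z + s%:C *: v).
      by rewrite rmorphD /= scalerDl addrACA; lra.
    exists (a * t); first by rewrite mulr_ge0// ltW.
    by rewrite rmorphM /= -scalerA -scalerDr pZ//; ring.
  have Sp y : inf (S y) <= p y.
    apply: ge_inf; first by exists (- p (- y)).
    by exists 0; rewrite // scale0r addr0 mul0r subr0.
  have e : inf (S x) = p x by have /(congr1 (fun g => g x)) := pmin _ sS Sp.
  rewrite -lerBrDr -{1}e.
  apply: ge_inf; first by exists (- p (- x)).
  by exists 1; rewrite // scale1r mul1r.
exists p; split => [x y|a x|//]; first exact: padd.
have pN y : p (- y) = - p y.
  by have := padd y (- y); rewrite addNr (sublinear0 sp); lra.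
have [->|a0] := eqVneq a 0; first by rewrite scale0r (sublinear0 sp) mul0r.
case: (ltP 0 a) => [/pZ//|a0'].
have na : 0 < - a by rewrite oppr_gt0 lt_def eq_sym a0.
have := pZ _ x na; rewrite rmorphN /= scaleNr pN; lra.
Qed.

Lemma hahn_banach_cone (S : V -> set R) (b : V -> R) :
  (forall x, S x !=set0) -> (forall x, lbound (S x) (b x)) ->
  (forall x y r s, S x r -> S y s -> S (x + y) (r + s)) ->
  (forall a x r, 0 < a -> S x r -> S (a%:C *: x) (a * r)) ->
  exists f : V -> R, [/\ {morph f : x y / x + y},
    forall a x, f (a%:C *: x) = a * f x & forall x r, S x r -> f x <= r].
Proof.
move=> S0 Sb SD SZ.
have sq : sublinear (fun x => inf (S x)).
  apply: (sublinear_inf S0 Sb) => // x y r s Sr Ss.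
  by exists (r + s) => //; exact: SD.
have [f [fD fZ fS]] := sublinear_dominates sq.
exists f; split => // x r Sr; apply: le_trans (fS x) _.
by apply: ge_inf => //; exists (b x).
Qed.

Lemma complexify (f : V -> R) : {morph f : x y / x + y} ->
  (forall a x, f (a%:C *: x) = a * f x) ->
  clinear (fun x => (f x)%:C - 'i * (f ('i *: x))%:C).
Proof.
move=> fD fZ; split=> [x y|k x].
  by rewrite !scalerDr !fD !rmorphD /=; ring.
have fN x' : f (- x') = - f x'.
  by have := fZ (-1) x'; rewrite rmorphN /= scaleN1r mulN1r.
have fk z u : f (z *: u) = complex.Re z * f u + complex.Im z * f ('i *: u).
  rewrite {1}[z]complexE scalerDl fD fZ; congr (_ + _).
  by rewrite mulrC -scalerA fZ.
rewrite scalerA (fk k x) (fk ('i * k) x).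
have -> : complex.Re ('i * k) = - complex.Im k by case: k => a c /=; ring.
have -> : complex.Im ('i * k) = complex.Re k by case: k => a c /=; ring.
rewrite {3}[k]complexE; case: k => a c /=.
by apply/eqP; rewrite eq_complex /=; apply/andP; split; apply/eqP; ring.
Qed.

End HahnBanach.

Section PreHilbert.
Variable R : realType.

(* No linear structure is required of the carrier: the form sees only its
   quotient by the vectors of norm zero.                                      *)
Record prehilbert := PreHilbert {
  ph_sort :> Type;
  ph_point : ph_sort;
  ph_add : ph_sort -> ph_sort -> ph_sort;
  ph_scl : R[i] -> ph_sort -> ph_sort;
  ph_form : ph_sort -> ph_sort -> R[i];
  ph_formD : forall x y z, ph_form (ph_add x y) z = ph_form x z + ph_form y z;
  ph_formZ : forall k x z, ph_form (ph_scl k x) z = k * ph_form x z;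
  ph_formC : forall x y, ph_form x y = conjc (ph_form y x);
  ph_form_ge0 : forall x, 0 <= ph_form x x }.

Variable T : prehilbert.
Implicit Types x y z : T.

Definition pn x : R := Num.sqrt (complex.Re (ph_form x x)).

Lemma ge0_Re (z : R[i]) : 0 <= z -> z = (complex.Re z)%:C.
Proof. by move=> h; rewrite RRe_real// ger0_real. Qed.

Lemma Re_ge0 (z : R[i]) : 0 <= z -> 0 <= complex.Re z.
Proof. by move=> h; move: (h); rewrite {1}(ge0_Re h) ler0c. Qed.

Lemma ph_formDr x y z : ph_form x (ph_add y z) = ph_form x y + ph_form x z.
Proof. by rewrite ph_formC ph_formD cjD -!ph_formC. Qed.

Lemma ph_formZr k x z : ph_form x (ph_scl k z) = conjc k * ph_form x z.
Proof. by rewrite ph_formC ph_formZ cjM -!ph_formC. Qed.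

Lemma pn_ge0 x : 0 <= pn x.
Proof. exact: sqrtr_ge0. Qed.

Lemma pn2 x : pn x ^+ 2 = complex.Re (ph_form x x).
Proof. by rewrite sqr_sqrtr// Re_ge0// ph_form_ge0. Qed.

Lemma ph_form_pn x : ph_form x x = (pn x ^+ 2)%:C.
Proof. by rewrite pn2 -ge0_Re// ph_form_ge0. Qed.

Lemma pn2_add k x y : pn (ph_add x (ph_scl k y)) ^+ 2 =
  pn x ^+ 2 + 2 * complex.Re (conjc k * ph_form x y) + nr k ^+ 2 * pn y ^+ 2.
Proof.
rewrite !pn2 ph_formDr !ph_formD !ph_formZr !ph_formZ (ph_formC y x) !ph_form_pn.
rewrite nr2; move: (ph_form x y) (pn x) (pn y) => [a b] p q.
by case: k => c d /=; ring.
Qed.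

Lemma ph_CS x y : nr (ph_form x y) <= pn x * pn y.
Proof.
rewrite -(ler_pXn2r (ltn0Sn 1)) ?nnegrE ?nr_ge0 ?mulr_ge0 ?pn_ge0// exprMn.
set c := ph_form x y.
have key (t : R) : 0 <= pn x ^+ 2 - 2 * t * nr c ^+ 2 + t ^+ 2 * nr c ^+ 2 * pn y ^+ 2.
  have := sqr_ge0 (pn (ph_add x (ph_scl ((- t)%:C * c) y))).
  rewrite pn2_add -/c nrM exprMn nr_real real_normK ?num_real// sqrrN.
  have -> : complex.Re (conjc ((- t)%:C * c) * c) = - t * nr c ^+ 2.
    by rewrite cjM cjr -mulrA [conjc c * c]mulrC -sqr_nr -rmorphM.
  lra.
have [y0|y0] := eqVneq (pn y ^+ 2) 0.
  have [c0|c0] := eqVneq (nr c ^+ 2) 0; first by rewrite c0 mulr_ge0// sqr_ge0.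
  have := key ((pn x ^+ 2 + 1) / (2 * nr c ^+ 2)); rewrite y0 mulr0 addr0.
  rewrite (_ : 2 * _ * _ = pn x ^+ 2 + 1); last by field; rewrite -sqrf_eq0.
  lra.
have yp : 0 < pn y ^+ 2 by rewrite lt_def y0 sqr_ge0.
have := key (pn y ^+ 2)^-1.
rewrite (_ : _ + _ = pn x ^+ 2 - nr c ^+ 2 / pn y ^+ 2); last by field; rewrite -sqrf_eq0.
by rewrite subr_ge0 ler_pdivrMr.
Qed.

Lemma pn_scl k x : pn (ph_scl k x) = nr k * pn x.
Proof.
apply/eqP; rewrite -(eqrXn2 (ltn0Sn 1)) ?pn_ge0 ?mulr_ge0 ?nr_ge0 ?pn_ge0//.
rewrite pn2 ph_formZr ph_formZ ph_form_pn exprMn mulrA [conjc k * k]mulrC.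
by rewrite -sqr_nr -rmorphM.
Qed.

End PreHilbert.

Section PositiveFunctionals.
Variables (R : realType) (A : cstarAlgType R).
Implicit Types (x y z w h a b : A) (r s l M : R) (F : A -> R[i]).

Local Notation "r %:1" := (r%:C *: (1 : A)) (at level 2, format "r %:1").

Definition pfun F := clinear F /\ forall x, 0 <= F (star x * x).

Lemma clin0 F : clinear F -> F 0 = 0.
Proof. by case=> _ h; have := h 0 0; rewrite scale0r mul0r. Qed.
Lemma clinN F x : clinear F -> F (- x) = - F x.
Proof. by case=> _ h; have := h (-1) x; rewrite scaleN1r mulN1r. Qed.
Lemma clinB F x y : clinear F -> F (x - y) = F x - F y.
Proof. by move=> h; rewrite h.1 clinN. Qed.
Lemma clin_sum F (I : Type) (l : seq I) (P : pred I) (f : I -> A) : clinear F ->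
  F (\sum_(i <- l | P i) f i) = \sum_(i <- l | P i) F (f i).
Proof.
by move=> h; apply: (big_morph F); [exact: h.1|exact: clin0].
Qed.

Lemma star_sum (I : Type) (l : seq I) (P : pred I) (f : I -> A) :
  star (\sum_(i <- l | P i) f i) = \sum_(i <- l | P i) star (f i).
Proof. exact: (big_morph (@star R A) (@starD R A) (star0 A)). Qed.

Lemma pfun_formC F x y : pfun F -> F (star y * x) = conjc (F (star x * y)).
Proof.
move=> [lF pF]; have im u : complex.Im (F (star u * u)) = 0 by rewrite ger0_Im.
have := im (x + y); have := im (x + 'i *: y); have := im x; have := im y.
rewrite !starD starZc !mulrDl !mulrDr -!scaleMr -!scaleMl !lF.1 !lF.2 conj_i.
move: (F (star x * y)) (F (star y * x)) (F (star y * y)) (F (star x * x)).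
move=> [a b] [c d] [e f] [g k] /= h1 h2 h3 h4.
by apply/eqP; rewrite eq_complex /=; apply/andP; split; apply/eqP;
   move: h1 h2 h3 h4; lra.
Qed.

Definition pfun_ph F (pF : pfun F) : prehilbert R.
Proof.
refine (@PreHilbert R A 0 +%R (fun k x => k *: x) (fun x y => F (star y * x)) _ _ _ _).
- by move=> x y z; rewrite mulrDr pF.1.1.
- by move=> k x z; rewrite -scaleMr pF.1.2.
- by move=> x y; exact: pfun_formC.
- by move=> x; exact: pF.2.
Defined.

(* [|a|^2 - star a * a] is a square. *)
Lemma pfun_bound F a x : pfun F ->
  complex.Re (F (star (a * x) * (a * x))) <= nr a ^+ 2 * complex.Re (F (star x * x)).
Proof.
move=> pF; have [z [sz zz]] := pos_norm_sqrt a.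
have := Re_ge0 (pF.2 (z * x)).
have -> : star (z * x) * (z * x) =
    (nr a ^+ 2)%:C *: (star x * x) - star (a * x) * (a * x).
  rewrite !starMr sz -(mulrA (star x)) (mulrA z) zz.
  by rewrite mulrBl mulrBr -scaleMl mul1r -scaleMr !mulrA.
rewrite (clinB _ _ pF.1) pF.1.2 raddfB /= subr_ge0.
by case: (F (star x * x)) => u v /=; rewrite mul0r subr0.
Qed.

Lemma pfun_CS F x y : pfun F ->
  nr (F (star y * x)) ^+ 2 <= complex.Re (F (star x * x)) * complex.Re (F (star y * y)).
Proof.
move=> pF; have := @ph_CS R (pfun_ph pF) x y.
rewrite -(ler_pXn2r (ltn0Sn 1)) ?nnegrE ?nr_ge0 ?mulr_ge0 ?pn_ge0//.
by rewrite exprMn !pn2.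
Qed.

Lemma pfun_le F x : pfun F -> nr (F x) <= complex.Re (F 1) * nr x.
Proof.
move=> pF; have F1 : 0 <= complex.Re (F 1).
  by have := Re_ge0 (pF.2 1); rewrite star1 mulr1.
rewrite -(ler_pXn2r (ltn0Sn 1)) ?nnegrE ?nr_ge0 ?mulr_ge0 ?nr_ge0//.
have := pfun_CS x 1 pF; rewrite star1 !mul1r => /le_trans; apply.
have := pfun_bound x 1 pF; rewrite !mulr1 star1 => h.
by rewrite exprMn expr2 -mulrA mulrC ler_wpM2l// mulrC.
Qed.

Definition re_part x : A := (2^-1)%:C *: (x + star x).

Lemma re_partD x y : re_part (x + y) = re_part x + re_part y.
Proof. by rewrite /re_part starD addrACA scalerDr. Qed.
Lemma re_partZ r x : re_part (r%:C *: x) = r%:C *: re_part x.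
Proof. by rewrite /re_part starZr -scalerDr !scalerA mulrC. Qed.
Lemma re_part_sa x : sa x -> re_part x = x.
Proof.
move=> sx; rewrite /re_part sx scalerDr -scalerDl -rmorphD /=.
by rewrite (_ : 2^-1 + 2^-1 = 1) ?scale1r//; field.
Qed.
Lemma sa_re_part x : sa (re_part x).
Proof. by rewrite /sa /re_part starZr starD starK addrC. Qed.
Lemma nr_re_part x : nr (re_part x) <= nr x.
Proof.
rewrite /re_part nrZr ger0_norm ?invr_ge0// mulrC ler_pdivrMr//.
by apply: le_trans (nrD _ _) _; rewrite nr_star; lra.
Qed.

Lemma scalar_pos_ge0 r : (1 : A) != 0 -> Pos (r%:1) -> 0 <= r.
Proof.
move=> n1 p; rewrite leNgt; apply/negP => r0.
have p' : Pos ((- r)%:1) by apply: pos_r; rewrite oppr_ge0 ltW.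
have p2 : Pos (- (r%:1)) by rewrite -scaleNr -rmorphN.
have /eqP := posN_eq0 p p2.
rewrite scaler_eq0 (negPf n1) orbF => /eqP e.
have re : r = 0 by apply: (@complexI R).
by move: r0; rewrite re ltxx.
Qed.

Lemma enough_states z : z != 0 ->
  exists F, [/\ pfun F, F 1 = 1 & F (star z * z) = (nr z ^+ 2)%:C].
Proof.
move=> z0; pose h := star z * z; pose Q := nr z ^+ 2.
have n1 : (1 : A) != 0.
  by apply: contra z0 => /eqP e; rewrite -(mul1r z) e mul0r.
have ph : Pos h := pos_star z.
have nh : nr h = Q by exact: nr_starM.
have Q0 : 0 <= Q by exact: sqr_ge0.
pose S x := [set v | exists s t : R, v = s - t * Q /\ Pos (s%:1 - re_part x - t%:C *: h)].
have S0 x : S x !=set0.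
  exists (nr x - 0 * Q), (nr x), 0; split => //; rewrite scale0r subr0.
  by apply: pos_order_unit; [exact: sa_re_part|exact: nr_re_part].
have Sb x : lbound (S x) (- nr x).
  move=> _ [s [t [-> p]]].
  have p1 : Pos ((s + nr x)%:1 - t%:C *: h).
    have q : Pos ((nr x)%:1 + re_part x).
      rewrite -[re_part x]opprK; apply: pos_order_unit; first exact/saN/sa_re_part.
      by rewrite nrN; exact: nr_re_part.
    by have := pos_add p q; congr Pos; rewrite rmorphD /= scalerDl; cstar.
  suff : t * Q <= s + nr x by lra.
  have [t0|t0] := leP t 0.
    have p2 : Pos ((- t)%:C *: (Q%:1 - h)).
      by apply: posZ; [rewrite oppr_ge0|apply: pos_order_unit; [exact: pos_sa ph|rewrite nh]].
    have : Pos ((s + nr x - t * Q)%:1).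
      by have := pos_add p1 p2; congr Pos; cstar.
    by move/(scalar_pos_ge0 n1); lra.
  have p3 : Pos ((s + nr x)%:1).
    by have := pos_add p1 (posZ (ltW t0) ph); rewrite subrK.
  have s0 := scalar_pos_ge0 n1 p3.
  rewrite -ler_pdivlMl// -nh; apply: norm_le_pos.
  - by rewrite mulr_ge0// invr_ge0 ltW.
  - have ti : 0 <= t^-1 by rewrite invr_ge0 ltW.
    have := posZ ti p1; congr Pos.
    by rewrite scalerBr !scalerA -!rmorphM /= mulVf ?gt_eqF// scale1r.
  - by apply: pos_add => //; apply: pos_r; rewrite mulr_ge0// invr_ge0 ltW.
have [f [fD fZ fS]] : exists f : A -> R, [/\ {morph f : x y / x + y},
    forall (c : R) x, f (c%:C *: x) = c * f x & forall x r, S x r -> f x <= r].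
  apply: (hahn_banach_cone S0 Sb).
    move=> x y _ _ [s [t [-> p]]] [s' [t' [-> p']]]; exists (s + s'), (t + t').
    split; first ring.
    by have := pos_add p p'; congr Pos; rewrite re_partD !rmorphD /= !scalerDl; cstar.
  move=> a x _ a0 [s [t [-> p]]]; exists (a * s), (a * t); split; first ring.
  have := posZ (ltW a0) p; congr Pos.
  by rewrite re_partZ !rmorphM /= !scalerBr !scalerA.
have fN x : f (- x) = - f x.
  by have := fZ (-1) x; rewrite rmorphN /= scaleN1r mulN1r.
have fpos k : Pos k -> 0 <= f k.
  move=> pk; rewrite -oppr_le0 -fN; apply: fS; exists 0, 0; split; first by rewrite mul0r subr0.
  by rewrite !scale0r sub0r subr0 re_part_sa ?opprK//; exact/saN/pos_sa.
have f1 : f 1 = 1.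
  apply/eqP; rewrite eq_le; apply/andP; split.
    apply: fS; exists 1, 0; split; first by rewrite mul0r subr0.
    by rewrite scale0r subr0 scale1r re_part_sa ?subrr; [exact: pos0|exact: sa1].
  rewrite -lerN2 -fN; apply: fS; exists (-1), 0; split; first by rewrite mul0r subr0.
  rewrite scale0r subr0 rmorphN /= scaleNr scale1r re_part_sa ?opprK ?addNr;
    [exact: pos0|exact/saN/sa1].
have fh : f h = Q.
  have sh := pos_sa ph.
  apply/eqP; rewrite eq_le; apply/andP; split.
    apply: fS; exists 0, (-1); split; first ring.
    by rewrite scale0r sub0r re_part_sa// rmorphN /= scaleNr scale1r opprK addNr; exact: pos0.
  rewrite -lerN2 -fN; apply: fS; exists 0, 1; split; first ring.
  by rewrite scale0r sub0r re_part_sa ?opprK ?scale1r ?subrr; [exact: pos0|exact/saN].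
have fi k : sa k -> f ('i *: k) = 0.
  move=> sk; have e : re_part ('i *: k) = 0.
    by rewrite /re_part starZc conj_i sk -scalerDl addrN scale0r scaler0.
  apply/eqP; rewrite eq_le; apply/andP; split.
    by apply: fS; exists 0, 0; split; [ring|rewrite !scale0r e !subr0; exact: pos0].
  rewrite -oppr_le0 -fN; apply: fS; exists 0, 0; split; first ring.
  have -> : re_part (- ('i *: k)) = 0.
    by move: e; rewrite /re_part starN -opprD scalerN => ->; rewrite oppr0.
  by rewrite !scale0r !subr0; exact: pos0.
exists (fun x => (f x)%:C - 'i * (f ('i *: x))%:C); split.
- split; first exact: complexify.
  by move=> x; rewrite fi ?mulr0 ?subr0 ?ler0c; [exact/fpos/pos_star|exact: sa_star].
- by rewrite fi ?f1 ?mulr0 ?subr0//; exact: sa1.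
- by rewrite fi ?mulr0 ?subr0 -/h ?fh//; exact: pos_sa.
Qed.

End PositiveFunctionals.

Section States.
Variables (R : realType) (A : cstarAlgType R).
Implicit Types (x y z : A) (F : A -> R[i]).

Lemma norm_le_states z (c : R) : 0 <= c ->
  (forall F, pfun F -> F 1 = 1 -> complex.Re (F (star z * z)) <= c ^+ 2) ->
  nr z <= c.
Proof.
move=> c0 H; have [->|z0] := eqVneq z 0; first by rewrite nr0.
have [F [pF F1 Fz]] := enough_states z0.
by have := H F pF F1; rewrite Fz /= ler_pXn2r ?nnegrE ?nr_ge0.
Qed.

Lemma clinear_scalar F : clinear F -> exists f : {scalar A}, forall x, f x = F x.
Proof.
move=> [FD FZ].
have lF : scalar F by move=> k x y; rewrite FD FZ.
pose f : {scalar A} := HB.pack F (GRing.isLinear.Build _ _ _ _ F lF).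
by exists f.
Qed.

Lemma ultra_lim (I : Type) (U : set_system I) (g : I -> R) (M : R) :
  UltraFilter U -> U [set i | `|g i| <= M] ->
  exists c, forall e, 0 < e -> U [set i | `|g i - c| < e].
Proof.
move=> UU gM; pose S := [set r | U [set i | r <= g i]].
have SM : S (- M).
  by apply: filterS gM => i /=; rewrite ler_norml => /andP[].
have Sub : ubound S M.
  move=> r Sr; have [i [/= ri gi]] := filter_ex (filterI Sr gM).
  by apply: le_trans ri _; apply: le_trans (ler_norm _) gi.
have hs : has_sup S by split; [exists (- M)|exists M].
exists (sup S) => e e0.
have [r Sr er] := sup_adherent e0 hs.
have nS : ~ S (sup S + e / 2).
  move=> h; have := ub_le_sup hs.2 h; have : 0 < e / 2 by rewrite divr_gt0.
  lra.
have {}nS : U (~` [set i | sup S + e / 2 <= g i]).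
  by case: (in_ultra_setVsetC [set i | sup S + e / 2 <= g i] UU).
have e2 : e / 2 < e by lra.
apply: filterS (filterI Sr nS) => i /= [h1 /negP]; rewrite -ltNge => h2.
by rewrite ltr_norml; apply/andP; split; lra.
Qed.

Lemma ultra_limC (I : Type) (U : set_system I) (g : I -> R[i]) (M : R) :
  UltraFilter U -> U [set i | nr (g i) <= M] ->
  exists c, forall e, 0 < e -> U [set i | nr (g i - c) < e].
Proof.
move=> UU gM.
have [a ha] : exists a, forall e : R, 0 < e -> U [set i | `|complex.Re (g i) - a| < e].
  apply: (ultra_lim (M := M)) => //; apply: filterS gM => i /=.
  exact/le_trans/Re_le_nr.
have [b hb] : exists b, forall e : R, 0 < e -> U [set i | `|complex.Im (g i) - b| < e].
  apply: (ultra_lim (M := M)) => //; apply: filterS gM => i /=.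
  apply/le_trans; rewrite -(ler_pXn2r (ltn0Sn 1)) ?nnegrE ?nr_ge0//.
  by rewrite nr2 real_normK ?num_real// lerDr sqr_ge0.
exists (a +i* b) => e e0; have e2 : 0 < e / 2 by rewrite divr_gt0.
apply: filterS (filterI (ha _ e2) (hb _ e2)) => i /= [h1 h2].
apply: le_lt_trans (nr_ReIm _) _; move: h1 h2.
by case: (g i) => u v /=; lra.
Qed.

Lemma states_compact (S : set (A * R)) :
  (forall l : seq (A * R), (forall p, p \in l -> S p) ->
     exists F, [/\ pfun F, F 1 = 1 & forall p, p \in l -> nr (F p.1) <= p.2]) ->
  exists F, [/\ pfun F, F 1 = 1 & forall p, S p -> nr (F p.1) <= p.2].
Proof.
move=> H.
pose good (l : seq (A * R)) := forall p, p \in l -> S p.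
have Hl (l : seq (A * R)) : exists F, good l ->
    [/\ pfun F, F 1 = 1 & forall p, p \in l -> nr (F p.1) <= p.2].
  have [gl|ngl] := pselect (good l); last by exists (fun=> 0).
  by have [F hF] := H l gl; exists F.
have [f hf] := choice Hl.
pose U0 : set_system (seq (A * R)) := fun X => exists2 l, good l &
  forall l', good l' -> {subset l <= l'} -> X l'.
have PU0 : ProperFilter U0.
  constructor.
    by move=> [l gl /(_ l gl)]; apply.
  constructor.
  - by exists [::].
  - move=> X Y [l gl hX] [m gm hY]; exists (l ++ m).
      by move=> p; rewrite mem_cat => /orP[/gl|/gm].
    move=> l' gl' sub; split.
      by apply: hX => // p pl; apply: sub; rewrite mem_cat pl.
    by apply: hY => // p pl; apply: sub; rewrite mem_cat pl orbT.
  - by move=> X Y XY [l gl hX]; exists l => // l' gl' sub; apply: XY; exact: hX.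
have [U [UU U0U]] := ultraFilterLemma PU0.
have Ug : U good by apply: U0U; exists [::].
have bnd x : U [set l | nr (f l x) <= nr x].
  apply: filterS Ug => l gl /=; have [pF F1 _] := hf l gl.
  by have := pfun_le x pF; rewrite F1 mul1r.
have /choice[F hF] : forall x, exists c, forall e : R, 0 < e ->
    U [set l | nr (f l x - c) < e].
  by move=> x; exact: (ultra_limC UU (bnd x)).
have close x c e : 0 < e -> U [set l | nr (f l x - c) <= e] -> nr (F x - c) <= e.
  move=> e0 h; apply/ler_addgt0Pr => d d0.
  have [l [/= h1 h2]] := filter_ex (filterI h (hF x _ d0)).
  apply: le_trans (nr_trans (f l x) _ _) _; rewrite nr_dist addrC.
  by apply: lerD => //; exact: ltW.
have small (z : R[i]) : (forall e : R, 0 < e -> nr z <= e) -> z = 0.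
  by move=> h; apply: nr_le0; apply/ler_addgt0Pr => e e0; rewrite add0r h.
have lF : clinear F.
  split=> [x y|k x]; apply/eqP; rewrite -subr_eq0; apply/eqP; apply: small => e e0.
    have e2 : 0 < e / 2 by rewrite divr_gt0.
    apply: close => //.
    apply: filterS (filterI Ug (filterI (hF x _ e2) (hF y _ e2))) => l /= [gl [h1 h2]].
    have [pF _ _] := hf l gl; rewrite pF.1.1 opprD addrACA.
    by apply: le_trans (nrD _ _) _; move: h1 h2; lra.
  have k0 : 0 < e / (nr k + 1) by rewrite divr_gt0// ltr_wpDl// nr_ge0.
  apply: close => //; apply: filterS (filterI Ug (hF x _ k0)) => l /= [gl h1].
  have [pF _ _] := hf l gl; rewrite pF.1.2 -mulrBr nrM.
  move: h1; rewrite ltr_pdivlMr ?ltr_wpDl ?nr_ge0// => h1.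
  apply: le_trans (ltW h1); rewrite mulrC ler_wpM2l ?nr_ge0// lerDl//.
have F1 : F 1 = 1.
  apply/eqP; rewrite -subr_eq0; apply/eqP; apply: small => e e0; apply: close => //.
  apply: filterS Ug => l gl /=; have [_ -> _] := hf l gl.
  by rewrite subrr nr0 ltW.
exists F; split => //.
- split => // x.
  have h (e : R) : 0 < e -> exists2 l, good l & nr (f l (star x * x) - F (star x * x)) < e.
    move=> e0; have [l [gl h]] := filter_ex (filterI Ug (hF (star x * x) _ e0)).
    by exists l.
  rewrite lecE /=; apply/andP; split.
    apply/eqP/esym; apply/eqP; rewrite eq_sym -normr_eq0 eq_le normr_ge0 andbT.
    apply/ler_addgt0Pr => e e0; rewrite add0r; have [l gl hl] := h e e0.
    have [pF _ _] := hf l gl; have := pF.2 x; move: hl.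
    case: (f l _) => a b; case: (F _) => c d hl; rewrite lecE /= => /andP[/eqP b0 _].
    apply: le_trans (ltW hl); rewrite -(ler_pXn2r (ltn0Sn 1)) ?nnegrE ?nr_ge0//.
    by rewrite nr2 real_normK ?num_real//= b0 sub0r sqrrN lerDr sqr_ge0.
  rewrite -oppr_le0; apply/ler_addgt0Pr => e e0; rewrite add0r; have [l gl hl] := h e e0.
  have [pF _ _] := hf l gl; have := pF.2 x; move: hl.
  case: (f l _) => a b; case: (F _) => c d hl; rewrite lecE /= => /andP[_ a0].
  by have := le_lt_trans (Re_nr _) hl; rewrite /=; lra.
- move=> [x r] Sx /=; apply/ler_addgt0Pr => e e0.
  pose p0 : (A * R)%type := (x, r).
  have Ul : U [set l : seq (A * R) | p0 \in l /\ good l].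
    apply: U0U; exists [:: p0].
      by move=> p; rewrite inE => /eqP ->.
    by move=> l gl sub; split => //; apply: sub; rewrite inE.
  have [l [[xl gl] /= h]] := filter_ex (filterI Ul (hF x _ e0)).
  have [_ _ /(_ _ xl) /= hr] := hf l gl.
  have := nr_sub (F x) (f l x); rewrite nr_dist; move: h hr; lra.
Qed.

End States.

(** * Banach and Hilbert spaces of functions *)

Section Completeness.
Variable R : realType.

Lemma seqR_complete (v : nat -> R) :
  (forall e, 0 < e -> exists N, forall m n, (N <= m)%N -> (N <= n)%N ->
    `|v m - v n| < e) ->
  exists c, forall e, 0 < e -> exists N, forall n, (N <= n)%N -> `|v n - c| < e.
Proof.
move=> vc; pose S := [set r | exists N, forall n, (N <= n)%N -> r <= v n].
have vN e : 0 < e -> exists N, S (v N - e) /\ ubound S (v N + e) /\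
    forall n, (N <= n)%N -> `|v n - v N| < e.
  move=> e0; have [N hN] := vc e e0; exists N; split.
    exists N => n Nn; have := hN n N Nn (leqnn _); rewrite ltr_norml => /andP[].
    lra.
  split=> [r [M hM]|n Nn]; last exact: hN.
  have := hM _ (leq_maxl M N); have := hN _ N (leq_maxr M N) (leqnn _).
  by rewrite ltr_norml => /andP[]; lra.
have hs : has_sup S.
  by have [N [h1 [h2 _]]] := vN 1 ltr01; split; [exists (v N - 1)|exists (v N + 1)].
exists (sup S) => e e0; have e2 : 0 < e / 2 by rewrite divr_gt0.
have [N [h1 [h2 h3]]] := vN _ e2; exists N => n /h3; rewrite !ltr_norml.
have := ub_le_sup hs.2 h1; have := ge_sup (ex_intro _ _ h1) h2.
by move=> ? ? /andP[? ?]; apply/andP; split; lra.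
Qed.

Lemma seqC_complete (u : nat -> R[i]) :
  (forall e : R, 0 < e -> exists N, forall m n, (N <= m)%N -> (N <= n)%N ->
    nr (u m - u n) < e) -> exists l, lim_to u l.
Proof.
move=> uc.
have [a ha] : exists c : R, forall e, 0 < e -> exists N, forall n, (N <= n)%N ->
    `|complex.Re (u n) - c| < e.
  apply: seqR_complete => e /uc[N hN]; exists N => m n Nm Nn.
  by apply: le_lt_trans (hN _ _ Nm Nn); rewrite -raddfB Re_le_nr.
have [b hb] : exists c : R, forall e, 0 < e -> exists N, forall n, (N <= n)%N ->
    `|complex.Im (u n) - c| < e.
  apply: seqR_complete => e /uc[N hN]; exists N => m n Nm Nn.
  apply: le_lt_trans (hN _ _ Nm Nn); rewrite -raddfB.
  rewrite -(ler_pXn2r (ltn0Sn 1)) ?nnegrE ?nr_ge0//.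
  by rewrite nr2 real_normK ?num_real// lerDr sqr_ge0.
exists (a +i* b) => e e0; have e2 : 0 < e / 2 by rewrite divr_gt0.
have [N hN] := ha _ e2; have [M hM] := hb _ e2.
exists (maxn N M) => n; rewrite geq_max => /andP[/hN h1 /hM h2].
apply: le_lt_trans (nr_ReIm _) _; move: h1 h2.
by case: (u n) => x y /=; lra.
Qed.

Lemma filter_complete (V : normedModType R[i]) :
  (forall u : nat -> V, (forall e : R, 0 < e -> exists N, forall m n,
     (N <= m)%N -> (N <= n)%N -> nr (u m - u n) < e) -> exists l, lim_to u l) ->
  forall F : set_system V, ProperFilter F -> cauchy F -> cvg F.
Proof.
move=> sc F FF /(@cauchyP R[i]) Fc.
have pos n : (0 : R[i]) < (n.+1%:R^-1 : R)%:C by rewrite ltcR invr_gt0.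
have /choice[x hx] : forall n, exists x, F (ball x (n.+1%:R^-1 : R)%:C).
  by move=> n; exact: (Fc _ (pos n)).
have near n y : ball (x n) (n.+1%:R^-1 : R)%:C y -> nr (x n - y) < n.+1%:R^-1.
  by rewrite -ball_normE /= nrE ltcR.
have [l xl] : exists l, lim_to x l.
  apply: sc => e e0; have e2 : 0 < e / 2 by rewrite divr_gt0.
  have [N hN] := inv_small e2; exists N => m n /hN Nm /hN Nn.
  have [y [/near h1 /near h2]] := filter_ex (filterI (hx m) (hx n)).
  have := nr_trans y (x m) (x n); rewrite (nr_dist y (x n)).
  by move: h1 h2 Nm Nn; move: (m.+1%:R^-1) (n.+1%:R^-1) => p q; lra.
apply/cvg_ex; exists l; apply/fcvgrPdist_lt => eps eps0.
have er : eps = (complex.Re eps)%:C by rewrite RRe_real// gtr0_real.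
have e0 : 0 < complex.Re eps by rewrite -ltcR -er.
have e2 : 0 < complex.Re eps / 2 by rewrite divr_gt0.
have [N hN] := inv_small e2; have [M hM] := xl _ e2.
apply: filterS (hx (maxn N M)) => y /near /= h; rewrite nrE er ltcR.
have := hM _ (leq_maxr N M); have := hN _ (leq_maxl N M).
have := nr_trans (x (maxn N M)) l y; rewrite (nr_dist l (x _)).
by move: h; move: ((maxn N M).+1%:R^-1) => p; lra.
Qed.

End Completeness.

(* Spaces of functions [g] on a set with [|g t| <= C * w t], cut out by
   conditions that are linear and stable under pointwise limits.              *)
Record bspace (R : realType) := BSpace {
  bs_dom : Type;
  bs_weight : bs_dom -> R;
  bs_weight_ge0 : forall t, 0 <= bs_weight t;
  bs_law : set (bs_dom -> R[i]);
  bs_law0 : bs_law (fun=> 0);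
  bs_lawD : forall f g, bs_law f -> bs_law g -> bs_law (fun t => f t + g t);
  bs_lawZ : forall k f, bs_law f -> bs_law (fun t => k * f t);
  bs_law_lim : forall (u : nat -> bs_dom -> R[i]) f,
    (forall n, bs_law (u n)) -> (forall t, lim_to (u ^~ t) (f t)) -> bs_law f }.

Record bdd (R : realType) (S : bspace R) := Bdd {
  bfun :> bs_dom S -> R[i];
  bfun_law : bs_law bfun;
  bfun_bounded : exists C : R, forall t, nr (bfun t) <= C * bs_weight t }.

Section BddInstances.
Variables (R : realType) (S : bspace R).
Implicit Types (f g h : bdd S) (t : bs_dom S).
Local Notation w := (@bs_weight R S).

HB.instance Definition _ := gen_eqMixin (bdd S).
HB.instance Definition _ := gen_choiceMixin (bdd S).

Lemma bdd_ext f g : (forall t, f t = g t) -> f = g.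
Proof.
case: f g => [f Lf bf] [g Lg bg] /= /funext fg; subst g.
by congr Bdd; exact: Prop_irrelevance.
Qed.

Lemma bdd0_subproof : exists C : R, forall t, nr (0 : R[i]) <= C * w t.
Proof. by exists 0 => t; rewrite nr0 mul0r. Qed.

Lemma bddD_subproof f g : exists C : R, forall t, nr (f t + g t) <= C * w t.
Proof.
have [C hC] := bfun_bounded f; have [D hD] := bfun_bounded g; exists (C + D) => t.
by rewrite mulrDl; apply: le_trans (nrD _ _) _; exact: lerD.
Qed.

Lemma bddZ_subproof k f : exists C : R, forall t, nr (k * f t) <= C * w t.
Proof.
have [C hC] := bfun_bounded f; exists (nr k * C) => t.
by rewrite nrM -mulrA ler_wpM2l// nr_ge0.
Qed.

Definition bdd0 := Bdd (bs_law0 S) bdd0_subproof.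
Definition bddD f g := Bdd (bs_lawD (bfun_law f) (bfun_law g)) (bddD_subproof f g).
Definition bddZ k f := Bdd (bs_lawZ k (bfun_law f)) (bddZ_subproof k f).

Lemma bddA : associative bddD.
Proof. by move=> f g h; apply: bdd_ext => t /=; rewrite addrA. Qed.
Lemma bddC : commutative bddD.
Proof. by move=> f g; apply: bdd_ext => t /=; rewrite addrC. Qed.
Lemma bdd0D : left_id bdd0 bddD.
Proof. by move=> f; apply: bdd_ext => t /=; rewrite add0r. Qed.
Lemma bddND : left_inverse bdd0 (bddZ (-1)) bddD.
Proof. by move=> f; apply: bdd_ext => t /=; rewrite mulN1r addNr. Qed.

HB.instance Definition _ := GRing.isZmodule.Build (bdd S) bddA bddC bdd0D bddND.

Lemma bddZA a b f : bddZ a (bddZ b f) = bddZ (a * b) f.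
Proof. by apply: bdd_ext => t /=; rewrite mulrA. Qed.
Lemma bdd1Z : left_id 1 bddZ.
Proof. by move=> f; apply: bdd_ext => t /=; rewrite mul1r. Qed.
Lemma bddZDr : right_distributive bddZ +%R.
Proof. by move=> k f g; apply: bdd_ext => t /=; rewrite mulrDr. Qed.
Lemma bddZDl f : {morph bddZ^~ f : a b / a + b}.
Proof. by move=> a b; apply: bdd_ext => t /=; rewrite mulrDl. Qed.

HB.instance Definition _ :=
  GRing.Zmodule_isLmodule.Build R[i] (bdd S) bddZA bdd1Z bddZDr bddZDl.

Lemma bddE_add f g t : (f + g) t = f t + g t. Proof. by []. Qed.
Lemma bddE_scale k f t : (k *: f) t = k * f t. Proof. by []. Qed.
Lemma bddE_opp f t : (- f) t = - f t.
Proof. by rewrite -[- f]scaleN1r /= mulN1r. Qed.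
Lemma bddE_sub f g t : (f - g) t = f t - g t.
Proof. by rewrite bddE_add bddE_opp. Qed.
Lemma bddE0 t : (0 : bdd S) t = 0. Proof. by []. Qed.

Definition bbounds f := [set C : R | 0 <= C /\ forall t, nr (f t) <= C * w t].
Definition bnorm f : R := inf (bbounds f).

Lemma bbounds_inf f : has_inf (bbounds f).
Proof.
split; last by exists 0 => C [].
have [C hC] := bfun_bounded f; exists `|C|; split => // t.
by apply: le_trans (hC t) _; rewrite ler_wpM2r ?bs_weight_ge0// ler_norm.
Qed.

Lemma bnorm_ge0 f : 0 <= bnorm f.
Proof. by apply: lb_le_inf => [|C []//]; exact: (bbounds_inf f).1. Qed.

Lemma bnorm_le f C : 0 <= C -> (forall t, nr (f t) <= C * w t) -> bnorm f <= C.
Proof. by move=> C0 fC; apply: ge_inf; [exact: (bbounds_inf f).2|split]. Qed.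

Lemma bnorm_ub f t : nr (f t) <= bnorm f * w t.
Proof.
apply/ler_addgt0Pr => e e0; have w1 : 0 < w t + 1 by rewrite ltr_wpDl// bs_weight_ge0.
have [C [C0 hC] Cf] := inf_adherent (divr_gt0 e0 w1) (bbounds_inf f).
apply: le_trans (hC t) _.
apply: le_trans (ler_wpM2r (bs_weight_ge0 t) (ltW Cf)) _.
rewrite mulrDl lerD2l// mulrAC ler_pdivrMr// ler_wpM2l ?(ltW e0)// lerDl//.
Qed.

Lemma bnormD f g : bnorm (f + g) <= bnorm f + bnorm g.
Proof.
apply: bnorm_le; first by rewrite addr_ge0// bnorm_ge0.
move=> t; rewrite mulrDl; apply: le_trans (nrD _ _) _.
by apply: lerD; exact: bnorm_ub.
Qed.

Lemma bnormZ k f : bnorm (k *: f) = nr k * bnorm f.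
Proof.
have le a g : bnorm (a *: g) <= nr a * bnorm g.
  apply: bnorm_le; first by rewrite mulr_ge0// ?nr_ge0 ?bnorm_ge0.
  by move=> t; rewrite /= nrM -mulrA ler_wpM2l ?nr_ge0// bnorm_ub.
have [->|k0] := eqVneq k 0.
  rewrite nr0 mul0r; apply/eqP; rewrite eq_le bnorm_ge0 andbT.
  by have := le 0 f; rewrite nr0 mul0r.
apply/eqP; rewrite eq_le le /=.
have nk : 0 < nr k by rewrite lt_def nr_eq0 k0 nr_ge0.
have := le k^-1 (k *: f); rewrite scalerA mulVf// scale1r.
rewrite -(ler_pM2l nk) mulrA -nrM mulfV//.
by rewrite (_ : nr 1 = 1) ?mul1r// -[1]/(1%:C) nr_real normr1.
Qed.

Lemma bnorm_eq0 f : bnorm f = 0 -> f = 0.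
Proof.
move=> f0; apply: bdd_ext => t; apply: nr_le0.
by have := bnorm_ub f t; rewrite f0 mul0r.
Qed.

Lemma bnormCD f g : (bnorm (f + g))%:C <= (bnorm f)%:C + (bnorm g)%:C.
Proof. by rewrite -rmorphD lecR bnormD. Qed.
Lemma bnormCZ k f : (bnorm (k *: f))%:C = `|k| * (bnorm f)%:C.
Proof. by rewrite bnormZ rmorphM /= -nrE. Qed.
Lemma bnormC_eq0 f : (bnorm f)%:C = 0 -> f = 0.
Proof. by move=> /complexI/bnorm_eq0. Qed.

HB.instance Definition _ :=
  Lmodule_isNormed.Build R[i] (bdd S) bnormCD bnormCZ bnormC_eq0.

Lemma nr_bdd f : nr f = bnorm f. Proof. by []. Qed.

Lemma bdd_seq_complete (u : nat -> bdd S) : (forall e : R, 0 < e -> exists N, forall m n,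
     (N <= m)%N -> (N <= n)%N -> nr (u m - u n) < e) -> exists l, lim_to u l.
Proof.
move=> uc.
have /choice[l hl] : forall t, exists l, lim_to (fun n => u n t) l.
  move=> t; apply: seqC_complete => e e0.
  have w1 : 0 < w t + 1 by rewrite ltr_wpDl// bs_weight_ge0.
  have [N hN] := uc _ (divr_gt0 e0 w1); exists N => m n Nm Nn.
  have := hN m n Nm Nn; rewrite ltr_pdivlMr// => h.
  rewrite -bddE_sub; apply: le_lt_trans (bnorm_ub _ _) (le_lt_trans _ h).
  by rewrite nr_bdd ler_wpM2l ?bnorm_ge0// lerDl.
have key (e : R) : 0 < e -> exists N, forall n, (N <= n)%N ->
    forall t, nr (u n t - l t) <= e * w t.
  move=> e0; have [N hN] := uc _ e0; exists N => n Nn t; rewrite nr_dist.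
  apply: (lim_le (limB (hl t) (lim_cst (u n t)))); exists N => m Nm.
  rewrite -bddE_sub; apply: le_trans (bnorm_ub _ _) _.
  by rewrite ler_wpM2r ?bs_weight_ge0// -nr_bdd ltW// hN.
have Ll : bs_law l by apply: (bs_law_lim (u := fun n => bfun (u n))) => // n; exact: bfun_law.
have bl : exists C : R, forall t, nr (l t) <= C * w t.
  have [N hN] := key 1 ltr01; exists (1 + bnorm (u N)) => t.
  have := hN N (leqnn _) t; have := bnorm_ub (u N) t.
  have := nr_sub (l t) (u N t); rewrite nr_dist mulrDl; lra.
exists (Bdd Ll bl) => e e0; have e2 : 0 < e / 2 by rewrite divr_gt0.
have [N hN] := key _ e2; exists N => n Nn.
apply: (@le_lt_trans _ _ (e / 2)); last by lra.
apply: bnorm_le => [|t]; first exact: ltW.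
by rewrite bddE_sub; exact: hN.
Qed.

HB.instance Definition _ := Uniform_isComplete.Build (bdd S)
  (filter_complete bdd_seq_complete).

End BddInstances.

Section HilbertCompletion.
Variables (R : realType) (T : prehilbert R).
Implicit Types (s t x y : T) (k : R[i]).

Definition antilinear_law : set (T -> R[i]) := [set g |
  (forall x y, g (ph_add x y) = g x + g y) /\
  (forall k x, g (ph_scl k x) = conjc k * g x)].

Lemma antilinear0 : antilinear_law (fun=> 0).
Proof. by split=> [x y|k x]; rewrite ?addr0 ?mulr0. Qed.

Lemma antilinearD f g : antilinear_law f -> antilinear_law g ->
  antilinear_law (fun t => f t + g t).
Proof.
by move=> [fD fZ] [gD gZ]; split=> [x y|k x]; rewrite ?fD ?gD ?fZ ?gZ; ring.
Qed.

Lemma antilinearZ k f : antilinear_law f -> antilinear_law (fun t => k * f t).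
Proof. by move=> [fD fZ]; split=> [x y|a x]; rewrite ?fD ?fZ; ring. Qed.

Lemma limCZ k (u : nat -> R[i]) l : lim_to u l -> lim_to (fun n => k * u n) (k * l).
Proof.
by apply: (@lim_lip _ _ _ (fun z : R[i] => k * z) (nr k)) => x y; rewrite -mulrBr nrM.
Qed.

Lemma antilinear_lim (u : nat -> T -> R[i]) f : (forall n, antilinear_law (u n)) ->
  (forall t, lim_to (u ^~ t) (f t)) -> antilinear_law f.
Proof.
move=> hu uf; split=> [x y|k x].
  apply: (lim_uniq (uf _)); have := limD (uf x) (uf y); congr lim_to.
  by apply/funext => n; rewrite (hu n).1.
apply: (lim_uniq (uf _)); have := limCZ (conjc k) (uf x); congr lim_to.
by apply/funext => n; rewrite (hu n).2.
Qed.

(* The completion of T is realised as the space of its bounded antilinear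
   functionals, a vector t being identified with [form t _].                  *)
Definition hbs : bspace R :=
  BSpace (@pn_ge0 R T) antilinear0 antilinearD antilinearZ antilinear_lim.

Definition hcomp := bdd hbs.
HB.instance Definition _ := CompleteNormedModule.on hcomp.
Implicit Types g h : hcomp.

Lemma hin_law t : antilinear_law (fun s => ph_form t s).
Proof. by split=> [x y|k x]; [exact: ph_formDr|exact: ph_formZr]. Qed.

Lemma hin_bounded t : exists C : R, forall s, nr (ph_form t s) <= C * pn s.
Proof. by exists (pn t) => s; exact: ph_CS. Qed.

Definition hin t : hcomp := @Bdd R hbs _ (hin_law t) (hin_bounded t).

Lemma hinD s t : hin (ph_add s t) = hin s + hin t.
Proof. by apply: bdd_ext => x /=; rewrite ph_formD. Qed.

Lemma hinZ k t : hin (ph_scl k t) = k *: hin t.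
Proof. by apply: bdd_ext => x /=; rewrite ph_formZ. Qed.

Lemma nr_hin t : nr (hin t) = pn t.
Proof.
apply/eqP; rewrite eq_le; apply/andP; split.
  by apply: bnorm_le => [|s]; [exact: pn_ge0|exact: ph_CS].
have := @bnorm_ub R hbs (hin t) t; rewrite /= ph_form_pn nr_real.
rewrite ger0_norm ?sqr_ge0// expr2 -nr_bdd.
have [->|t0] := eqVneq (pn t) 0; first by rewrite nr_ge0.
by rewrite ler_pM2r// lt_def t0 pn_ge0.
Qed.

Lemma hin_sub s t : hin s - hin t = hin (ph_add s (ph_scl (-1) t)).
Proof. by rewrite hinD hinZ scaleN1r. Qed.

Lemma h_ub g t : nr (g t) <= nr g * pn t.
Proof. exact: bnorm_ub. Qed.

Lemma hD g x y : g (ph_add x y) = g x + g y.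
Proof. exact: (bfun_law g).1. Qed.

Lemma hZ g k x : g (ph_scl k x) = conjc k * g x.
Proof. exact: (bfun_law g).2. Qed.

Lemma h_dense g (e : R) : 0 < e -> exists t, nr (g - hin t) <= e.
Proof.
move=> e0; pose N := nr g.
have [N0|N0] := eqVneq N 0.
  exists (ph_scl 0 (ph_point T)); rewrite hinZ scale0r subr0 -/N N0; exact: ltW.
have Np : 0 < N by rewrite lt_def N0 nr_ge0.
pose lam := e / N; have lam0 : 0 < lam by rewrite divr_gt0.
pose del := Num.min (lam * e / 2) (N / 2).
have del0 : 0 < del by rewrite lt_min !divr_gt0// mulr_gt0.
have del1 : del <= lam * e / 2 by rewrite ge_min lexx.
have del2 : del <= N / 2 by rewrite ge_min lexx orbT.
have [t ht] : exists t, (N - del) * pn t < nr (g t).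
  apply: contrapT => nt.
  have : N <= N - del.
    apply: bnorm_le => [|t]; first by lra.
    by rewrite leNgt; apply/negP => h; apply: nt; exists t.
  lra.
have pt : 0 < pn t.
  rewrite lt_def pn_ge0 andbT; apply/eqP => p0.
  by have := h_ub g t; move: ht; rewrite p0 !mulr0 => /lt_le_trans h /h; rewrite ltxx.
have gt : 0 < nr (g t).
  by apply: le_lt_trans ht; rewrite mulr_ge0 ?pn_ge0//; lra.
have gt0 : nr (g t) != 0 by rewrite gt_eqF.
have pt0 : pn t != 0 by rewrite gt_eqF.
pose s := ph_scl (((nr (g t) * pn t)^-1)%:C * g t) t.
pose r := nr (g t) / pn t.
have ps : pn s = 1.
  rewrite pn_scl nrM nr_real ger0_norm ?invr_ge0 ?mulr_ge0 ?nr_ge0 ?pn_ge0//.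
  by field; rewrite gt0 pt0.
have gs : g s = r%:C.
  rewrite hZ cjM cjr -mulrA [conjc _ * _]mulrC -sqr_nr -rmorphM /=; congr (_%:C).
  by rewrite /r; field; rewrite gt0 pt0.
have rN : N - del < r by rewrite ltr_pdivlMr.
exists (ph_scl N%:C s); apply: bnorm_le => [|x]; first exact: ltW.
rewrite bddE_sub hinZ bddE_scale /=.
set c := g x - N%:C * ph_form s x.
have [->|c0] := eqVneq c 0; first by rewrite nr0 mulr_ge0 ?pn_ge0// ltW.
have nc : 0 < nr c by rewrite lt_def nr_eq0 c0 nr_ge0.
have px : 0 < pn x.
  rewrite lt_def pn_ge0 andbT; apply/eqP => p0; move: nc; rewrite ltNge => /negP; apply.
  have := h_ub g x; have := ph_CS s x; rewrite p0 !mulr0 => h1 h2.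
  by apply: le_trans (nrB _ _) _; rewrite nrM (nr_le0 h1) (nr_le0 h2) nr0 mulr0 addr0.
have px0 : pn x != 0 by rewrite gt_eqF.
have nc0 : nr c != 0 by rewrite gt_eqF.
pose tau := (lam / (nr c * pn x))%:C * c.
have h1 : r + complex.Re (conjc tau * g x) <= N * pn (ph_add s (ph_scl tau x)).
  have := h_ub g (ph_add s (ph_scl tau x)); rewrite hD hZ gs.
  by apply: le_trans; apply: le_trans (Re_nr _); rewrite raddfD.
have h2 : pn (ph_add s (ph_scl tau x)) <=
    1 + complex.Re (conjc tau * ph_form s x) + lam ^+ 2 / 2.
  have tx : nr tau ^+ 2 * pn x ^+ 2 = lam ^+ 2.
    rewrite nrM nr_real ger0_norm; last by rewrite ltW// divr_gt0// mulr_gt0.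
    by field; rewrite nc0 px0.
  have := pn2_add tau s x; rewrite ps tx expr1n.
  by have := sqr_ge0 (pn (ph_add s (ph_scl tau x)) - 1); rewrite sqrrB expr1n; lra.
have h3 : complex.Re (conjc tau * c) = lam * nr c / pn x.
  rewrite cjM cjr -mulrA [conjc c * c]mulrC -sqr_nr -rmorphM /=.
  by field; rewrite nc0 px0.
have h4 : complex.Re (conjc tau * c) =
    complex.Re (conjc tau * g x) - N * complex.Re (conjc tau * ph_form s x).
  rewrite /c mulrBr raddfB /=; congr (_ - _).
  by rewrite mulrCA; case: (conjc tau * ph_form s x) => a b /=; ring.
have h5 : lam * nr c / pn x <= del + N * (lam ^+ 2 / 2).
  rewrite -h3 h4; have := ler_wpM2l (ltW Np) h2; move: h1 rN; lra.
have h6 : N * (lam ^+ 2 / 2) = lam * e / 2 by rewrite /lam; field.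
have h7 : lam * nr c / pn x <= lam * e by move: h5 del1; rewrite h6; lra.
by move: h7; rewrite -mulrA ler_pM2l// ler_pdivrMr.
Qed.

Lemma h_dense_seq g : exists u : nat -> T, lim_to (fun n => hin (u n)) g.
Proof.
have /choice[u hu] : forall n : nat, exists t, nr (g - hin t) <= n.+1%:R^-1.
  by move=> n; apply: h_dense; rewrite invr_gt0.
exists u => e /inv_small[N hN]; exists N => n /hN; rewrite nr_dist.
exact: le_lt_trans.
Qed.

Lemma hdot_exists g h : exists c : R[i],
  forall t, nr (c - g t) <= nr g * nr (h - hin t).
Proof.
have [u uh] := h_dense_seq h.
have gsub s t : nr (g s - g t) <= nr g * nr (hin s - hin t).
  rewrite hin_sub nr_hin; have := h_ub g (ph_add s (ph_scl (-1) t)).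
  by rewrite hD hZ cjN -[1]/(1%:C) cjr mulN1r.
have [c hc] : exists c, lim_to (fun n => g (u n)) c.
  apply: seqC_complete => e e0.
  have N1' : 0 < nr g + 1 by rewrite ltr_wpDl// nr_ge0.
  have N1 : 0 < 2 * (nr g + 1) by rewrite mulr_gt0.
  have [N hN] := uh _ (divr_gt0 e0 N1); exists N => m n /hN hm /hN hn.
  apply: le_lt_trans (gsub _ _) _.
  have h1 : nr (hin (u m) - hin (u n)) < e / (nr g + 1).
    apply: le_lt_trans (nr_trans h _ _) _; rewrite (nr_dist h).
    have -> : e / (nr g + 1) = e / (2 * (nr g + 1)) + e / (2 * (nr g + 1)).
      by field; rewrite gt_eqF.
    exact: ltrD.
  move: h1; rewrite ltr_pdivlMr//; apply: le_lt_trans.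
  by rewrite mulrC ler_wpM2l ?nr_ge0// lerDl.
exists c => t; apply/ler_addgt0Pr => e e0.
have N1 : 0 < nr g + 1 by rewrite ltr_wpDl// nr_ge0.
have e2 : 0 < e / 2 by rewrite divr_gt0.
have [N hN] := hc _ e2; have [M hM] := uh _ (divr_gt0 e2 N1).
have := hN _ (leq_maxl N M); have := hM _ (leq_maxr N M).
move: (u _) => s; rewrite ltr_pdivlMr// => h1 h2.
apply: le_trans (nr_trans (g s) _ _) _; rewrite nr_dist.
have h3 : nr (g s - g t) <= nr g * nr (hin s - h) + nr g * nr (h - hin t).
  rewrite -mulrDr; apply: le_trans (gsub _ _) _.
  by rewrite ler_wpM2l ?nr_ge0//; exact: nr_trans.
have h4 : nr g * nr (hin s - h) <= nr (hin s - h) * (nr g + 1).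
  by rewrite mulrC ler_wpM2l ?nr_ge0// lerDl.
by move: h1 h2 h3 h4; lra.
Qed.

Definition hd g h : R[i] := xget 0 [set c | forall t, nr (c - g t) <= nr g * nr (h - hin t)].

Lemma hd_spec g h t : nr (hd g h - g t) <= nr g * nr (h - hin t).
Proof.
have [c hc] := hdot_exists g h.
have := @xgetPex _ 0 [set c | forall t, nr (c - g t) <= nr g * nr (h - hin t)]
  (ex_intro _ c hc).
exact.
Qed.

Lemma hd_lim g h (u : nat -> T) : lim_to (fun n => hin (u n)) h ->
  lim_to (fun n => g (u n)) (hd g h).
Proof.
move=> uh e e0; have N1 : 0 < nr g + 1 by rewrite ltr_wpDl// nr_ge0.
have [N hN] := uh _ (divr_gt0 e0 N1); exists N => n /hN.
rewrite ltr_pdivlMr// => h1; rewrite nr_dist; apply: le_lt_trans (hd_spec _ _ _) _.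
rewrite (nr_dist h); apply: le_lt_trans h1.
by rewrite mulrC ler_wpM2l ?nr_ge0// lerDl.
Qed.

Lemma hd_hin g t : hd g (hin t) = g t.
Proof. by apply: (lim_uniq (hd_lim _ (lim_cst (hin t)))); exact: lim_cst. Qed.

Lemma hdDl g g' h : hd (g + g') h = hd g h + hd g' h.
Proof.
have [u uh] := h_dense_seq h.
exact: (lim_uniq (hd_lim (g + g') uh) (limD (hd_lim g uh) (hd_lim g' uh))).
Qed.

Lemma hdZl k g h : hd (k *: g) h = k * hd g h.
Proof.
have [u uh] := h_dense_seq h.
exact: (lim_uniq (hd_lim (k *: g) uh) (limCZ k (hd_lim g uh))).
Qed.

Lemma hd_CS g h : nr (hd g h) <= nr g * nr h.
Proof.
apply/ler_addgt0Pr => e e0; have N1 : 0 < 2 * (nr g + 1).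
  by rewrite mulr_gt0// ltr_wpDl// nr_ge0.
have [t] := h_dense h (divr_gt0 e0 N1); rewrite ler_pdivlMr// => ht.
have h1 := hd_spec g h t; have h2 := h_ub g t; rewrite -nr_hin in h2.
have h3 : nr (hin t) <= nr h + nr (h - hin t).
  by rewrite addrC -lerBlDr nr_dist nr_sub.
have h4 := nr_sub (hd g h) (g t).
have h5 := ler_wpM2l (nr_ge0 g) h3.
have := nr_ge0 (h - hin t); move: h1 h2 h4 h5 ht; nra.
Qed.

Lemma hd_lim2 g h (u v : nat -> T) : lim_to (fun n => hin (u n)) g ->
  lim_to (fun n => hin (v n)) h ->
  lim_to (fun n => ph_form (u n) (v n)) (hd g h).
Proof.
move=> ug vh.
have h0 : lim_to (fun n => g (v n) - hd (g - hin (u n)) (hin (v n))) (hd g h - 0).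
  apply: limB; first exact: hd_lim.
  have [N0 hN0] := vh 1 ltr01.
  move=> e e0; have K : 0 < nr h + 1 by rewrite ltr_wpDl// nr_ge0.
  have [N hN] := ug _ (divr_gt0 e0 K); exists (maxn N N0) => n.
  rewrite geq_max subr0 => /andP[/hN h1 /hN0 h2]; move: h1; rewrite ltr_pdivlMr// => h1.
  apply: le_lt_trans (hd_CS _ _) (le_lt_trans _ h1); rewrite nr_dist ler_wpM2l ?nr_ge0//.
  by have := nr_sub (hin (v n)) h; move: h2; lra.
move: h0; rewrite subr0; congr lim_to; apply/funext => n.
by rewrite hd_hin bddE_sub opprB addrC subrK.
Qed.

Lemma hdC g h : hd g h = conjc (hd h g).
Proof.
have [u ug] := h_dense_seq g; have [v vh] := h_dense_seq h.
apply: (lim_uniq (hd_lim2 ug vh)).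
have : lim_to (fun n => conjc (ph_form (v n) (u n))) (conjc (hd h g)).
  apply: (@lim_lip _ _ _ (@conjc R) 1 _ _ _ (hd_lim2 vh ug)) => x y.
  by rewrite mul1r -rmorphB nr_conj.
by congr lim_to; apply/funext => n; rewrite -ph_formC.
Qed.

Lemma hd_norm g : hd g g = (nr g ^+ 2)%:C.
Proof.
have [u ug] := h_dense_seq g.
apply: (lim_uniq (hd_lim2 ug ug)).
move=> e e0; have K : 0 < 2 * nr g + 1 by rewrite ltr_wpDl// mulr_ge0// nr_ge0.
have [N hN] := ug _ (divr_gt0 e0 K); have [M hM] := ug 1 ltr01.
exists (maxn N M) => n; rewrite geq_max => /andP[/hN + /hM h2].
rewrite ltr_pdivlMr// => h1; rewrite ph_form_pn -nr_hin -rmorphB nr_real.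
have h3 : `|nr (hin (u n)) - nr g| <= nr (hin (u n) - g).
  by rewrite ler_norml nr_sub andbT lerNl opprB nr_dist nr_sub.
rewrite subr_sqr normrM; apply: le_lt_trans h1; apply: ler_pM => //.
rewrite ger0_norm ?addr_ge0 ?nr_ge0//.
by have := nr_sub (hin (u n)) g; move: h2; lra.
Qed.

Lemma hdDr g h h' : hd g (h + h') = hd g h + hd g h'.
Proof. by rewrite hdC hdDl cjD -!hdC. Qed.

Lemma hdZr k g h : hd g (k *: h) = conjc k * hd g h.
Proof. by rewrite hdC hdZl cjM -!hdC. Qed.

Lemma hd_bilinear : bilinear_for ( *%R : GRing.Scale.law R[i] R[i])
  ((Num.conj : {rmorphism R[i] -> R[i]}) \; *%R : GRing.Scale.law R[i] R[i]) hd.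
Proof.
split=> [h k f g|h k f g]; first by rewrite hdDl hdZl.
by rewrite hdDr hdZr.
Qed.

HB.instance Definition _ := bilinear_isBilinear.Build R[i] hcomp hcomp R[i]
  *%R (Num.conj \; *%R) hd hd_bilinear.

Lemma hd_hermitian g h : hd g h = (-1) ^+ false * Num.conj (hd h g).
Proof. by rewrite expr0 mul1r hdC. Qed.

HB.instance Definition _ :=
  isHermitianSesquilinear.Build R[i] hcomp false Num.conj hd hd_hermitian.

Lemma hd_gt0 g : g != 0 -> 0 < hd g g.
Proof.
by move=> g0; rewrite hd_norm ltcR exprn_gt0// lt_def nr_eq0 g0 nr_ge0.
Qed.

HB.instance Definition _ := isDotProduct.Build R[i] hcomp hd hd_gt0.

Definition hd_dot : {dot hcomp for Num.conj} := hd.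

Lemma hd_dotE g : hd_dot g g = `|g| ^+ 2.
Proof. by rewrite /hd_dot /= hd_norm nrE rmorphXn. Qed.

HB.instance Definition _ := isHilbert.Build R hcomp hd_dotE.

Lemma hdotE_hd g h : hdot g h = hd g h.
Proof. by []. Qed.

End HilbertCompletion.

(** * Projections and Hilbert bimodules *)

Section HilbertSpace.
Variables (R : realType) (H : hilbertType R).
Implicit Types (x y z xi eta : H) (L : set H).

Lemma hdotDl x y z : hdot (x + y) z = hdot x z + hdot y z :> R[i].
Proof. exact: linearDl. Qed.
Lemma hdotDr x y z : hdot z (x + y) = hdot z x + hdot z y :> R[i].
Proof. exact: linearD. Qed.
Lemma hdotZl k x z : hdot (k *: x) z = k * hdot x z :> R[i].
Proof. by rewrite linearZl_LR. Qed.
Lemma hdotC x y : hdot x y = conjc (hdot y x) :> R[i].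
Proof. by rewrite hermC expr0 mul1r. Qed.
Lemma hdot_nr x : hdot x x = (nr x ^+ 2)%:C :> R[i].
Proof. by rewrite hdotE nrE rmorphXn. Qed.

Definition hilbert_ph : prehilbert R.
Proof.
refine (@PreHilbert R H 0 +%R (fun k x => k *: x) (fun x y => hdot x y)
  hdotDl hdotZl hdotC _).
by move=> x; rewrite hdot_nr ler0c sqr_ge0.
Defined.

Lemma pn_hilbert x : @pn R hilbert_ph x = nr x.
Proof. by rewrite /pn /= hdot_nr /= sqrtr_sqr ger0_norm ?nr_ge0. Qed.

Lemma hdotZr k x z : hdot z (k *: x) = conjc k * hdot z x :> R[i].
Proof. exact: (@ph_formZr R hilbert_ph). Qed.
Lemma hdotNl x z : hdot (- x) z = - hdot x z :> R[i].
Proof. by rewrite -scaleN1r hdotZl mulN1r. Qed.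
Lemma hdotNr x z : hdot z (- x) = - hdot z x :> R[i].
Proof. by rewrite hdotC hdotNl cjN -hdotC. Qed.
Lemma hdot0l z : hdot 0 z = 0 :> R[i].
Proof. by have := hdotZl 0 0 z; rewrite scale0r mul0r. Qed.
Lemma hdot0r z : hdot z 0 = 0 :> R[i].
Proof. by rewrite hdotC hdot0l /= oppr0. Qed.
Lemma hdotBl x y z : hdot (x - y) z = hdot x z - hdot y z :> R[i].
Proof. by rewrite hdotDl hdotNl. Qed.
Lemma hdotBr x y z : hdot z (x - y) = hdot z x - hdot z y :> R[i].
Proof. by rewrite hdotDr hdotNr. Qed.

Lemma hdot_CS x y : nr (hdot x y : R[i]) <= nr x * nr y.
Proof. by have := @ph_CS R hilbert_ph x y; rewrite !pn_hilbert. Qed.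

Lemma nr2_addZ k x y : nr (x + k *: y) ^+ 2 =
  nr x ^+ 2 + 2 * complex.Re (conjc k * hdot x y) + nr k ^+ 2 * nr y ^+ 2.
Proof. by have := @pn2_add R hilbert_ph k x y; rewrite !pn_hilbert. Qed.

Lemma nr2_sub x y :
  nr (x - y) ^+ 2 = nr x ^+ 2 - 2 * complex.Re (hdot x y) + nr y ^+ 2.
Proof.
have := nr2_addZ (-1) x y; rewrite scaleN1r => ->.
rewrite cjN cj1 mulN1r nrN nr1C expr1n mul1r.
by case: (hdot x y) => a b /=; ring.
Qed.

Lemma nr2_add x y :
  nr (x + y) ^+ 2 = nr x ^+ 2 + 2 * complex.Re (hdot x y) + nr y ^+ 2.
Proof. by rewrite -{1}[y]opprK nr2_sub hdotNr nrN; case: (hdot x y) => a b /=; ring. Qed.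

Lemma pythagoras x y : hdot x y = 0 :> R[i] -> nr (x + y) ^+ 2 = nr x ^+ 2 + nr y ^+ 2.
Proof. by move=> h; rewrite nr2_add h /= mulr0 addr0. Qed.

Definition closed_subspace L := [/\ L 0, forall x y, L x -> L y -> L (x + y),
  forall k x, L x -> L (k *: x) &
  forall u l, (forall n : nat, L (u n)) -> lim_to u l -> L l].

Lemma projection_exists L xi : closed_subspace L ->
  exists p, L p /\ forall eta, L eta -> hdot (xi - p) eta = 0 :> R[i].
Proof.
move=> [L0 LD LZ Llim].
pose S := [set r | exists2 y, L y & r = nr (xi - y) ^+ 2].
have hS : has_inf S.
  split; first by exists (nr (xi - 0) ^+ 2), 0.
  by exists 0 => _ [y _ ->]; exact: sqr_ge0.
pose d := inf S.
have dle y : L y -> d <= nr (xi - y) ^+ 2.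
  by move=> Ly; apply: ge_inf; [exact: hS.2|exists y].
have /choice[u hu] : forall n : nat, exists y, L y /\ nr (xi - y) ^+ 2 < d + n.+1%:R^-1.
  move=> n; have n0 : 0 < n.+1%:R^-1 :> R by rewrite invr_gt0.
  by have [_ [y Ly ->] hy] := inf_adherent n0 hS; exists y.
have par m n : nr (u m - u n) ^+ 2 <= 2 * m.+1%:R^-1 + 2 * n.+1%:R^-1.
  have [Lm hm] := hu m; have [Ln hn] := hu n.
  have e1 : u m - u n = (xi - u n) - (xi - u m) by rewrite opprB [RHS]addrC addrA subrK.
  have Lmid : L ((2^-1)%:C *: (u m + u n)) by apply: LZ; exact: LD.
  have e2 : xi - (2^-1)%:C *: (u m + u n) = (2^-1)%:C *: ((xi - u n) + (xi - u m)).
    rewrite addrACA -opprD scalerBr [u n + _]addrC; congr (_ - _).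
    by rewrite scalerDr -scalerDl -rmorphD /= (_ : 2^-1 + 2^-1 = 1) ?scale1r//; field.
  have := dle _ Lmid; rewrite e2 nrZr exprMn ger0_norm ?invr_ge0// (nr2_add (xi - u n)).
  rewrite e1 (nr2_sub (xi - u n)); move: hm hn.
  move: (m.+1%:R^-1) (n.+1%:R^-1) (complex.Re _) => a b c.
  have -> : (2^-1 : R) ^+ 2 = 4^-1 by field.
  lra.
have [p hp] : exists p, lim_to u p.
  apply: seq_complete => e e0; have e4 : 0 < e ^+ 2 / 4 by rewrite divr_gt0// exprn_gt0.
  have [N inv] := inv_small e4; exists N => m n Nm Nn.
  rewrite -(ltr_pXn2r (ltn0Sn 1)) ?nnegrE ?nr_ge0 ?(ltW e0)//.
  apply: le_lt_trans (par m n) _.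
  have := inv m Nm; have := inv n Nn; move: (m.+1%:R^-1) (n.+1%:R^-1) => a b; lra.
have Lp : L p by apply: Llim hp => n; exact: (hu n).1.
have pd : nr (xi - p) ^+ 2 <= d.
  have d0 : 0 <= d by apply: lb_le_inf; [exact: hS.1|move=> _ [y _ ->]; exact: sqr_ge0].
  rewrite leNgt; apply/negP => dN; pose r := Num.sqrt ((d + nr (xi - p) ^+ 2) / 2).
  have r2 : r ^+ 2 = (d + nr (xi - p) ^+ 2) / 2.
    by rewrite sqr_sqrtr// divr_ge0// addr_ge0// sqr_ge0.
  have dr : 0 < r ^+ 2 - d by rewrite r2; lra.
  have : nr (xi - p) <= r.
    apply: (lim_le (limB (lim_cst xi) hp)); have [N hN] := inv_small dr.
    exists N => n /hN h; rewrite -(ler_pXn2r (ltn0Sn 1)) ?nnegrE ?nr_ge0 ?sqrtr_ge0//.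
    have [_ /ltW] := hu n; move: h; move: (n.+1%:R^-1) => a; lra.
  rewrite -(ler_pXn2r (ltn0Sn 1)) ?nnegrE ?nr_ge0 ?sqrtr_ge0// r2; move: dN; lra.
exists p; split => // eta Leta; apply/eqP; rewrite -nr_eq0.
rewrite -sqrf_eq0 eq_le sqr_ge0 andbT leNgt; apply/negP => c0.
set c : R[i] := hdot (xi - p) eta in c0.
pose t := (nr eta ^+ 2 + 1)^-1.
have n1 : 0 < nr eta ^+ 2 + 1 by rewrite ltr_wpDl// sqr_ge0.
have t0 : 0 < t by rewrite invr_gt0.
have := dle (p + (t%:C * c) *: eta) (LD _ _ Lp (LZ _ _ Leta)).
rewrite opprD addrA -scaleNr nr2_addZ -/c nrN nrM nr_real (ger0_norm (ltW t0)).
have -> : complex.Re (conjc (- (t%:C * c)) * c) = - t * nr c ^+ 2.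
  by rewrite cjN cjM cjr -mulNr -rmorphN -mulrA [conjc c * c]mulrC -sqr_nr -rmorphM.
have e1 : t * nr eta ^+ 2 < 1 by rewrite mulrC ltr_pdivrMr// mul1r ltrDl.
have tC := mulr_gt0 t0 c0; rewrite exprMn; move: tC pd e1.
move: (nr c ^+ 2) (nr eta ^+ 2) (nr (xi - p) ^+ 2) => C E X tC pd e1 h.
have : 0 < (t * C) * (1 - t * E) by rewrite mulr_gt0// subr_gt0.
by move: h pd; nra.
Qed.

Lemma orth_projP L xi : closed_subspace L ->
  L (orth_proj L xi) /\ forall eta, L eta -> hdot (xi - orth_proj L xi) eta = 0 :> R[i].
Proof.
move=> /(projection_exists xi)[p hp].
exact: (@xgetPex _ 0 [set q | L q /\ forall eta, L eta -> hdot (xi - q) eta = 0]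
  (ex_intro _ p hp)).
Qed.

Lemma orth_proj_le L xi zeta : closed_subspace L -> L zeta ->
  nr (xi - orth_proj L xi) <= nr (xi - zeta).
Proof.
move=> cL Lz; have [Lp hp] := orth_projP xi cL; have [_ LD LZ _] := cL.
rewrite -(ler_pXn2r (ltn0Sn 1)) ?nnegrE ?nr_ge0//.
have -> : xi - zeta = (xi - orth_proj L xi) + (orth_proj L xi + (-1) *: zeta).
  by rewrite addrA subrK scaleN1r.
have h0 := hp _ (LD _ _ Lp (LZ (-1) _ Lz)).
by rewrite (pythagoras h0) lerDl sqr_ge0.
Qed.

Lemma orth_proj_orthogonal L xi : closed_subspace L ->
  (forall eta, L eta -> hdot xi eta = 0 :> R[i]) -> orth_proj L xi = 0.
Proof.
move=> cL h; have [Lp hp] := orth_projP xi cL.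
have := hp _ Lp; rewrite hdotBl h// sub0r hdot_nr => /eqP.
rewrite oppr_eq0 => /eqP; rewrite -[0]/((0 : R)%:C) => /complexI/eqP.
by rewrite sqrf_eq0 nr_eq0 => /eqP.
Qed.

End HilbertSpace.

Section HilbertBimodules.
Variables (R : realType) (A : cstarAlgType R) (H : hilbertType R).
Variable M : hilbert_bimodule A H.
Implicit Types (a b x : A) (xi eta zeta : H).

Lemma lactDl a b xi : lact M (a + b) xi = lact M a xi + lact M b xi.
Proof. exact: linearDl. Qed.
Lemma lactDr a xi eta : lact M a (xi + eta) = lact M a xi + lact M a eta.
Proof. exact: linearD. Qed.
Lemma lactZl (k : R[i]) a xi : lact M (k *: a) xi = k *: lact M a xi.
Proof. exact: linearZl_LR. Qed.
Lemma lactZr (k : R[i]) a xi : lact M a (k *: xi) = k *: lact M a xi.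
Proof. exact: linearZ_LR. Qed.
Lemma lactBr a xi eta : lact M a (xi - eta) = lact M a xi - lact M a eta.
Proof. exact: linearB. Qed.
Lemma lactBl a b xi : lact M (a - b) xi = lact M a xi - lact M b xi.
Proof. exact: linearBl. Qed.
Lemma ractDl a xi eta : ract M (xi + eta) a = ract M xi a + ract M eta a.
Proof. exact: linearDl. Qed.
Lemma ractDr a b xi : ract M xi (a + b) = ract M xi a + ract M xi b.
Proof. exact: linearD. Qed.
Lemma ractZl (k : R[i]) a xi : ract M (k *: xi) a = k *: ract M xi a.
Proof. exact: linearZl_LR. Qed.
Lemma ractZr (k : R[i]) a xi : ract M xi (k *: a) = k *: ract M xi a.
Proof. exact: linearZ_LR. Qed.
Lemma ractBl a xi eta : ract M (xi - eta) a = ract M xi a - ract M eta a.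
Proof. exact: linearBl. Qed.
Lemma ractBr a b xi : ract M xi (a - b) = ract M xi a - ract M xi b.
Proof. exact: linearB. Qed.

(* [|a|^2 - star a * a] is a square. *)
Lemma lact_le a xi : nr (lact M a xi) <= nr a * nr xi.
Proof.
have [z [sz zz]] := pos_norm_sqrt a.
rewrite -(ler_pXn2r (ltn0Sn 1)) ?nnegrE ?mulr_ge0 ?nr_ge0// exprMn.
have := sqr_ge0 (nr (lact M z xi)); rewrite -[nr (lact M z xi) ^+ 2]/(complex.Re (_%:C)).
rewrite -hdot_nr lact_star sz -lactM zz lactBl lactZl lact1 lactM hdotBr hdotZr cjr.
by rewrite -lact_star !hdot_nr -rmorphM -rmorphB /= subr_ge0.
Qed.

Lemma ract_le a xi : nr (ract M xi a) <= nr a * nr xi.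
Proof.
have [z [sz zz]] := pos_norm_sqrt (star a).
rewrite -(ler_pXn2r (ltn0Sn 1)) ?nnegrE ?mulr_ge0 ?nr_ge0// exprMn.
have := sqr_ge0 (nr (ract M xi z)); rewrite -[nr (ract M xi z) ^+ 2]/(complex.Re (_%:C)).
rewrite -hdot_nr ract_star sz -ractM zz ractBr ractZr ract1 starK ractM hdotBr hdotZr cjr.
by rewrite -ract_star !hdot_nr -rmorphM -rmorphB /= subr_ge0 nr_star.
Qed.

Lemma lim_lact a (u : nat -> H) l : lim_to u l -> lim_to (fun n => lact M a (u n)) (lact M a l).
Proof.
by apply: (@lim_lip R H H (fun v : H => lact M a v) (nr a) u l) => x y; rewrite -lactBr lact_le.
Qed.

Lemma lim_ract a (u : nat -> H) l : lim_to u l -> lim_to (fun n => ract M (u n) a) (ract M l a).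
Proof.
by apply: (@lim_lip R H H (fun v : H => ract M v a) (nr a) u l) => x y; rewrite -ractBl ract_le.
Qed.

Lemma central_closed : closed_subspace (central_vectors M).
Proof.
split.
- by move=> a; rewrite (linear0 (lact M a)) (linear0l (ract M)).
- by move=> x y hx hy a; rewrite lactDr ractDl hx hy.
- by move=> k x hx a; rewrite lactZr ractZl hx.
- move=> u l hu ul a; apply: (lim_uniq (lim_lact a ul)).
  have -> : (fun n => lact M a (u n)) = (fun n => ract M (u n) a).
    by apply/funext => n; exact: hu.
  exact: lim_ract.
Qed.

Definition commut a xi := lact M a xi - ract M xi a.

Lemma commutB a xi eta : commut a (xi - eta) = commut a xi - commut a eta.
Proof. by rewrite /commut lactBr ractBl !opprB addrACA [RHS]addrACA [- lact M a eta + _]addrC. Qed.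

Lemma commutZ a (k : R[i]) xi : commut a (k *: xi) = k *: commut a xi.
Proof. by rewrite /commut lactZr ractZl scalerBr. Qed.

Lemma commut_le a xi : nr (commut a xi) <= 2 * nr a * nr xi.
Proof.
by apply: le_trans (nrB _ _) _; have := lact_le a xi; have := ract_le a xi; lra.
Qed.

Lemma commut_star a xi eta : hdot (commut a xi) eta = hdot xi (commut (star a) eta) :> R[i].
Proof. by rewrite /commut hdotBl hdotBr lact_star ract_star. Qed.

Lemma commut_central a xi : central_vectors M xi -> commut a xi = 0.
Proof. by move=> h; rewrite /commut h subrr. Qed.

Definition gap_op (c : R) (Q : seq A) xi : H :=
  xi - (c^-1)%:C *: \sum_(x <- Q) commut (star x) (commut x xi).

Lemma gap_op_central c Q xi zeta : central_vectors M zeta ->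
  hdot (gap_op c Q xi) zeta = hdot xi zeta :> R[i].
Proof.
move=> hz; rewrite /gap_op hdotBl hdotZl.
rewrite (big_morph (fun v => hdot v zeta : R[i]) (fun v w => hdotDl v w zeta)
  (hdot0l zeta)).
rewrite big1 ?mulr0 ?subr0// => x _.
by rewrite commut_star (commut_central _ hz) hdot0r.
Qed.

Lemma sqr_sum_le (I : Type) (r : seq I) (a b : I -> R) :
  (\sum_(i <- r) a i * b i) ^+ 2 <= (\sum_(i <- r) a i ^+ 2) * (\sum_(i <- r) b i ^+ 2).
Proof.
elim: r => [|i r ih]; first by rewrite !big_nil expr0n mul0r.
rewrite !big_cons; set p := \sum_(j <- r) _ in ih *.
set x := \sum_(j <- r) _ in ih *; set y := \sum_(j <- r) _ in ih *.
have x0 : 0 <= x by apply: sumr_ge0 => j _; exact: sqr_ge0.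
have y0 : 0 <= y by apply: sumr_ge0 => j _; exact: sqr_ge0.
have h : 2 * (a i * b i) * p <= a i ^+ 2 * y + b i ^+ 2 * x.
  have [pp|pn] := leP 0 (a i * b i * p); last first.
    have := mulr_ge0 (sqr_ge0 (a i)) y0; have := mulr_ge0 (sqr_ge0 (b i)) x0.
    by move: pn; lra.
  have e0 : 0 <= a i ^+ 2 * y + b i ^+ 2 * x.
    exact: (addr_ge0 (mulr_ge0 (sqr_ge0 _) y0) (mulr_ge0 (sqr_ge0 _) x0)).
  rewrite -(ler_pXn2r (ltn0Sn 1)) ?nnegrE//; last by rewrite -mulrA mulr_ge0.
  have h1 : (2 * (a i * b i) * p) ^+ 2 <= 4 * (a i ^+ 2 * y) * (b i ^+ 2 * x).
    have -> : (2 * (a i * b i) * p) ^+ 2 = 4 * (a i ^+ 2 * b i ^+ 2) * p ^+ 2 by ring.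
    have -> : 4 * (a i ^+ 2 * y) * (b i ^+ 2 * x) =
      4 * (a i ^+ 2 * b i ^+ 2) * (x * y) by ring.
    apply: ler_wpM2l => //; apply: mulr_ge0 => //; apply: mulr_ge0; exact: sqr_ge0.
  apply: le_trans h1 _; rewrite -subr_ge0.
  have -> : (a i ^+ 2 * y + b i ^+ 2 * x) ^+ 2 - 4 * (a i ^+ 2 * y) * (b i ^+ 2 * x) =
    (a i ^+ 2 * y - b i ^+ 2 * x) ^+ 2 by ring.
  exact: sqr_ge0.
rewrite sqrrD mulrDl !mulrDr exprMn -!addrA lerD2l.
by move: ih h; lra.
Qed.

Lemma nr_sum (V : normedZmodType R[i]) (I : Type) (r : seq I) (f : I -> V) :
  nr (\sum_(i <- r) f i) <= \sum_(i <- r) nr (f i).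
Proof.
elim: r => [|i r ih]; first by rewrite !big_nil nr0.
by rewrite !big_cons; apply: le_trans (nrD _ _) _; rewrite lerD2l.
Qed.

(* With [Delta = \sum_x D_x^* D_x] and [|Delta| <= c] one has
   [|Delta eta|^2 <= c <Delta eta, eta>].                                     *)
Lemma gap_op_norm c Q eta (beta : R) : 0 < c ->
  \sum_(x <- Q) (2 * nr x) ^+ 2 <= c ->
  beta ^+ 2 * nr eta ^+ 2 <= \sum_(x <- Q) nr (commut x eta) ^+ 2 ->
  nr (gap_op c Q eta) ^+ 2 <= (1 - beta ^+ 2 / c) * nr eta ^+ 2.
Proof.
move=> c0 hc gap; rewrite /gap_op; set D := \sum_(x <- Q) _.
have hD : complex.Re (hdot eta D) = \sum_(x <- Q) nr (commut x eta) ^+ 2.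
  rewrite /D (big_morph (fun v => hdot eta v : R[i]) (fun v w => hdotDr v w eta)
    (hdot0r eta)) raddf_sum; apply: eq_bigr => x _ /=.
  by rewrite -commut_star hdot_nr.
have nD : nr D ^+ 2 <= c * complex.Re (hdot eta D).
  have h1 : nr D <= \sum_(x <- Q) (2 * nr x) * nr (commut x eta).
    apply: le_trans (nr_sum _ _) _; apply: ler_sum => x _.
    by apply: le_trans (commut_le _ _) _; rewrite nr_star.
  apply: (@le_trans _ _ ((\sum_(x <- Q) (2 * nr x) * nr (commut x eta)) ^+ 2)).
    rewrite ler_pXn2r ?nnegrE ?nr_ge0//; exact: le_trans (nr_ge0 _) h1.
  apply: le_trans (sqr_sum_le _ _ _) _; rewrite hD ler_wpM2r//.
  by apply: sumr_ge0 => x _; exact: sqr_ge0.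
rewrite nr2_sub hdotZr cjr nrZr exprMn ger0_norm ?invr_ge0 ?(ltW c0)//.
have -> : complex.Re ((c^-1)%:C * hdot eta D) = c^-1 * complex.Re (hdot eta D).
  by case: (hdot eta D) => u v /=; ring.
have c1 : c^-1 ^+ 2 * nr D ^+ 2 <= c^-1 * complex.Re (hdot eta D).
  apply: le_trans (ler_wpM2l (sqr_ge0 _) nD) _.
  rewrite le_eqVlt; apply/orP; left; apply/eqP; field.
  by rewrite gt_eqF.
have c2 : c^-1 * (beta ^+ 2 * nr eta ^+ 2) <= c^-1 * complex.Re (hdot eta D).
  by rewrite hD ler_wpM2l// invr_ge0 ltW.
by move: c1 c2; lra.
Qed.

Lemma gap_op_fix c Q zeta : central_vectors M zeta -> gap_op c Q zeta = zeta.
Proof.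
move=> hz; rewrite /gap_op big1 ?scaler0 ?subr0// => x _.
by rewrite (commut_central _ hz) /commut (linear0 (lact M _)) (linear0l (ract M)) subr0.
Qed.

Lemma gap_opB c Q xi eta : gap_op c Q (xi - eta) = gap_op c Q xi - gap_op c Q eta.
Proof.
rewrite /gap_op.
have -> : \sum_(x <- Q) commut (star x) (commut x (xi - eta)) =
   \sum_(x <- Q) commut (star x) (commut x xi) - \sum_(x <- Q) commut (star x) (commut x eta).
  by rewrite -sumrB; apply: eq_bigr => x _; rewrite !commutB.
by rewrite scalerBr !opprB addrACA [RHS]addrACA [- eta + _]addrC.
Qed.

Definition orth_gap (Q : seq A) (beta : R) := forall eta : H,
  (forall zeta, central_vectors M zeta -> hdot eta zeta = 0 :> R[i]) ->
  beta ^+ 2 * nr eta ^+ 2 <= \sum_(x <- Q) nr (commut x eta) ^+ 2.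

Lemma gap_op_iter c Q (beta : R) xi n : 0 < c ->
  \sum_(x <- Q) (2 * nr x) ^+ 2 + beta ^+ 2 <= c -> orth_gap Q beta ->
  nr (iter n (gap_op c Q) xi - orth_proj (central_vectors M) xi) ^+ 2 <=
  (1 - beta ^+ 2 / c) ^+ n * nr xi ^+ 2.
Proof.
move=> c0 hc gap; set p := orth_proj _ xi.
have [Lp hp] := orth_projP xi central_closed; rewrite -/p in Lp hp.
have Q0 : 0 <= \sum_(x <- Q) (2 * nr x) ^+ 2 by apply: sumr_ge0 => x _; exact: sqr_ge0.
have rho0 : 0 <= 1 - beta ^+ 2 / c.
  by rewrite subr_ge0 ler_pdivrMr// mul1r; apply: le_trans hc; rewrite lerDr.
have orth k zeta : central_vectors M zeta ->
    hdot (iter k (gap_op c Q) xi - p) zeta = 0 :> R[i].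
  move=> hz; elim: k => [|k ih]; first exact: hp.
  by rewrite /= -(gap_op_fix c Q Lp) -gap_opB gap_op_central.
elim: n => [|n ih].
  rewrite /= expr0 mul1r.
  have h : xi = (xi - p) + p by rewrite subrK.
  by rewrite {2}h (pythagoras (hp _ Lp)) lerDl sqr_ge0.
rewrite /= -{1}(gap_op_fix c Q Lp) -gap_opB.
apply: le_trans (gap_op_norm c0 _ (gap _ (orth n))) _.
  by apply: le_trans hc; rewrite lerDl sqr_ge0.
rewrite [_ ^+ n.+1]exprS -[_ * _ * nr xi ^+ 2]mulrA; exact: ler_wpM2l.
Qed.

End HilbertBimodules.

Lemma strong_T_gap (R : realType) (A : cstarAlgType R) : strong_property_T A ->
  exists (Q : seq A) (beta : R), 0 < beta /\ forall (H : hilbertType R) (M : hilbert_bimodule A H), orth_gap M Q beta.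
Proof.
move=> /(_ 1 ltr01)[Q0 [beta [_ /finite_seqP[Q QE] beta0 HT]]].
exists Q, beta; split => // H M eta orth.
have [->|eta0] := eqVneq eta 0.
  rewrite nr0 expr0n mulr0; apply: sumr_ge0 => x _; exact: sqr_ge0.
have n0 : 0 < nr eta by rewrite lt_def nr_eq0 eta0 nr_ge0.
pose xi := ((nr eta)^-1)%:C *: eta.
have nxi : nr xi = 1.
  by rewrite nrZr ger0_norm ?invr_ge0 ?nr_ge0// mulVf// gt_eqF.
have pxi : orth_proj (central_vectors M) xi = 0.
  apply: orth_proj_orthogonal; first exact: central_closed.
  by move=> z hz; rewrite hdotZl orth// mulr0.
have [x xQ hx] : exists2 x, x \in Q & beta <= nr (commut M x xi).
  apply: contrapT => nx.
  have ac : almost_central_unit M Q0 beta xi.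
    split; first by rewrite nrE nxi.
    move=> x; rewrite QE /= => xQ; rewrite nrE ltcR ltNge; apply/negP => h.
    by apply: nx; exists x.
  by have := HT H M xi ac; rewrite pxi subr0 nrE nxi ltxx.
have le1 : beta * nr eta <= nr (commut M x eta).
  move: hx; rewrite commutZ nrZr ger0_norm ?invr_ge0 ?nr_ge0//.
  by rewrite mulrC ler_pdivlMr.
rewrite -exprMn (big_rem x)//= -[leLHS]addr0 lerD//.
  by rewrite ler_pXn2r// nnegrE ?nr_ge0 ?mulr_ge0 ?nr_ge0 ?ltW.
by apply: sumr_ge0 => y _; exact: sqr_ge0.
Qed.

(** * Orthonormal families *)

Section GramSchmidt.
Variables (R : realType) (A : cstarAlgType R) (tau : A -> R[i]).
Hypothesis ptau : pfun tau.
Implicit Types (x y b c : A).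

Definition orthonormal n (e : 'I_n -> A) :=
  forall i j, tau (star (e j) * e i) = (i == j)%:R.

Definition nullv x := tau (star x * x) = 0.

Definition oproj n (e : 'I_n -> A) b := \sum_i tau (star (e i) * b) *: e i.

Lemma pfunD x y : tau (x + y) = tau x + tau y. Proof. exact: ptau.1.1. Qed.
Lemma pfunZ k x : tau (k *: x) = k * tau x. Proof. exact: ptau.1.2. Qed.
Lemma pfunN x : tau (- x) = - tau x. Proof. exact: clinN ptau.1. Qed.
Lemma pfunB x y : tau (x - y) = tau x - tau y. Proof. exact: clinB ptau.1. Qed.
Lemma pfunMsum c n (f : 'I_n -> A) :
  tau (c * \sum_i f i) = \sum_i tau (c * f i).
Proof. by rewrite mulr_sumr (clin_sum _ _ _ ptau.1). Qed.
Lemma pfun_ipC x y : tau (star y * x) = conjc (tau (star x * y)).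
Proof. exact: pfun_formC. Qed.

Lemma nullv_Re x : complex.Re (tau (star x * x)) <= 0 -> nullv x.
Proof.
move=> h; rewrite /nullv (ge0_Re (ptau.2 x)) (_ : complex.Re _ = 0)//.
by apply/eqP; rewrite eq_le h Re_ge0// ptau.2.
Qed.

Lemma null_ip x y : nullv x -> tau (star y * x) = 0.
Proof.
move=> hx; have := pfun_CS x y ptau; rewrite hx mul0r => h.
by apply: nr0_eq; apply/eqP; rewrite -sqrf_eq0 eq_le h sqr_ge0.
Qed.

Lemma oproj_ip n (e : 'I_n -> A) b j : orthonormal e ->
  tau (star (e j) * oproj e b) = tau (star (e j) * b).
Proof.
move=> oe; rewrite /oproj pfunMsum (bigD1 j)//= big1 => [|i ij].
  by rewrite addr0 -scaleMr pfunZ oe eqxx mulr1.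
by rewrite -scaleMr pfunZ oe (negPf ij) mulr0.
Qed.

Lemma gram_schmidt (J : set A) (s : seq A) : J 0 ->
  (forall x y, J x -> J y -> J (x + y)) -> (forall (k : R[i]) x, J x -> J (k *: x)) ->
  (forall b, b \in s -> J b) ->
  exists n (e : 'I_n -> A), [/\ orthonormal e, forall i, J (e i) &
    forall b, b \in s -> nullv (b - oproj e b)].
Proof.
move=> J0 JD JZ; elim: s => [|b s ih] Js.
  by exists 0%N, (fun=> 0); split=> // -[].
have [n [e [oe Je he]]] : exists n (e : 'I_n -> A), [/\ orthonormal e, forall i, J (e i) &
    forall b, b \in s -> nullv (b - oproj e b)].
  by apply: ih => c cs; apply: Js; rewrite inE cs orbT.
pose r := b - oproj e b.
have er i : tau (star (e i) * r) = 0 by rewrite mulrBr pfunB oproj_ip// subrr.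
have [nr0|nnr] := pselect (nullv r).
  exists n, e; split => // c; rewrite inE => /orP[/eqP ->//|]; exact: he.
have rr0 : 0 < complex.Re (tau (star r * r)).
  by rewrite ltNge; apply/negP => h; apply: nnr; exact: nullv_Re.
pose m := Num.sqrt (complex.Re (tau (star r * r))).
have m0 : 0 < m by rewrite sqrtr_gt0.
have m2 : tau (star r * r) = (m ^+ 2)%:C by rewrite sqr_sqrtr ?ltW// -ge0_Re// ptau.2.
pose v := (m^-1)%:C *: r.
have ev i : tau (star (e i) * v) = 0 by rewrite -scaleMr pfunZ er mulr0.
have vv : tau (star v * v) = 1.
  rewrite /v starZr -scaleMr -scaleMl !pfunZ m2 -!rmorphM.
  by rewrite (_ : m^-1 * (m^-1 * m ^+ 2) = 1)//; field; rewrite gt_eqF.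
have rv : tau (star v * b) = m%:C.
  have -> : b = r + oproj e b by rewrite subrK.
  have -> : star v * (r + oproj e b) = star v * r + star v * oproj e b by rewrite mulrDr.
  rewrite pfunD /oproj pfunMsum big1 => [|i _]; last first.
    by rewrite -scaleMr pfunZ (pfun_ipC (e i) v) ev conjc0 mulr0.
  rewrite addr0 starZr -scaleMl pfunZ m2 -rmorphM; congr (_%:C).
  by field; rewrite gt_eqF.
pose e' (i : 'I_n.+1) := if unlift ord0 i is Some j then e j else v.
have e'0 : e' ord0 = v by rewrite /e' unlift_none.
have e'S i : e' (lift ord0 i) = e i by rewrite /e' liftK.
have pe' c : oproj e' c = tau (star v * c) *: v + oproj e c.
  by rewrite /oproj big_ord_recl e'0; congr (_ + _); apply: eq_bigr => i _; rewrite e'S.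
exists n.+1, e'; split.
- move=> i j; case: (unliftP ord0 i) => [i'|] ->; case: (unliftP ord0 j) => [j'|] ->;
    rewrite ?e'0 ?e'S.
  + by rewrite oe (inj_eq (@lift_inj _ ord0)).
  + by rewrite pfun_ipC ev conjc0 eq_sym (negPf (neq_lift _ _)).
  + by rewrite ev (negPf (neq_lift _ _)).
  + by rewrite vv eqxx.
- move=> i; case: (unliftP ord0 i) => [i'|] ->; rewrite ?e'0 ?e'S//.
  apply: (JZ); apply: (JD); first by apply: Js; rewrite inE eqxx.
  rewrite -scaleN1r; apply: (JZ); rewrite /oproj.
  by apply: big_ind => // k _; apply: (JZ).
- move=> c; rewrite inE => /orP[/eqP ->|cs].
    rewrite pe' rv opprD addrCA addrC -/r.
    have -> : r - m%:C *: v = 0.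
      by rewrite /v scalerA -rmorphM /= mulfV ?gt_eqF// scale1r subrr.
    by rewrite /nullv mulr0 -[0 in LHS](scale0r 0) pfunZ mul0r.
  have h := he c cs.
  have -> : c - oproj e' c = c - oproj e c.
    rewrite pe'; have -> : tau (star v * c) = 0.
      have -> : c = (c - oproj e c) + oproj e c by rewrite subrK.
      rewrite mulrDr pfunD (null_ip _ h) add0r pfunMsum big1// => i _.
      by rewrite -scaleMr pfunZ (pfun_ipC (e i) v) ev conjc0 mulr0.
    by rewrite scale0r add0r.
  exact: h.
Qed.

Lemma parseval n (e : 'I_n -> A) b c : nullv (b - oproj e b) ->
  tau (star c * b) = \sum_i tau (star (e i) * b) * conjc (tau (star (e i) * c)).
Proof.
move=> h; have {1}-> : b = (b - oproj e b) + oproj e b by rewrite subrK.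
rewrite mulrDr pfunD (null_ip _ h) add0r pfunMsum; apply: eq_bigr => i _.
by rewrite -scaleMr pfunZ -pfun_ipC.
Qed.

Lemma bessel n (e : 'I_n -> A) b : orthonormal e ->
  \sum_i nr (tau (star (e i) * b)) ^+ 2 <= complex.Re (tau (star b * b)).
Proof.
move=> oe; pose r := b - oproj e b.
have er i : tau (star (e i) * r) = 0 by rewrite mulrBr pfunB oproj_ip// subrr.
have h c : tau (star c * oproj e b) =
    \sum_i tau (star (e i) * b) * conjc (tau (star (e i) * c)).
  by rewrite pfunMsum; apply: eq_bigr => i _; rewrite -scaleMr pfunZ -pfun_ipC.
have e1 : tau (star r * r) = tau (star r * b).
  rewrite {2}/r mulrBr pfunB h big1 ?subr0// => i _.
  by rewrite er conjc0 mulr0.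
have e2 : tau (star r * b) = tau (star b * b) - tau (star (oproj e b) * b).
  by rewrite starB mulrBl pfunB.
have e3 : tau (star (oproj e b) * b) = (\sum_i nr (tau (star (e i) * b)) ^+ 2)%:C.
  rewrite pfun_ipC h cj_sum rmorph_sum; apply: eq_bigr => i _ /=.
  by rewrite sqr_nr cjM conjcK mulrC.
have := Re_ge0 (ptau.2 r); rewrite e1 e2 e3.
by case: (tau (star b * b)) => u v /=; rewrite subr_ge0.
Qed.

End GramSchmidt.

(** * Coarse bimodules *)

Lemma lip_continuous (R : realType) (V W : normedModType R[i]) (f : V -> W) (C : R) :
  (forall x y, nr (f x - f y) <= C * nr (x - y)) -> continuous f.
Proof.
move=> fC x; apply/cvgrPdist_lt => eps eps0.
have er : eps = (complex.Re eps)%:C by rewrite RRe_real// gtr0_real.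
have e0 : 0 < complex.Re eps by rewrite -ltcR -er.
have C1 : 0 < `|C| + 1 by rewrite ltr_wpDl.
have d0 : (0 : R[i]) < (complex.Re eps / (`|C| + 1))%:C by rewrite ltcR divr_gt0.
apply: filterS (nbhsx_ballx x _ d0) => y; rewrite -ball_normE /=.
rewrite !nrE er !ltcR ltr_pdivlMr// => h.
apply: le_lt_trans (fC _ _) (le_lt_trans _ h); rewrite mulrC ler_wpM2l ?nr_ge0//.
by apply: le_trans (ler_norm C) _; rewrite lerDl.
Qed.

Section TensorLists.
Variables (R : realType) (A : cstarAlgType R).
Implicit Types (a b c d x y : A) (s t u : seq (A * A)) (k : R[i]).

(* A list of pairs [(a, b)] stands for the sum of the tensors [a (x) b], on
   which A acts by [c . (a (x) b) . d = (c * a) (x) (b * d)].                 *)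
Definition lmap a s : seq (A * A) := [seq (a * p.1, p.2) | p <- s].
Definition rmap a s : seq (A * A) := [seq (p.1, p.2 * a) | p <- s].
Definition imap a s : seq (A * A) := [seq (p.1 * a, p.2) | p <- s].
Definition jmap a s : seq (A * A) := [seq (p.1, a * p.2) | p <- s].
Definition swapT s : seq (A * A) := [seq (p.2, p.1) | p <- s].
Definition sclT k s : seq (A * A) := [seq (k *: p.1, p.2) | p <- s].

Variables (F tau : A -> R[i]).

Definition cform s t : R[i] :=
  \sum_(p <- s) \sum_(q <- t) F (star q.1 * p.1) * tau (star q.2 * p.2).

Hypotheses (pF : pfun F) (ptau : pfun tau).
Hypothesis trtau : forall x y, tau (x * y) = tau (y * x).

Lemma cformD s t u : cform (s ++ t) u = cform s u + cform t u.
Proof. by rewrite /cform big_cat. Qed.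

Lemma cformZ k s t : cform (sclT k s) t = k * cform s t.
Proof.
rewrite /cform big_map mulr_sumr; apply: eq_bigr => p _.
rewrite mulr_sumr; apply: eq_bigr => q _.
by rewrite -scaleMr pF.1.2 mulrA.
Qed.

Lemma cformC s t : cform s t = conjc (cform t s).
Proof.
rewrite /cform exchange_big cj_sum; apply: eq_bigr => q _.
rewrite cj_sum; apply: eq_bigr => p _.
by rewrite cjM -!pfun_formC.
Qed.

Lemma cform_ge0 s : 0 <= cform s s.
Proof.
have [n [e [oe _ he]]] : exists n (e : 'I_n -> A), [/\ orthonormal tau e,
    forall i, setT (e i) & forall b, b \in map snd s -> nullv tau (b - oproj tau e b)].
  exact: gram_schmidt.
pose y i := \sum_(p <- s) tau (star (e i) * p.2) *: p.1.
have -> : cform s s = \sum_i F (star (y i) * y i).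
  have E (p q : A * A) : p \in s -> F (star q.1 * p.1) * tau (star q.2 * p.2) =
      \sum_i (tau (star (e i) * p.2) * conjc (tau (star (e i) * q.2)) * F (star q.1 * p.1)).
    move=> ps; rewrite (parseval ptau _ (he _ (map_f _ ps))) mulr_sumr.
    by apply: eq_bigr => i _; rewrite mulrC.
  rewrite /cform big_seq.
  under eq_bigr => p ps do under eq_bigr => q _ do rewrite (E p q ps).
  rewrite -big_seq; under eq_bigr => p _ do rewrite exchange_big.
  rewrite exchange_big; apply: eq_bigr => i _.
  rewrite /y mulr_sumr (clin_sum _ _ _ pF.1); apply: eq_bigr => p _.
  rewrite star_sum mulr_suml (clin_sum _ _ _ pF.1); apply: eq_bigr => q _.
  by rewrite starZc -scaleMr -scaleMl !pF.1.2 mulrA.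
by apply: sumr_ge0 => i _; exact: pF.2.
Qed.

Definition coarse : prehilbert R := PreHilbert [::] cformD cformZ cformC cform_ge0.

Lemma cform_lmap a s t : cform (lmap a s) t = cform s (lmap (star a) t).
Proof.
rewrite /cform big_map; apply: eq_bigr => p _; rewrite big_map; apply: eq_bigr => q _ /=.
by rewrite starMr starK mulrA.
Qed.

Lemma cform_rmap a s t : cform (rmap a s) t = cform s (rmap (star a) t).
Proof.
rewrite /cform big_map; apply: eq_bigr => p _; rewrite big_map; apply: eq_bigr => q _ /=.
by congr (_ * _); rewrite starMr starK mulrA trtau mulrA.
Qed.

Lemma cform_lmapD k a b s t :
  cform (lmap (k *: a + b) s) t = k * cform (lmap a s) t + cform (lmap b s) t.
Proof.
rewrite /cform !big_map mulr_sumr -big_split; apply: eq_bigr => p _ /=.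
rewrite mulr_sumr -big_split; apply: eq_bigr => q _ /=.
by rewrite mulrDl mulrDr -scaleMl -scaleMr pF.1.1 pF.1.2; ring.
Qed.

Lemma cform_rmapD k a b s t :
  cform (rmap (k *: a + b) s) t = k * cform (rmap a s) t + cform (rmap b s) t.
Proof.
rewrite /cform !big_map mulr_sumr -big_split; apply: eq_bigr => p _ /=.
rewrite mulr_sumr -big_split; apply: eq_bigr => q _ /=.
by rewrite mulrDr mulrDr -!scaleMr ptau.1.1 ptau.1.2; ring.
Qed.

Lemma lmapM a b s : lmap (a * b) s = lmap a (lmap b s).
Proof. by rewrite /lmap -map_comp; apply: eq_map => p /=; rewrite mulrA. Qed.
Lemma rmapM a b s : rmap (a * b) s = rmap b (rmap a s).
Proof. by rewrite /rmap -map_comp; apply: eq_map => p /=; rewrite mulrA. Qed.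
Lemma lmap1 s : lmap 1 s = s.
Proof. by rewrite -[RHS]map_id; apply: eq_map => -[p q] /=; rewrite mul1r. Qed.
Lemma rmap1 s : rmap 1 s = s.
Proof. by rewrite -[RHS]map_id; apply: eq_map => -[p q] /=; rewrite mulr1. Qed.
Lemma lrmap a b s : lmap a (rmap b s) = rmap b (lmap a s).
Proof. by rewrite /lmap /rmap -!map_comp; exact: eq_map. Qed.
Lemma lmap_scl a k s : lmap a (sclT k s) = sclT k (lmap a s).
Proof. by rewrite /lmap /sclT -!map_comp; apply: eq_map => p /=; rewrite scaleMr. Qed.
Lemma rmap_scl a k s : rmap a (sclT k s) = sclT k (rmap a s).
Proof. by rewrite /rmap /sclT -!map_comp; exact: eq_map. Qed.

Lemma cform_lmapB (r : R) b s t :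
  cform (lmap (r%:C *: (1 : A) - b) s) t = r%:C * cform s t - cform (lmap b s) t.
Proof.
have -> : r%:C *: (1 : A) - b = (-1) *: b + r%:C *: (1 : A) by cstar.
rewrite cform_lmapD mulN1r addrC; congr (_ - _).
rewrite -cformZ; congr cform; apply: eq_map => p.
by rewrite -scaleMl mul1r.
Qed.

Lemma cform_rmapB (r : R) b s t :
  cform (rmap (r%:C *: (1 : A) - b) s) t = r%:C * cform s t - cform (rmap b s) t.
Proof.
have -> : r%:C *: (1 : A) - b = (-1) *: b + r%:C *: (1 : A) by cstar.
rewrite cform_rmapD mulN1r addrC; congr (_ - _).
rewrite /cform big_map mulr_sumr; apply: eq_bigr => p _.
rewrite mulr_sumr; apply: eq_bigr => q _ /=.
by rewrite -!scaleMr mulr1 ptau.1.2 mulrCA.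
Qed.

Lemma pn_lmap a s : @pn R coarse (lmap a s) <= nr a * @pn R coarse s.
Proof.
have [z [sz zz]] := pos_norm_sqrt a.
rewrite -(ler_pXn2r (ltn0Sn 1)) ?nnegrE ?mulr_ge0 ?nr_ge0 ?pn_ge0// exprMn !pn2 /=.
have := Re_ge0 (cform_ge0 (lmap z s)).
rewrite -[X in cform _ (lmap X _)]sz -cform_lmap -lmapM zz cform_lmapB lmapM cform_lmap starK.
rewrite raddfB /= subr_ge0.
by case: (cform s s) => u v /=; rewrite mul0r subr0.
Qed.

Lemma pn_rmap a s : @pn R coarse (rmap a s) <= nr a * @pn R coarse s.
Proof.
have [z [sz zz]] := pos_norm_sqrt (star a).
rewrite -(ler_pXn2r (ltn0Sn 1)) ?nnegrE ?mulr_ge0 ?nr_ge0 ?pn_ge0// exprMn !pn2 /=.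
have := Re_ge0 (cform_ge0 (rmap z s)).
rewrite -[X in cform _ (rmap X _)]sz -cform_rmap -rmapM zz cform_rmapB rmapM cform_rmap starK.
rewrite nr_star raddfB /= subr_ge0.
by case: (cform s s) => u v /=; rewrite mul0r subr0.
Qed.

Local Notation HT := (hcomp coarse).

Lemma h_congr (g : HT) s t : (forall u, cform s u = cform t u) -> g s = g t.
Proof.
move=> h; apply/eqP; rewrite -subr_eq0; apply/eqP.
have -> : g s - g t = g (@ph_add R coarse s (@ph_scl R coarse (-1) t)).
  by rewrite hD hZ cjN cj1 mulN1r.
apply: nr_le0; apply: le_trans (h_ub _ _) _.
rewrite (_ : pn _ = 0) ?mulr0//; apply/eqP; rewrite -sqrf_eq0 pn2 /=.
by rewrite cformD cformZ h mulN1r subrr.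
Qed.

Lemma clact_law a (g : HT) : antilinear_law (fun s : coarse => g (lmap (star a) s)).
Proof.
split=> [s t|k s] /=; first by rewrite /lmap map_cat; exact: hD.
by rewrite lmap_scl; exact: hZ.
Qed.

Lemma cract_law a (g : HT) : antilinear_law (fun s : coarse => g (rmap (star a) s)).
Proof.
split=> [s t|k s] /=; first by rewrite /rmap map_cat; exact: hD.
by rewrite rmap_scl; exact: hZ.
Qed.

Lemma clact_ub a (g : HT) (s : coarse) :
  nr (g (lmap (star a) s)) <= (nr a * nr g) * pn s.
Proof.
apply: le_trans (h_ub _ _) _; rewrite [nr a * _]mulrC -mulrA ler_wpM2l ?nr_ge0//.
by apply: le_trans (pn_lmap _ _) _; rewrite nr_star.
Qed.

Lemma cract_ub a (g : HT) (s : coarse) :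
  nr (g (rmap (star a) s)) <= (nr a * nr g) * pn s.
Proof.
apply: le_trans (h_ub _ _) _; rewrite [nr a * _]mulrC -mulrA ler_wpM2l ?nr_ge0//.
by apply: le_trans (pn_rmap _ _) _; rewrite nr_star.
Qed.

Definition clact a (g : HT) : HT :=
  @Bdd R (hbs coarse) _ (clact_law a g) (ex_intro _ _ (clact_ub a g)).
Definition cract (g : HT) a : HT :=
  @Bdd R (hbs coarse) _ (cract_law a g) (ex_intro _ _ (cract_ub a g)).

Lemma clact_bilinear : bilinear_for ( *:%R : GRing.Scale.law R[i] HT)
  ( *:%R : GRing.Scale.law R[i] HT) clact.
Proof.
split=> [g k a b|a k g h]; last by apply: bdd_ext.
apply: bdd_ext => s; rewrite bddE_add bddE_scale /= starD starZc.
have -> : g (lmap (conjc k *: star a + star b) s) =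
    g (@ph_add R coarse (@ph_scl R coarse (conjc k) (lmap (star a) s)) (lmap (star b) s)).
  by apply: h_congr => u; rewrite cform_lmapD cformD cformZ.
by rewrite hD hZ conjcK.
Qed.

Lemma cract_bilinear : bilinear_for ( *:%R : GRing.Scale.law R[i] HT)
  ( *:%R : GRing.Scale.law R[i] HT) cract.
Proof.
split=> [a k g h|g k a b]; first by apply: bdd_ext.
apply: bdd_ext => s; rewrite bddE_add bddE_scale /= starD starZc.
have -> : g (rmap (conjc k *: star a + star b) s) =
    g (@ph_add R coarse (@ph_scl R coarse (conjc k) (rmap (star a) s)) (rmap (star b) s)).
  by apply: h_congr => u; rewrite cform_rmapD cformD cformZ.
by rewrite hD hZ conjcK.
Qed.

HB.instance Definition _ := bilinear_isBilinear.Build R[i] A HT HT *:%R *:%R clact clact_bilinear.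
HB.instance Definition _ := bilinear_isBilinear.Build R[i] HT A HT *:%R *:%R cract cract_bilinear.

Lemma clact_le a g : nr (clact a g) <= nr a * nr g.
Proof. by apply: bnorm_le => [|s]; [rewrite mulr_ge0 ?nr_ge0|exact: clact_ub]. Qed.

Lemma cract_le a g : nr (cract g a) <= nr a * nr g.
Proof. by apply: bnorm_le => [|s]; [rewrite mulr_ge0 ?nr_ge0|exact: cract_ub]. Qed.

Lemma clact_hin a s : clact a (hin (s : coarse)) = hin (lmap a s : coarse).
Proof. by apply: bdd_ext => t /=; rewrite cform_lmap. Qed.

Lemma cract_hin a s : cract (hin (s : coarse)) a = hin (rmap a s : coarse).
Proof. by apply: bdd_ext => t /=; rewrite cform_rmap. Qed.

Lemma clactB a g h : clact a (g - h) = clact a g - clact a h.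
Proof. by apply: bdd_ext => s; rewrite bddE_sub /= ?bddE_sub ?mulN1r. Qed.

Lemma cractB a g h : cract (g - h) a = cract g a - cract h a.
Proof. by apply: bdd_ext => s; rewrite bddE_sub /= ?bddE_sub ?mulN1r. Qed.

Lemma clact_star a g h : hdot (clact a g) h = hdot g (clact (star a) h) :> R[i].
Proof.
have [u uh] := h_dense_seq h.
have uh' : lim_to (fun n => hin (lmap (star a) (u n) : coarse)) (clact (star a) h).
  have -> : (fun n => hin (lmap (star a) (u n) : coarse)) =
      (fun n => clact (star a) (hin (u n))).
    by apply/funext => n; rewrite clact_hin.
  apply: (@lim_lip R HT HT (clact (star a)) (nr (star a)) _ _ _ uh) => v w.
  by rewrite -clactB clact_le.
exact: (lim_uniq (hd_lim (clact a g) uh) (hd_lim g uh')).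
Qed.

Lemma cract_star g a h : hdot (cract g a) h = hdot g (cract h (star a)) :> R[i].
Proof.
have [u uh] := h_dense_seq h.
have uh' : lim_to (fun n => hin (rmap (star a) (u n) : coarse)) (cract h (star a)).
  have -> : (fun n => hin (rmap (star a) (u n) : coarse)) =
      (fun n => cract (hin (u n)) (star a)).
    by apply/funext => n; rewrite cract_hin.
  apply: (@lim_lip R HT HT (fun v => cract v (star a)) (nr (star a)) _ _ _ uh) => v w.
  by rewrite -cractB cract_le.
exact: (lim_uniq (hd_lim (cract g a) uh) (hd_lim g uh')).
Qed.

Definition coarse_bimodule : hilbert_bimodule A HT.
Proof.
refine (@HilbertBimodule R A HT clact cract _ _ _ _ _ _ _ _ _).
- move=> a; apply: (@lip_continuous R HT HT _ (nr a)) => g h.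
  by rewrite -clactB clact_le.
- move=> a; apply: (@lip_continuous R HT HT _ (nr a)) => g h.
  by rewrite -cractB cract_le.
- by move=> g; apply: bdd_ext => s /=; rewrite star1 lmap1.
- by move=> g; apply: bdd_ext => s /=; rewrite star1 rmap1.
- by move=> a b g; apply: bdd_ext => s /=; rewrite starMr lmapM.
- by move=> a b g; apply: bdd_ext => s /=; rewrite starMr rmapM.
- exact: clact_star.
- by move=> a g h; exact: cract_star.
- by move=> a b g; apply: bdd_ext => s /=; rewrite lrmap.
Defined.

End TensorLists.

Section SliceMap.
Variables (R : realType) (A : cstarAlgType R) (tau : A -> R[i]).
Hypotheses (ptau : pfun tau) (tau1 : tau 1 = 1).
Hypothesis trtau : forall x y, tau (x * y) = tau (y * x).
Implicit Types (a b c d x y : A) (s t u : seq (A * A)) (k : R[i]).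
Variables (Q : seq A) (beta : R).
Hypothesis beta0 : 0 < beta.
Hypothesis gap : forall (H : hilbertType R) (M : hilbert_bimodule A H),
  orth_gap M Q beta.

Definition slice s : A := \sum_(p <- s) tau p.2 *: p.1.

Lemma slice_cat s t : slice (s ++ t) = slice s + slice t.
Proof. by rewrite /slice big_cat. Qed.
Lemma slice_scl k s : slice (sclT k s) = k *: slice s.
Proof.
by rewrite /slice big_map scaler_sumr; apply: eq_bigr => p _; rewrite !scalerA mulrC.
Qed.
Lemma slice_lmap a s : slice (lmap a s) = a * slice s.
Proof.
by rewrite /slice big_map mulr_sumr; apply: eq_bigr => p _; rewrite scaleMr.
Qed.
Lemma slice_imap a s : slice (imap a s) = slice s * a.
Proof.
by rewrite /slice big_map mulr_suml; apply: eq_bigr => p _; rewrite scaleMl.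
Qed.
Lemma slice_jmap a s : slice (jmap a s) = slice (rmap a s).
Proof. by rewrite /slice !big_map; apply: eq_bigr => p _; rewrite trtau. Qed.

Definition sub_T s t := s ++ sclT (-1) t.

Lemma slice_sub s t : slice (sub_T s t) = slice s - slice t.
Proof. by rewrite slice_cat slice_scl scaleN1r. Qed.

Definition commT x s := sub_T (lmap x s) (rmap x s).
Definition gapc : R := 1 + (\sum_(x <- Q) (2 * nr x) ^+ 2 + beta ^+ 2).
Definition gapT s :=
  s ++ sclT (- (gapc^-1)%:C) (flatten [seq commT (star x) (commT x s) | x <- Q]).

Lemma Q_ge0 : 0 <= \sum_(x <- Q) (2 * nr x) ^+ 2.
Proof. by apply: sumr_ge0 => x _; exact: sqr_ge0. Qed.

Lemma gapc_gt0 : 0 < gapc.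
Proof. by rewrite /gapc ltr_wpDr// addr_ge0 ?Q_ge0// sqr_ge0. Qed.

Definition rate n : R := Num.sqrt ((1 - beta ^+ 2 / gapc) ^+ n).

Lemma rate0_bound : 0 <= 1 - beta ^+ 2 / gapc < 1.
Proof.
rewrite subr_ge0 ler_pdivrMr ?gapc_gt0// mul1r gtrBl divr_gt0 ?gapc_gt0 ?exprn_gt0// andbT.
by rewrite /gapc; have := Q_ge0; lra.
Qed.

Lemma rate_ge0 n : 0 <= rate n.
Proof. exact: sqrtr_ge0. Qed.

Lemma rate_sq n : rate n ^+ 2 = (1 - beta ^+ 2 / gapc) ^+ n.
Proof. by rewrite sqr_sqrtr// exprn_ge0//; have /andP[] := rate0_bound. Qed.

Lemma rate_small e : 0 < e -> exists N, forall n, (N <= n)%N -> rate n < e.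
Proof.
move=> e0; have /andP[h0 h1] := rate0_bound.
have q1 : `|1 - beta ^+ 2 / gapc| < 1 by rewrite ger0_norm.
have e2 : 0 < e ^+ 2 by rewrite exprn_gt0.
have := cvg_expr q1 => /cvgrPdist_lt /(_ (e ^+ 2) e2)[N _ hN].
exists N => n Nn; rewrite -(ltr_pXn2r (ltn0Sn 1)) ?nnegrE ?rate_ge0 ?(ltW e0)//.
rewrite rate_sq; move: (hN n Nn) => /=; rewrite sub0r normrN.
by apply: le_lt_trans; exact: ler_norm.
Qed.

Lemma imap_gapT a s : gapT (imap a s) = imap a (gapT s).
Proof.
have hl x t : lmap x (imap a t) = imap a (lmap x t).
  by rewrite /lmap /imap -!map_comp; apply: eq_map => p /=; rewrite mulrA.
have hr x t : rmap x (imap a t) = imap a (rmap x t).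
  by rewrite /rmap /imap -!map_comp; exact: eq_map.
have hs k t : sclT k (imap a t) = imap a (sclT k t).
  by rewrite /sclT /imap -!map_comp; apply: eq_map => p /=; rewrite scaleMl.
have hc x t : commT x (imap a t) = imap a (commT x t).
  by rewrite /commT /sub_T hl hr hs [RHS]map_cat.
rewrite /gapT [RHS]map_cat; congr (_ ++ _); rewrite -/(imap _ _) -hs; congr sclT.
rewrite [RHS]map_flatten -map_comp; congr flatten; apply: eq_map => x /=.
by rewrite !hc.
Qed.

Lemma jmap_gapT a s : gapT (jmap a s) = jmap a (gapT s).
Proof.
have hl x t : lmap x (jmap a t) = jmap a (lmap x t).
  by rewrite /lmap /jmap -!map_comp; exact: eq_map.
have hr x t : rmap x (jmap a t) = jmap a (rmap x t).
  by rewrite /rmap /jmap -!map_comp; apply: eq_map => p /=; rewrite mulrA.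
have hs k t : sclT k (jmap a t) = jmap a (sclT k t).
  by rewrite /sclT /jmap -!map_comp; exact: eq_map.
have hc x t : commT x (jmap a t) = jmap a (commT x t).
  by rewrite /commT /sub_T hl hr hs [RHS]map_cat.
rewrite /gapT [RHS]map_cat; congr (_ ++ _); rewrite -/(jmap _ _) -hs; congr sclT.
rewrite [RHS]map_flatten -map_comp; congr flatten; apply: eq_map => x /=.
by rewrite !hc.
Qed.

Lemma imap_iter a s n : iter n gapT (imap a s) = imap a (iter n gapT s).
Proof. by elim: n => //= n ->; exact: imap_gapT. Qed.
Lemma jmap_iter a s n : iter n gapT (jmap a s) = jmap a (iter n gapT s).
Proof. by elim: n => //= n ->; exact: jmap_gapT. Qed.

Definition kaz n := iter n gapT [:: (1, 1)].

Section OneState.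
Variable F : A -> R[i].
Hypotheses (pF : pfun F) (F1 : F 1 = 1).
Local Notation T := (coarse pF ptau).
Local Notation M := (coarse_bimodule pF ptau trtau).
Local Notation hinT s := (@hin R T s).
Local Notation pnT s := (@pn R T s).

Lemma hin_commT x s : hinT (commT x s) = commut M x (hinT s).
Proof.
rewrite /commut /= clact_hin cract_hin.
by rewrite -[commT x s]/(@ph_add R T (lmap x s) (@ph_scl R T (-1) (rmap x s)))
  hinD hinZ scaleN1r.
Qed.

Lemma hin_gapT s : hinT (gapT s) = gap_op M gapc Q (hinT s).
Proof.
rewrite -[gapT s]/(@ph_add R T s (@ph_scl R T (- (gapc^-1)%:C) (flatten _))).
rewrite hinD hinZ scaleNr /gap_op; congr (_ - _ *: _).
elim: Q => [|x q ih] /=; first by rewrite big_nil; apply: bdd_ext => u; rewrite /= /cform big_nil.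
rewrite big_cons -ih -!hin_commT.
by rewrite -[commT _ _ ++ _]/(@ph_add R T _ _) hinD.
Qed.

Lemma hin_iter s n : hinT (iter n gapT s) = iter n (gap_op M gapc Q) (hinT s).
Proof. by elim: n => //= n ih; rewrite hin_gapT ih. Qed.

Definition kazP s : hcomp T := orth_proj (central_vectors M) (hinT s).

Lemma iter_dist s n : nr (hinT (iter n gapT s) - kazP s) <= rate n * pnT s.
Proof.
rewrite -(ler_pXn2r (ltn0Sn 1)) ?nnegrE ?nr_ge0 ?mulr_ge0 ?rate_ge0 ?pn_ge0//.
rewrite exprMn rate_sq hin_iter -nr_hin; apply: gap_op_iter => //; first exact: gapc_gt0.
by rewrite /gapc; lra.
Qed.

Lemma pn_one a b : pnT [:: (a, b)] ^+ 2 =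
  complex.Re (F (star a * a) * tau (star b * b)).
Proof. by rewrite pn2 /= /cform !big_seq1. Qed.

Lemma pn_one_le a b : pnT [:: (a, b)] <= nr a * nr b.
Proof.
rewrite -(ler_pXn2r (ltn0Sn 1)) ?nnegrE ?nr_ge0 ?mulr_ge0 ?nr_ge0 ?pn_ge0//.
rewrite pn_one exprMn (ge0_Re (pF.2 a)) (ge0_Re (ptau.2 b)) -rmorphM /=.
have h1 := pfun_bound a 1 pF; have h2 := pfun_bound b 1 ptau.
move: h1 h2; rewrite !mulr1 star1 F1 tau1 /= !mulr1 => h1 h2.
by apply: ler_pM => //; apply: Re_ge0; [exact: pF.2|exact: ptau.2].
Qed.

Lemma slice_form y s b : F (star y * slice (rmap b s)) = cform F tau s [:: (y, star b)].
Proof.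
rewrite /slice big_map mulr_sumr (clin_sum _ _ _ pF.1) /cform.
apply: eq_bigr => p _; rewrite big_seq1 /= starK -scaleMr pF.1.2 mulrC; congr (_ * _).
by rewrite trtau.
Qed.

Lemma slice_le b s : complex.Re (F (star (slice (rmap b s)) * slice (rmap b s))) <=
  pnT s ^+ 2 * complex.Re (tau (star b * b)).
Proof.
set z := slice _; set X := complex.Re _.
have X0 : 0 <= X by apply: Re_ge0; exact: pF.2.
have B0 : 0 <= complex.Re (tau (star b * b)) by apply: Re_ge0; exact: ptau.2.
have h : X <= pnT s * pnT [:: (z, star b)].
  apply: le_trans (Re_nr _) _; rewrite slice_form.
  exact: (@ph_CS R T s [:: (z, star b)]).
have h2 : pnT [:: (z, star b)] ^+ 2 = X * complex.Re (tau (star b * b)).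
  rewrite pn_one starK trtau (ge0_Re (pF.2 z)) (ge0_Re (ptau.2 b)) -rmorphM /=.
  by [].
have h3 : X ^+ 2 <= pnT s ^+ 2 * (X * complex.Re (tau (star b * b))).
  by rewrite -h2 -exprMn ler_pXn2r ?nnegrE ?mulr_ge0 ?pn_ge0.
have [->|Xn] := eqVneq X 0; first by rewrite mulr_ge0 ?sqr_ge0.
have Xp : 0 < X by rewrite lt_def Xn.
by move: h3; rewrite expr2 mulrCA ler_pM2l.
Qed.

Lemma commut_iter x s n : pnT (commT x (iter n gapT s)) <= 2 * nr x * (rate n * pnT s).
Proof.
rewrite -nr_hin hin_commT.
have hc : central_vectors M (kazP s).
  by have [] := orth_projP (hinT s) (central_closed M).
have -> : commut M x (hinT (iter n gapT s)) = commut M x (hinT (iter n gapT s) - kazP s).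
  by rewrite commutB (commut_central _ hc) subr0.
apply: le_trans (commut_le _ _ _) _; apply: ler_wpM2l; last exact: iter_dist.
by rewrite mulr_ge0// nr_ge0.
Qed.

Lemma kaz_sub m n : pnT (sub_T (kaz m) (kaz n)) <= rate m + rate n.
Proof.
rewrite -nr_hin -[sub_T _ _]/(@ph_add R T (kaz m) (@ph_scl R T (-1) (kaz n))) -hin_sub.
have p1 : pnT [:: (1, 1)] <= 1.
  apply: le_trans (pn_one_le _ _) _.
  by rewrite mulr_ile1 ?nr_ge0 ?nr1_le.
have h (j : nat) : nr (hinT (kaz j) - kazP [:: (1, 1)]) <= rate j.
  apply: le_trans (iter_dist _ _) _; rewrite -[leRHS]mulr1.
  by rewrite ler_wpM2l ?rate_ge0.
apply: le_trans (nr_trans (kazP [:: (1, 1)]) _ _) _; apply: lerD => //.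
by rewrite nr_dist.
Qed.

Lemma kaz_le1 n : pnT (kaz n) <= 1.
Proof.
rewrite /kaz; elim: n => [|n ih].
  by apply: le_trans (pn_one_le _ _) _; rewrite mulr_ile1 ?nr_ge0 ?nr1_le.
rewrite iterS; apply: le_trans ih; rewrite -!nr_hin hin_gapT.
rewrite -(ler_pXn2r (ltn0Sn 1)) ?nnegrE ?nr_ge0//.
have := @gap_op_norm R A _ M gapc Q (hinT (iter n gapT [:: (1, 1)])) 0 gapc_gt0.
rewrite expr0n /= !mul0r subr0 mul1r; apply.
  by rewrite /gapc; have := sqr_ge0 beta; lra.
by apply: sumr_ge0 => x _; exact: sqr_ge0.
Qed.

(* [x . xi - xi . x] is orthogonal to the central vectors. *)
Lemma kaz_ij x n : pnT (sub_T (imap x (kaz n)) (jmap x (kaz n))) <= rate n * (2 * nr x).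
Proof.
have -> : sub_T (imap x (kaz n)) (jmap x (kaz n)) =
   sub_T (iter n gapT [:: (x, 1)]) (iter n gapT [:: (1, x)]).
  rewrite /kaz -imap_iter -jmap_iter /imap /jmap /=.
  by rewrite mul1r mulr1.
rewrite -nr_hin -[sub_T _ _]/(@ph_add R T _ (@ph_scl R T (-1) _)) -hin_sub.
rewrite !hin_iter.
have -> : iter n (gap_op M gapc Q) (hinT [:: (x, 1)]) - iter n (gap_op M gapc Q) (hinT [:: (1, x)])
   = iter n (gap_op M gapc Q) (hinT [:: (x, 1)] - hinT [:: (1, x)]).
  by elim: n => //= n <-; rewrite gap_opB.
set eta := _ - _.
have eeta : eta = commut M x (hinT [:: (1, 1)]).
  by rewrite -hin_commT /eta hin_sub /commT /sub_T /lmap /rmap /= mulr1 mul1r.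
have oeta zeta : central_vectors M zeta -> hdot eta zeta = 0 :> R[i].
  by move=> hz; rewrite eeta commut_star (commut_central _ hz) hdot0r.
have peta := orth_proj_orthogonal (central_closed M) oeta.
have := @gap_op_iter R A _ M gapc Q beta eta n gapc_gt0.
rewrite peta subr0 => h.
have {}h : nr (iter n (gap_op M gapc Q) eta) <= rate n * nr eta.
  rewrite -(ler_pXn2r (ltn0Sn 1)) ?nnegrE ?nr_ge0 ?mulr_ge0 ?nr_ge0 ?rate_ge0//.
  by rewrite exprMn rate_sq; apply: h; [rewrite /gapc; lra|exact: gap].
apply: le_trans h _; rewrite ler_wpM2l ?rate_ge0// /eta.
apply: le_trans (nrB _ _) _; rewrite !nr_hin.
have := pn_one_le x 1; have := pn_one_le 1 x.
have := nr1_le A; have := nr_ge0 x; nra.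
Qed.

End OneState.

Lemma slice_bound (c : R) s : 0 <= c ->
  (forall F (pF : pfun F), F 1 = 1 -> @pn R (coarse pF ptau) s <= c) -> nr (slice s) <= c.
Proof.
move=> c0 H; apply: norm_le_states => // F pF F1.
have := slice_le pF 1 s; rewrite rmap1 star1 mulr1 tau1 /= mulr1 => /le_trans; apply.
by rewrite ler_pXn2r ?nnegrE ?pn_ge0//; exact: H.
Qed.

Lemma kaz_limit : exists z : A, lim_to (fun n => slice (kaz n)) z.
Proof.
apply: seq_complete => e e0; have e2 : 0 < e / 2 by rewrite divr_gt0.
have [N hN] := rate_small e2; exists N => m n /hN hm /hN hn.
rewrite -slice_sub; apply: (@le_lt_trans _ _ (rate m + rate n)); last lra.
by apply: slice_bound => [|F pF F1]; [rewrite addr_ge0 ?rate_ge0|exact: kaz_sub].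
Qed.

Lemma lim_rate0 (u : nat -> A) (C : R) : 0 <= C -> (forall n, nr (u n) <= rate n * C) ->
  lim_to u 0.
Proof.
move=> C0 h; apply: (lim_le0 h) => e e0.
have C1 : 0 < C + 1 by rewrite ltr_wpDl.
have [N hN] := rate_small (divr_gt0 e0 C1); exists N => n /hN.
rewrite ltr_pdivlMr//; apply: le_lt_trans.
by rewrite ler_wpM2l ?rate_ge0// lerDl.
Qed.

Variable t : A.
Hypothesis kazt : lim_to (fun n => slice (kaz n)) t.

Lemma kaz_rmap x : lim_to (fun n => slice (rmap x (kaz n))) (x * t).
Proof.
have h : lim_to (fun n => slice (commT x (kaz n))) 0.
  apply: (@lim_rate0 _ (2 * nr x)) => [|n]; first by rewrite mulr_ge0// nr_ge0.
  apply: slice_bound => [|F pF F1]; first by rewrite !mulr_ge0 ?rate_ge0 ?nr_ge0.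
  apply: le_trans (commut_iter pF _ _ _) _.
  rewrite [leRHS]mulrC ler_wpM2l ?mulr_ge0 ?nr_ge0// -[leRHS]mulr1.
  rewrite ler_wpM2l ?rate_ge0//; apply: le_trans (pn_one_le pF F1 _ _) _.
  by rewrite mulr_ile1 ?nr_ge0 ?nr1_le.
have := limB (limMl x kazt) h; rewrite subr0; congr lim_to.
by apply/funext => n; rewrite slice_sub slice_lmap opprB addrC subrK.
Qed.

Lemma kaz_central x : t * x = x * t.
Proof.
apply: (lim_uniq (limMr x kazt)).
have h : lim_to (fun n => slice (sub_T (imap x (kaz n)) (jmap x (kaz n)))) 0.
  apply: (@lim_rate0 _ (2 * nr x)) => [|n]; first by rewrite mulr_ge0// nr_ge0.
  apply: slice_bound => [|F pF F1]; last exact: kaz_ij.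
  by rewrite !mulr_ge0 ?rate_ge0 ?nr_ge0.
have := limD h (kaz_rmap x); rewrite add0r; congr lim_to.
by apply/funext => n; rewrite slice_sub slice_jmap subrK slice_imap.
Qed.

Lemma kaz_L2_bounded x : nr (x * t) ^+ 2 <= complex.Re (tau (star x * x)).
Proof.
set X := complex.Re _; have X0 : 0 <= X by apply: Re_ge0; exact: ptau.2.
rewrite -(sqr_sqrtr X0) ler_pXn2r ?nnegrE ?nr_ge0 ?sqrtr_ge0//.
apply: (lim_le (kaz_rmap x)); exists 0%N => n _.
apply: norm_le_states => [|F pF F1]; first exact: sqrtr_ge0.
rewrite sqr_sqrtr//; apply: le_trans (slice_le pF _ _) _.
rewrite -[leRHS]mul1r ler_wpM2r// -(expr1n _ 2).
by rewrite ler_pXn2r ?nnegrE ?pn_ge0//; exact: kaz_le1.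
Qed.

Lemma slice_HS n (e : 'I_n -> A) (F : A -> R[i]) (s : seq (A * A)) (pF : pfun F) :
  orthonormal tau e ->
  complex.Re (\sum_i F (star (slice (rmap (e i) s)) * slice (rmap (e i) s))) <=
  @pn R (coarse pF ptau) s ^+ 2.
Proof.
move=> oe; set E := complex.Re _.
pose y i := slice (rmap (e i) s).
have E0 : 0 <= \sum_i F (star (y i) * y i) by apply: sumr_ge0 => i _; exact: pF.2.
pose v := [seq (y i, star (e i)) | i <- enum 'I_n].
have sv : cform F tau s v = \sum_i F (star (y i) * y i).
  transitivity (\sum_i cform F tau s [:: (y i, star (e i))]); last first.
    by apply: eq_bigr => i _; rewrite -slice_form.
  rewrite /cform [RHS]exchange_big; apply: eq_bigr => p _.
  rewrite /v big_map big_enum /=; apply: eq_bigr => i _.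
  by rewrite big_seq1.
have vv : cform F tau v v = \sum_i F (star (y i) * y i).
  rewrite /cform /v big_map big_enum /=; apply: eq_bigr => i _.
  rewrite big_map big_enum /= (bigD1 i)//= big1 => [|j ji].
    by rewrite starK trtau oe eqxx mulr1 addr0.
  by rewrite starK trtau oe ?(eq_sym i) (negPf ji) mulr0.
have h : E <= @pn R (coarse pF ptau) s * @pn R (coarse pF ptau) v.
  rewrite /E -/y -sv; apply: le_trans (Re_nr _) _; exact: (@ph_CS R (coarse pF ptau) s v).
have h2 : @pn R (coarse pF ptau) v ^+ 2 = E by rewrite pn2 /= vv.
have E00 : 0 <= E by exact: Re_ge0.
have h3 : E ^+ 2 <= @pn R (coarse pF ptau) s ^+ 2 * E.
  by rewrite -h2 -exprMn ler_pXn2r ?nnegrE ?mulr_ge0 ?pn_ge0 ?h2.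
have [->|En] := eqVneq E 0; first exact: sqr_ge0.
have Ep : 0 < E by rewrite lt_def En.
by move: h3; rewrite expr2 ler_pM2r.
Qed.

Lemma lim_pfun (u : nat -> A) l : lim_to u l -> lim_to (fun n => tau (u n)) (tau l).
Proof.
apply: (@lim_lip R A R[i] tau (complex.Re (tau 1))) => x y.
by rewrite -(pfunB ptau) pfun_le.
Qed.

Lemma lim_sum (V : normedZmodType R[i]) n (u : nat -> 'I_n -> V) (l : 'I_n -> V) :
  (forall i, lim_to (u ^~ i) (l i)) -> lim_to (fun m => \sum_i u m i) (\sum_i l i).
Proof.
move=> h; elim: (index_enum _) => [|i r ih].
  rewrite big_nil; have := lim_cst (0 : V); congr lim_to.
  by apply/funext => m; rewrite big_nil.
rewrite big_cons; have := limD (h i) ih; congr lim_to.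
by apply/funext => m; rewrite big_cons.
Qed.

Lemma kaz_rmap_bounded x n : nr (slice (rmap x (kaz n))) <= Num.sqrt (complex.Re (tau (star x * x))).
Proof.
have X0 : 0 <= complex.Re (tau (star x * x)) by apply: Re_ge0; exact: ptau.2.
apply: norm_le_states => [|F pF F1]; first exact: sqrtr_ge0.
rewrite sqr_sqrtr//; apply: le_trans (slice_le pF _ _) _.
rewrite -[leRHS]mul1r ler_wpM2r// -(expr1n _ 2).
by rewrite ler_pXn2r ?nnegrE ?pn_ge0//; exact: kaz_le1.
Qed.

(* The map [x |-> x t] is Hilbert-Schmidt on L^2(tau). *)
Lemma kaz_HS n (e : 'I_n -> A) : orthonormal tau e ->
  \sum_i complex.Re (tau (star (e i * t) * (e i * t))) <= 1.
Proof.
move=> oe; rewrite -raddf_sum /=.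
have h : lim_to (fun m => \sum_i tau (star (slice (rmap (e i) (kaz m))) * slice (rmap (e i) (kaz m))))
    (\sum_i tau (star (e i * t) * (e i * t))).
  apply: lim_sum => i; apply: lim_pfun.
  apply: (limM (K := Num.sqrt (complex.Re (tau (star (e i) * e i))))).
  - by move=> m; rewrite nr_star kaz_rmap_bounded.
  - by apply: lim_star; exact: kaz_rmap.
  - exact: kaz_rmap.
apply: le_trans (Re_nr _) _; apply: (lim_le h); exists 0%N => m _.
set S := \sum_i _.
have S0 : 0 <= S by apply: sumr_ge0 => i _; exact: ptau.2.
rewrite (ge0_Re S0) nr_real ger0_norm ?Re_ge0//.
apply: le_trans (slice_HS _ ptau oe) _; rewrite -(expr1n _ 2).
by rewrite ler_pXn2r ?nnegrE ?pn_ge0//; exact: kaz_le1.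
Qed.

Section NullLimit.
Hypothesis tnull : nullv tau t.
Local Notation T := (coarse ptau ptau).
Local Notation M := (coarse_bimodule ptau ptau trtau).

Lemma kaz_proj0 : kazP ptau [:: (1, 1)] = 0.
Proof.
set z : hcomp T := kazP _ _.
have hz : lim_to (fun n => hin (kaz n : T)) z.
  move=> eps /rate_small[N hN]; exists N => n /hN; apply: le_lt_trans.
  apply: le_trans (iter_dist _ _ _) _; rewrite -[leRHS]mulr1 ler_wpM2l ?rate_ge0//.
  by apply: le_trans (pn_one_le ptau tau1 _ _) _; rewrite mulr_ile1 ?nr_ge0 ?nr1_le.
apply: bdd_ext => s; rewrite bddE0.
have h1 : lim_to (fun n => cform tau tau (kaz n) s) (z s).
  apply: (@lim_lip R (hcomp T) R[i] (fun g => g s) (@pn R T s) _ _ _ hz) => g h.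
  by rewrite mulrC -bddE_sub; exact: h_ub.
apply: (lim_uniq h1).
have -> : 0 = \sum_(q <- s) tau (star q.1 * (star q.2 * t)).
  by rewrite big1// => q _; rewrite mulrA -starMr (null_ip ptau _ tnull).
elim: s {h1} => [|q s ih].
  rewrite big_nil; have := lim_cst (0 : R[i]); congr lim_to.
  by apply/funext => n; rewrite /cform big1// => p _; rewrite big_nil.
rewrite big_cons.
have h2 : lim_to (fun n => tau (star q.1 * slice (rmap (star q.2) (kaz n))))
   (tau (star q.1 * (star q.2 * t))).
  by apply: lim_pfun; apply: limMl; exact: kaz_rmap.
have := limD h2 ih; congr lim_to; apply/funext => n.
rewrite slice_form// starK /cform -big_split; apply: eq_bigr => p _.
by rewrite big_seq1 big_cons.
Qed.

Lemma cform_swap (F G : A -> R[i]) s u :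
  cform F G s u = cform G F (swapT s) (swapT u).
Proof.
rewrite /cform big_map; apply: eq_bigr => p _; rewrite big_map; apply: eq_bigr => q _ /=.
exact: mulrC.
Qed.

Lemma pn_jmap a s : @pn R T (jmap a s) <= nr a * @pn R T s.
Proof.
have h u : @pn R T u = @pn R T (swapT u) by rewrite /pn /= cform_swap.
rewrite h [pn (s : T)]h.
have -> : swapT (jmap a s) = lmap a (swapT s).
  by rewrite /swapT /jmap /lmap -!map_comp.
exact: pn_lmap.
Qed.

Lemma central_null (z : hcomp T) : central_vectors M z -> z = 0.
Proof.
move=> hz.
have h1 c : z [:: (1, c)] = 0.
  apply: nr_le0; apply/ler_addgt0Pr => eps eps0; rewrite add0r.
  have C0 : 0 < nr z * nr c + 1 by rewrite ltr_wpDl// mulr_ge0 ?nr_ge0.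
  have [N hN] := rate_small (divr_gt0 eps0 C0).
  have -> : z [:: (1, c)] = hdot z (hin (jmap c (kaz N) : T)).
    rewrite /kaz -jmap_iter hin_iter.
    rewrite hdotC.
    have -> : hdot (iter N (gap_op M gapc Q) (hin (jmap c [:: (1, 1)] : T))) z =
        hdot (hin (jmap c [:: (1, 1)] : T)) z :> R[i].
      by elim: {hN} N => //= N ih; rewrite gap_op_central.
    by rewrite -hdotC hdotE_hd hd_hin /jmap /= mulr1.
  apply: le_trans (hdot_CS _ _) _; rewrite nr_hin.
  have hk : @pn R T (kaz N) <= rate N.
    have := iter_dist ptau [:: (1, 1)] N; rewrite kaz_proj0 subr0 nr_hin => /le_trans; apply.
    rewrite -[leRHS]mulr1 ler_wpM2l ?rate_ge0//.
    by apply: le_trans (pn_one_le ptau tau1 _ _) _; rewrite mulr_ile1 ?nr_ge0 ?nr1_le.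
  have := hN N (leqnn N); rewrite ltr_pdivlMr// => /ltW h.
  have h3 := pn_jmap c (kaz N).
  have h4 : nr z * @pn R T (jmap c (kaz N)) <= nr z * (nr c * rate N).
    rewrite ler_wpM2l ?nr_ge0//; apply: le_trans h3 _.
    by rewrite ler_wpM2l ?nr_ge0.
  apply: le_trans h4 (le_trans _ h); rewrite mulrDr mulr1 mulrA mulrC lerDl.
  exact: rate_ge0.
apply: bdd_ext => s; rewrite bddE0.
elim: s => [|[a b] s ih].
  by have := hZ z 0 ([::] : T); rewrite conjc0 mul0r.
have -> : z ((a, b) :: s) = z (@ph_add R T [:: (a, b)] s) by [].
rewrite hD ih addr0.
have -> : z [:: (a, b)] = hdot z (hin (lmap a (rmap b [:: (1, 1)]) : T)).
  by rewrite hdotE_hd hd_hin /lmap /rmap /= mulr1 mul1r.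
rewrite -clact_hin -cract_hin.
have := lact_star M (star a) z (cract trtau (hin ([:: (1, 1)] : T) : hcomp T) b).
rewrite starK /= => <-.
have := hz (star a); rewrite /= => ->.
have := ract_star M (star a) z (cract trtau (hin ([:: (1, 1)] : T) : hcomp T) b).
rewrite starK /= => ->.
rewrite !cract_hin hd_hin.
by rewrite /rmap /= mul1r h1.
Qed.

Lemma kaz_null_gap s :
  beta ^+ 2 * @pn R T s ^+ 2 <= \sum_(x <- Q) @pn R T (commT x s) ^+ 2.
Proof.
have := @gap _ M (hin (s : T)); rewrite nr_hin.
under eq_bigr => x _ do rewrite -hin_commT nr_hin.
by apply=> z /central_null ->; rewrite hdot0r.
Qed.

End NullLimit.

End SliceMap.

(** * Finite-dimensional central summands *)

Section HilbertSchmidtIdeal.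
Variables (R : realType) (A : cstarAlgType R) (tau : A -> R[i]) (t : A).
Hypotheses (ptau : pfun tau) (tau1 : tau 1 = 1).
Hypothesis trtau : forall x y, tau (x * y) = tau (y * x).
Hypothesis tC : forall x, t * x = x * t.
Hypothesis tL2 : forall x, nr (x * t) ^+ 2 <= complex.Re (tau (star x * x)).
Hypothesis tHS : forall n (e : 'I_n -> A), orthonormal tau e ->
  \sum_i complex.Re (tau (star (e i * t) * (e i * t))) <= 1.
Hypothesis tnn : ~ nullv tau t.
Implicit Types (x y z b c : A).

Lemma orthonormal_cons n (e : 'I_n -> A) v : orthonormal tau e ->
  tau (star v * v) = 1 -> (forall i, tau (star (e i) * v) = 0) ->
  exists e' : 'I_n.+1 -> A, [/\ orthonormal tau e', e' ord0 = v &
    forall i, e' (lift ord0 i) = e i].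
Proof.
move=> oe vv ev.
pose e' (i : 'I_n.+1) := if unlift ord0 i is Some j then e j else v.
have e'0 : e' ord0 = v by rewrite /e' unlift_none.
have e'S i : e' (lift ord0 i) = e i by rewrite /e' liftK.
exists e'; split => // i j.
case: (unliftP ord0 i) => [i'|] ->; case: (unliftP ord0 j) => [j'|] ->; rewrite ?e'0 ?e'S.
- by rewrite oe (inj_eq (@lift_inj _ ord0)).
- by rewrite (pfun_ipC ptau) ev conjc0 eq_sym (negPf (neq_lift _ _)).
- by rewrite ev (negPf (neq_lift _ _)).
- by rewrite vv eqxx.
Qed.

Lemma bounded_orthonormal_basis (J : set A) (N : R) : J 0 ->
  (forall x y, J x -> J y -> J (x + y)) -> (forall (k : R[i]) x, J x -> J (k *: x)) ->
  (forall n (e : 'I_n -> A), orthonormal tau e -> (forall i, J (e i)) -> n%:R <= N) ->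
  (forall x, J x -> nullv tau x -> x = 0) ->
  exists n (e : 'I_n -> A), [/\ orthonormal tau e, forall i, J (e i) &
    forall b, J b -> b = oproj tau e b].
Proof.
move=> J0 JD JZ JN Jnull.
have [n [e [oe Je nmax]]] : exists n (e : 'I_n -> A), [/\ orthonormal tau e,
    forall i, J (e i) & forall e' : 'I_n.+1 -> A, orthonormal tau e' -> ~ forall i, J (e' i)].
  apply: contrapT => H.
  have step n : exists e : 'I_n -> A, orthonormal tau e /\ forall i, J (e i).
    elim: n => [|n [e [oe Je]]]; first by exists (fun=> 0); split=> -[].
    apply: contrapT => H'; apply: H; exists n, e; split => // e' oe' Je'.
    by apply: H'; exists e'.
  have [e [oe Je]] := step (Num.truncn N).+1; have := JN _ _ oe Je.
  by rewrite leNgt truncnS_gt.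
exists n, e; split => // b Jb; apply/eqP; rewrite -subr_eq0; apply/eqP.
set r := b - oproj tau e b.
have er i : tau (star (e i) * r) = 0.
  by rewrite mulrBr (pfunB ptau) (oproj_ip ptau)// subrr.
have Jr : J r.
  apply: (JD) => //; rewrite -scaleN1r; apply: (JZ); rewrite /oproj.
  by apply: big_ind => // i _; apply: (JZ).
pose J' : set A := [set x | J x /\ forall i, tau (star (e i) * x) = 0].
have [m [f [of' Jf fr]]] : exists m (f : 'I_m -> A), [/\ orthonormal tau f,
    forall i, J' (f i) & forall c, c \in [:: r] -> nullv tau (c - oproj tau f c)].
  apply: (gram_schmidt ptau) => [|x y [Jx ex] [Jy ey]|k x [Jx ex]|c].
  - by split => // i; rewrite mulr0 (clin0 ptau.1).
  - by split=> [|i]; [exact: JD|rewrite mulrDr (pfunD ptau) ex ey addr0].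
  - by split=> [|i]; [exact: JZ|rewrite -scaleMr (pfunZ ptau) ex mulr0].
  - by rewrite inE => /eqP ->.
case: m f of' Jf fr => [|m] f of' Jf fr.
  have := fr r; rewrite inE eqxx => /(_ isT); rewrite /oproj big_ord0 subr0.
  exact: Jnull.
have [e' [oe' e0 eS]] := orthonormal_cons oe (etrans (of' ord0 ord0) (congr1 (fun b : bool => b%:R) (eqxx _))) (Jf ord0).2.
case: (nmax e' oe') => i; case: (unliftP ord0 i) => [j|] ->; rewrite ?e0 ?eS//.
exact: (Jf ord0).1.
Qed.

Theorem finite_dimensional_summand : exists e : A,
  [/\ star e = e, e * e = e, forall x, e * x = x * e, tau e != 0 &
    exists n (v : 'I_n -> A), forall x, exists c : 'I_n -> R[i], e * x = \sum_i c i *: v i].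
Proof.
pose delta := complex.Re (tau (star t * t)) / 2.
have d0 : 0 < delta.
  rewrite divr_gt0// ltNge; apply/negP => h; apply: tnn; exact: (nullv_Re ptau).
have stC x : star t * x = x * star t.
  by rewrite -[x]starK -!starMr tC.
pose w := star t * t - delta%:C *: (1 : A).
have sw : sa w by rewrite /sa /w starB starMr starK starZr star1.
have ttC x : (star t * t) * x = x * (star t * t).
  by rewrite -mulrA tC mulrA stC mulrA.
have wC x : w * x = x * w.
  by rewrite /w mulrBl mulrBr ttC -scaleMl -scaleMr mul1r mulr1.
have [m [sm pm mm mC]] := pos_sqrt (pos_sq sw).
have [l [sl _ ll lC]] := pos_sqrt pm.
have mC' x : m * x = x * m.
  by rewrite mC// mulrA -wC -mulrA -wC mulrA.
have lC' x : l * x = x * l by rewrite lC.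
pose g := (2^-1)%:C *: (w + m).
have gC x : g * x = x * g.
  by rewrite /g -scaleMl -scaleMr mulrDl mulrDr wC mC'.
have sg : star g = g by rewrite /g starZr starD sw sm.
have wg : w * g = m * g by rewrite /g -!scaleMr (mulrDr w w) (mulrDr m w) mm (wC m) addrC.
have ggw : w * g * g = (l * g) * (l * g).
  by rewrite wg -ll -[RHS]mulrA [g * _]mulrA (gC l) !mulrA.
pose J : set A := [set x | exists a, x = g * a].
have Jl x y : J x -> J (y * x) by move=> [a ->]; exists (y * a); rewrite !mulrA gC.
have Jr x y : J x -> J (x * y) by move=> [a ->]; exists (a * y); rewrite !mulrA.
have Js x : J x -> J (star x) by move=> [a ->]; exists (star a); rewrite starMr sg gC.
have JD x y : J x -> J y -> J (x + y).
  by move=> [a ->] [b ->]; exists (a + b); rewrite mulrDr.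
have JZ (k : R[i]) x : J x -> J (k *: x).
  by move=> [a ->]; exists (k *: a); rewrite scaleMr.
have J0 : J 0 by exists 0; rewrite mulr0.
have Jt y : J y -> tau (star (y * t) * (y * t)) =
    tau (star y * (w * y)) + delta%:C * tau (star y * y).
  move=> _; rewrite -(pfunZ ptau) -(pfunD ptau); congr tau.
  have -> : star (y * t) * (y * t) = star y * (star t * t * y).
    by rewrite starMr stC -!mulrA; congr (_ * (_ * _)); rewrite tC.
  have -> : star t * t = w + delta%:C *: (1 : A) by rewrite /w subrK.
  by rewrite mulrDl mulrDr -scaleMl mul1r -[in LHS]scaleMr.
have Jpos y : J y -> 0 <= tau (star y * (w * y)).
  move=> [a ->]; have -> : star (g * a) * (w * (g * a)) = star (l * g * a) * (l * g * a).
    rewrite !starMr sg sl -!mulrA; congr (_ * _).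
    have -> : g * (w * (g * a)) = w * g * g * a by rewrite gC -!mulrA (gC a).
    by rewrite ggw !mulrA (lC' g).
  exact: ptau.2.
have JN n (e : 'I_n -> A) : orthonormal tau e -> (forall i, J (e i)) -> n%:R <= delta^-1.
  move=> oe Je; rewrite -[leRHS]mul1r ler_pdivlMr//.
  apply: le_trans (tHS oe); rewrite mulrC mulr_natr -[in leLHS](card_ord n) -sumr_const.
  apply: ler_sum => i _; rewrite Jt// oe eqxx mulr1 raddfD /= lerDr.
  by apply: Re_ge0; exact: Jpos.
have Jnull y : J y -> nullv tau y -> y = 0.
  move=> Jy ny; have yt : y * t = 0.
    by apply: nr_le0; rewrite -(ler_pXn2r (ltn0Sn 1)) ?nnegrE ?nr_ge0// expr0n;
      apply: le_trans (tL2 y) _; rewrite ny.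
  have wy : w * y = - (delta%:C *: y).
    rewrite /w mulrBl -scaleMl mul1r.
    by rewrite -mulrA tC yt mulr0 sub0r.
  have my : m * y = w * y.
    by case: Jy => a ->; rewrite !mulrA -wg.
  have h1 : Pos (star y * (m * y)).
    have -> : star y * (m * y) = star (l * y) * (l * y).
      by rewrite starMr sl -ll -!mulrA.
    exact: pos_star.
  have h2 : star y * (m * y) = - (delta%:C *: (star y * y)).
    by rewrite my wy mulrN scaleMr.
  have yy : delta%:C *: (star y * y) = 0.
    apply: posN_eq0; first by apply: posZ; [exact: ltW|exact: pos_star].
    by rewrite -h2.
  apply: nr0_eq; apply/eqP; rewrite -sqrf_eq0 -nr_starM nr_eq0.
  by move/eqP: yy; rewrite scaler_eq0 => /orP[/eqP/complexI d|//]; rewrite d ltxx in d0.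
have [n [e [oe Je he]]] := bounded_orthonormal_basis J0 JD JZ JN Jnull.
pose p := oproj tau e 1.
have Jp : J p by rewrite /p /oproj; apply: big_ind => // i _; exact: JZ.
have p1 y : J y -> tau (star y * (1 - p)) = 0.
  move=> Jy; rewrite (he _ Jy) /oproj star_sum mulr_suml (clin_sum _ _ _ ptau.1).
  rewrite big1// => i _; rewrite starZc -scaleMl (pfunZ ptau).
  by rewrite mulrBr (pfunB ptau) (oproj_ip ptau)// subrr mulr0.
have JB x y : J x -> J y -> J (x - y).
  by move=> Jx Jy; rewrite -scaleN1r; apply: (JD) => //; exact: JZ.
have pl y : J y -> p * y = y.
  move=> Jy; apply/eqP; rewrite eq_sym -subr_eq0; apply/eqP.
  have Jz : J (y - p * y) by apply: (JB) => //; exact: Jl.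
  apply: (Jnull) => //; rewrite /nullv; set z := y - p * y.
  have {2}-> : z = (1 - p) * y by rewrite mulrBl mul1r.
  rewrite mulrA trtau mulrA -[y * star z]starK; apply: p1.
  by apply: (Js); apply: (Jl); exact: Js.
have pr y : J y -> y * p = y.
  move=> Jy; apply/eqP; rewrite eq_sym -subr_eq0; apply/eqP.
  have Jz : J (y - y * p) by apply: (JB) => //; exact: Jr.
  apply: (Jnull) => //; rewrite /nullv; set z := y - y * p.
  have {2}-> : z = y * (1 - p) by rewrite mulrBr mulr1.
  rewrite mulrA -[star z * y]starK; apply: p1.
  by apply: (Js); apply: (Jl).
have sp : star p = p.
  have h := pl _ (Js _ Jp).
  by apply: etrans (starK p); rewrite -{2}h starMr starK.
exists p; split.
- exact: sp.
- exact: pl.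
- by move=> x; rewrite -(pr (p * x) (Jr _ _ Jp)) -mulrA pl//; exact: Jl.
- apply/eqP => tp.
  have p0 : p = 0 by apply: (Jnull) => //; rewrite /nullv sp pl.
  have g0 : g = 0 by rewrite -(pl g) ?p0 ?mul0r//; exists 1; rewrite mulr1.
  have wm : w = - (star l * l).
    move/eqP: g0; rewrite /g scaler_eq0 => /orP[|].
      by rewrite -[0]/((0 : R)%:C) => /eqP/complexI/eqP; rewrite invr_eq0 pnatr_eq0.
    by rewrite addr_eq0 sl ll => /eqP.
  have := Re_ge0 (ptau.2 l).
  have -> : tau (star l * l) = - tau w by rewrite wm (pfunN ptau) opprK.
  rewrite /w (pfunB ptau) (pfunZ ptau) tau1 mulr1 opprB raddfB /= subr_ge0 -/delta.
  by move: d0; rewrite /delta; lra.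
- exists n, e => x; exists (fun i => tau (star (e i) * (p * x))).
  by apply: he; exact: Jr.
Qed.

End HilbertSchmidtIdeal.

Definition central_projection (R : realType) (A : cstarAlgType R) (e : A) :=
  [/\ star e = e, e * e = e & forall x, e * x = x * e].

Record corner (R : realType) (A : cstarAlgType R) (e : A)
  (he : central_projection e) := Corner { cval :> A; cvalP : e * cval = cval }.

Section Corner.
Variables (R : realType) (A : cstarAlgType R) (e : A) (he : central_projection e).
Local Notation B := (corner he).
Implicit Types (x y z : B) (a b : A).

HB.instance Definition _ := gen_eqMixin B.
HB.instance Definition _ := gen_choiceMixin B.

Lemma cval_inj : injective (@cval R A e he).
Proof. by move=> [x hx] [y hy] /= xy; subst y; congr Corner; exact: Prop_irrelevance. Qed.

Lemma cutP a : e * (e * a) = e * a.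
Proof. by have [_ ee _] := he; rewrite mulrA ee. Qed.
Definition cut a : B := Corner he (cutP a).

Lemma corner0P : e * 0 = 0. Proof. exact: mulr0. Qed.
Lemma cornerDP x y : e * (cval x + cval y) = cval x + cval y.
Proof. by rewrite mulrDr !cvalP. Qed.
Lemma cornerNP x : e * (- cval x) = - cval x.
Proof. by rewrite mulrN !cvalP. Qed.
Lemma cornerZP k x : e * (k *: cval x) = k *: cval x.
Proof. by rewrite -scaleMr cvalP. Qed.
Lemma cornerMP x y : e * (cval x * cval y) = cval x * cval y.
Proof. by rewrite mulrA cvalP. Qed.
Lemma cornerSP x : e * star (cval x) = star (cval x).
Proof. by have [se _ eC] := he; rewrite -{2}(cvalP x) starMr se eC. Qed.
Lemma corner1P : e * e = e. Proof. by have [] := he. Qed.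

Definition corner_add x y : B := Corner he (cornerDP x y).
Definition corner_opp x : B := Corner he (cornerNP x).
Definition corner_scl k x : B := Corner he (cornerZP k x).
Definition corner_mul x y : B := Corner he (cornerMP x y).
Definition corner_star x : B := Corner he (cornerSP x).

Lemma corner_addA : associative corner_add.
Proof. by move=> x y z; apply: cval_inj; exact: addrA. Qed.
Lemma corner_addC : commutative corner_add.
Proof. by move=> x y; apply: cval_inj; exact: addrC. Qed.
Lemma corner_add0 : left_id (Corner he corner0P) corner_add.
Proof. by move=> x; apply: cval_inj; exact: add0r. Qed.
Lemma corner_addN : left_inverse (Corner he corner0P) corner_opp corner_add.
Proof. by move=> x; apply: cval_inj; exact: addNr. Qed.

HB.instance Definition _ :=
  GRing.isZmodule.Build B corner_addA corner_addC corner_add0 corner_addN.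

Lemma corner_sclA (a b : R[i]) x : corner_scl a (corner_scl b x) = corner_scl (a * b) x.
Proof. by apply: cval_inj; exact: scalerA. Qed.
Lemma corner_scl1 : left_id 1 corner_scl.
Proof. by move=> x; apply: cval_inj; exact: scale1r. Qed.
Lemma corner_sclDr : right_distributive corner_scl +%R.
Proof. by move=> k x y; apply: cval_inj; exact: scalerDr. Qed.
Lemma corner_sclDl x : {morph corner_scl^~ x : a b / a + b}.
Proof. by move=> a b; apply: cval_inj; exact: scalerDl. Qed.

HB.instance Definition _ := GRing.Zmodule_isLmodule.Build R[i] B
  corner_sclA corner_scl1 corner_sclDr corner_sclDl.

Lemma corner_normD x y : `|cval (x + y)| <= `|cval x| + `|cval y|.
Proof. exact: ler_normD. Qed.
Lemma corner_normZ (k : R[i]) x : `|cval (k *: x)| = `|k| * `|cval x|.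
Proof. exact: normrZ. Qed.
Lemma corner_norm_eq0 x : `|cval x| = 0 -> x = 0.
Proof. by move=> h; apply: cval_inj; exact: normr0_eq0. Qed.

HB.instance Definition _ :=
  Lmodule_isNormed.Build R[i] B corner_normD corner_normZ corner_norm_eq0.

Lemma corner_seq_complete (u : nat -> B) : (forall r : R, 0 < r -> exists N, forall m n,
     (N <= m)%N -> (N <= n)%N -> nr (u m - u n) < r) -> exists l, lim_to u l.
Proof.
move=> uc; have [l hl] : exists l, lim_to (fun n => cval (u n)) l by exact: seq_complete.
have el : e * l = l.
  apply: (lim_uniq _ hl); have := limMl e hl; congr lim_to.
  by apply/funext => n; rewrite cvalP.
by exists (Corner he el).
Qed.

HB.instance Definition _ := Uniform_isComplete.Build B
  (filter_complete corner_seq_complete).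

Lemma corner_mulA : associative corner_mul.
Proof. by move=> x y z; apply: cval_inj; exact: mulrA. Qed.
Lemma corner_mul1x : left_id (Corner he corner1P) corner_mul.
Proof. by move=> x; apply: cval_inj; exact: cvalP. Qed.
Lemma corner_mulx1 : right_id (Corner he corner1P) corner_mul.
Proof. by move=> x; apply: cval_inj; have [_ _ eC] := he; apply: etrans (esym (eC _)) _; exact: cvalP. Qed.
Lemma corner_mulDl : left_distributive corner_mul +%R.
Proof. by move=> x y z; apply: cval_inj; exact: mulrDl. Qed.
Lemma corner_mulDr : right_distributive corner_mul +%R.
Proof. by move=> x y z; apply: cval_inj; exact: mulrDr. Qed.
Lemma corner_mulAl (k : R[i]) x y : k *: corner_mul x y = corner_mul (k *: x) y.
Proof. by apply: cval_inj; exact: scaleMl. Qed.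
Lemma corner_mulAr (k : R[i]) x y : k *: corner_mul x y = corner_mul x (k *: y).
Proof. by apply: cval_inj; exact: scaleMr. Qed.
Lemma corner_starK : involutive corner_star.
Proof. by move=> x; apply: cval_inj; exact: starK. Qed.
Lemma corner_starD : {morph corner_star : x y / x + y}.
Proof. by move=> x y; apply: cval_inj; exact: starD. Qed.
Lemma corner_starZ (k : R[i]) x : corner_star (k *: x) = Num.conj k *: corner_star x.
Proof. by apply: cval_inj; exact: starZ. Qed.
Lemma corner_starM x y : corner_star (corner_mul x y) = corner_mul (corner_star y) (corner_star x).
Proof. by apply: cval_inj; exact: starMr. Qed.
Lemma corner_normM x y : `|corner_mul x y| <= `|x| * `|y|.
Proof. exact: cstar_normM. Qed.
Lemma corner_norm_star x : `|corner_mul (corner_star x) x| = `|x| ^+ 2.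
Proof. exact: cstar_norm. Qed.

HB.instance Definition _ := isCStarAlgebra.Build R B
  corner_mulA corner_mul1x corner_mulx1 corner_mulDl corner_mulDr corner_mulAl corner_mulAr
  corner_starK corner_starD corner_starZ corner_starM corner_normM corner_norm_star.

End Corner.

Section CentralProjections.
Variables (R : realType) (A : cstarAlgType R).
Implicit Types (x y e f : A).

Lemma central_projection_compl e : central_projection e -> central_projection (1 - e).
Proof.
case=> se ee eC; split; first by rewrite starB star1 se.
  by rewrite mulrBl mul1r mulrBr mulr1 ee subrr subr0.
by move=> x; rewrite mulrBl mulrBr eC mul1r mulr1.
Qed.

Lemma corner_decomposition e (he : central_projection e) :
  star_isomorphic A (corner he * corner (central_projection_compl he))%type.
Proof.
have [se ee eC] := he; pose he' := central_projection_compl he.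
pose f x : (corner he * corner he')%type := (cut he x, cut he' x).
have [_ _ eC'] := he'.
exists f; split.
- exists (fun p => cval p.1 + cval p.2).
    by move=> x; rewrite /= -mulrDl addrC subrK mul1r.
  move=> [x y]; have h1 : e * cval y = 0.
    by rewrite -(cvalP y) mulrA mulrBr mulr1 ee subrr mul0r.
  have h2 : (1 - e) * cval x = 0.
    by rewrite -(cvalP x) mulrA mulrBl mul1r ee subrr mul0r.
  congr pair; apply: cval_inj; rewrite /= mulrDr cvalP ?h1 ?h2 ?addr0 ?add0r//.
- by move=> k x y; congr pair; apply: cval_inj; rewrite /= mulrDr -scaleMr.
- by congr pair; apply: cval_inj; rewrite /= mulr1.
- move=> x y; congr pair; apply: cval_inj; rewrite /=.
    by rewrite -mulrA [x * (e * y)]mulrA -eC -mulrA [RHS]mulrA ee.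
  by have [_ ee' _] := he'; rewrite -mulrA [x * (_ * y)]mulrA -eC' -[in RHS]mulrA [RHS]mulrA ee'.
- move=> x; congr pair; apply: cval_inj; rewrite /= starMr ?se -?eC//.
  by have [-> _ _] := he'; rewrite eC'.
Qed.

Definition finite_cut e := exists n (v : 'I_n -> A),
  forall x, exists c : 'I_n -> R[i], e * x = \sum_i c i *: v i.

Lemma finite_corner e (he : central_projection e) :
  finite_cut e -> finite_dimensional (corner he).
Proof.
case=> n [v hv]; exists n, (fun i => cut he (v i)) => x.
have [c hc] := hv x; exists c; apply: cval_inj.
rewrite -(cvalP x) -[in LHS](cvalP x) hc mulr_sumr.
rewrite (big_morph (@cval R A e he) (fun _ _ => erefl) (erefl _)).
by apply: eq_bigr => i _ /=; rewrite -scaleMr.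
Qed.

Definition join_projection e f : A := e + f - e * f.

Lemma join_projectionP e f : central_projection e -> central_projection f ->
  central_projection (join_projection e f) /\
  e * join_projection e f = e /\ f * join_projection e f = f.
Proof.
move=> [se ee eC] [sf ff fC].
have e1 : e * join_projection e f = e.
  by rewrite /join_projection mulrBr mulrDr mulrA ee addrK.
have f1 : f * join_projection e f = f.
  by rewrite /join_projection mulrBr mulrDr ff mulrA (fC e) -mulrA ff addrAC subrr add0r.
split => //; split.
- by rewrite /join_projection starB starD starMr se sf fC.
- by rewrite {1}/join_projection mulrBl mulrDl -mulrA e1 f1.
- move=> x; rewrite /join_projection mulrBl mulrBr mulrDl mulrDr.
  have -> : e * f * x = x * (e * f) by rewrite -mulrA fC mulrA eC -mulrA.
  by rewrite (eC x) (fC x).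
Qed.

Lemma finite_cut_join e f : finite_cut e -> finite_cut f ->
  (forall x, e * x = x * e) -> finite_cut (join_projection e f).
Proof.
move=> [n [v hv]] [m [w hw]] eC.
exists (n + m)%N, (fun i : 'I_(n + m) => match fintype.split i with inl j => v j | inr j => w j end) => x.
have [c hc] := hv x; have [d hd] := hw ((1 - e) * x).
exists (fun i : 'I_(n + m) => match fintype.split i with inl j => c j | inr j => d j end).
rewrite big_split_ord /=.
under eq_bigr => i _ do rewrite (unsplitK (inl i)).
under [X in _ + X]eq_bigr => i _ do rewrite (unsplitK (inr i)).
rewrite -hc -hd /join_projection -addrA mulrDl; congr (_ + _).
by rewrite mulrA mulrBr mulr1 eC.
Qed.

End CentralProjections.

Section TraceDichotomy.
Variables (R : realType) (A : cstarAlgType R).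
Implicit Types (x y e f : A).

Lemma finite_join (l : seq A) :
  (forall e, e \in l -> central_projection e /\ finite_cut e) ->
  exists f, [/\ central_projection f, finite_cut f & forall e, e \in l -> e * f = e].
Proof.
elim: l => [_|e l ih hl].
  exists 0; split => //; first by split=> [||x]; rewrite ?star0 ?mulr0 ?mul0r.
  by exists 0%N, (fun=> 0) => x; exists (fun=> 0); rewrite mul0r big_ord0.
have [he fe] := hl e (mem_head _ _).
have [f [hf ff lf]] : exists f, [/\ central_projection f, finite_cut f &
    forall e, e \in l -> e * f = e].
  by apply: ih => g gl; apply: hl; rewrite inE gl orbT.
have [hj [ej fj]] := join_projectionP he hf; exists (join_projection e f); split => //.
  by apply: finite_cut_join => //; case: he.
move=> g; rewrite inE => /orP[/eqP ->//|/lf gf].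
by rewrite -{1}gf -mulrA fj gf.
Qed.

Lemma corner_trace e (he : central_projection e) (phi : {scalar corner he}) :
  tracial_state phi -> let tau x := phi (cut he x) in
  [/\ pfun tau, tau 1 = 1, forall x y, tau (x * y) = tau (y * x) & forall f, f * e = 0 -> tau f = 0].
Proof.
move=> [p0 p1 ptr] tau; have [se ee eC] := he.
have cD x y : cut he (x + y) = cut he x + cut he y by apply: cval_inj; exact: mulrDr.
have cZ (k : R[i]) x : cut he (k *: x) = k *: cut he x.
  by apply: cval_inj; rewrite /= -scaleMr.
have cM x y : cut he (x * y) = corner_mul (cut he x) (cut he y).
  by apply: cval_inj; rewrite /= -mulrA [x * (e * y)]mulrA -eC -mulrA [RHS]mulrA ee.
have cS x : cut he (star x) = corner_star (cut he x).
  by apply: cval_inj; rewrite /= starMr se eC.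
split.
- split; first split=> [x y|k x]; rewrite /tau ?cD ?cZ ?linearD ?linearZ//.
  by move=> x; rewrite /tau cM cS; exact: (p0 (cut he x)).
- by rewrite /tau -p1; congr (phi _); apply: cval_inj => /=; rewrite mulr1.
- by move=> x y; rewrite /tau !cM; exact: (ptr (cut he x) (cut he y)).
- move=> f fe; rewrite /tau; have -> : cut he f = 0 by apply: cval_inj; rewrite /= eC.
  exact: linear0.
Qed.

(* Otherwise the traces killing the finite-dimensional central summands would,
   by compactness, converge to a trace killing all of them.                   *)
Lemma trace_dichotomy :
  (forall tau : A -> R[i], pfun tau -> tau 1 = 1 -> (forall x y, tau (x * y) = tau (y * x)) ->
    exists e, [/\ central_projection e, finite_cut e & tau e != 0]) ->
  exists B C : cstarAlgType R, [/\ star_isomorphic A (B * C)%type, finite_dimensional B &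
    ~ (exists tau : {scalar C}, tracial_state tau)].
Proof.
move=> H; apply: contrapT => nex.
have tr e : central_projection e -> finite_cut e -> exists tau : A -> R[i],
    [/\ pfun tau, tau 1 = 1, forall x y, tau (x * y) = tau (y * x) &
        forall f, f * e = f -> tau f = 0].
  move=> he fe; have [phi hphi] : exists tau : {scalar corner (central_projection_compl he)}, tracial_state tau.
    apply: contrapT => nt; apply: nex; exists (corner he), (corner (central_projection_compl he)).
    by split => //; [exact: corner_decomposition|exact: finite_corner].
  have [h1 h2 h3 h4] := corner_trace hphi.
  exists (fun x => phi (cut (central_projection_compl he) x)); split => // f fef.
  by apply: h4; rewrite mulrBr mulr1 fef subrr.
pose S : set (A * R) := [set p | (exists x y, p = (x * y - y * x, 0)) \/
  exists e, [/\ p = (e, 0), central_projection e & finite_cut e]].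
have [tau [ptau tau1 htau]] : exists F, [/\ pfun F, F 1 = 1 & forall p, S p -> nr (F p.1) <= p.2].
  apply: states_compact => l lS.
  pose good e := central_projection e /\ finite_cut e.
  have [f [hf ff lf]] : exists f, [/\ central_projection f, finite_cut f & forall e,
      e \in [seq p.1 | p <- l & `[< central_projection p.1 /\ finite_cut p.1 >]] -> e * f = e].
    apply: finite_join => e /mapP[p]; rewrite mem_filter => /andP[/asboolP hp _ ->].
    exact: hp.
  have [F [pF F1 trF Ff]] := tr f hf ff; exists F; split => // p pl.
  have [[x [y ->]]|[e [pe he fe]]] := lS p pl.
    by rewrite /= (clinB _ _ pF.1) trF subrr nr0.
  rewrite pe in pl *; rewrite /= Ff ?nr0//; apply: lf; apply/mapP; exists (e, 0) => //.
  by rewrite mem_filter pl andbT; apply/asboolP.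
have trtau x y : tau (x * y) = tau (y * x).
  have /nr_le0 h := htau _ (or_introl (ex_intro _ x (ex_intro _ y erefl))).
  by apply/eqP; rewrite -subr_eq0 -(clinB _ _ ptau.1); apply/eqP.
have [e [he fe /eqP]] := H tau ptau tau1 trtau; apply.
exact: nr_le0 (htau _ (or_intror (ex_intro _ e (And3 erefl he fe)))).
Qed.

End TraceDichotomy.

(** * Virtual traces *)

Definition sesqui (R : realType) (A : cstarAlgType R) (V : A -> A -> R[i]) :=
  (forall k x x' y, V (k *: x + x') y = k * V x y + V x' y) /\
  (forall k x y y', V x (k *: y + y') = conjc k * V x y + V x y').

Section CocycleSpace.
Variables (R : realType) (A : cstarAlgType R).
Implicit Types (a b x y r : A).

(* For fixed x and y, such a function is a derivation of A in its last
   variable.                                                                  *)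
Definition cocycle_law : set (A * A * A -> R[i]) := [set g |
  [/\ forall r, sesqui (fun x y => g (x, y, r)),
      forall x y (k : R[i]) r r', g (x, y, k *: r + r') = k * g (x, y, r) + g (x, y, r') &
      forall x y a b, g (x, y, a * b) = g (x * a, y, b) + g (x, y * star b, a)]].

Definition cocycle_weight (t : A * A * A) : R := nr t.1.1 * nr t.1.2 * nr t.2.

Lemma cocycle_weight_ge0 t : 0 <= cocycle_weight t.
Proof. by rewrite !mulr_ge0 ?nr_ge0. Qed.

Lemma cocycle_law0 : cocycle_law (fun=> 0).
Proof.
split=> [r|x y k r r'|x y a b]; rewrite ?mulr0 ?addr0//.
by split=> *; rewrite mulr0 addr0.
Qed.

Lemma cocycle_lawD f g : cocycle_law f -> cocycle_law g ->
  cocycle_law (fun t => f t + g t).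
Proof.
move=> [f1 f2 f3] [g1 g2 g3]; split=> [r|x y k r r'|x y a b].
- by split=> k *; rewrite ?(f1 r).1 ?(g1 r).1 ?(f1 r).2 ?(g1 r).2; ring.
- by rewrite f2 g2; ring.
- by rewrite f3 g3; ring.
Qed.

Lemma cocycle_lawZ k f : cocycle_law f -> cocycle_law (fun t => k * f t).
Proof.
move=> [f1 f2 f3]; split=> [r|x y c r r'|x y a b].
- by split=> c *; rewrite ?(f1 r).1 ?(f1 r).2; ring.
- by rewrite f2; ring.
- by rewrite f3; ring.
Qed.

Lemma cocycle_law_lim (u : nat -> A * A * A -> R[i]) f : (forall n, cocycle_law (u n)) ->
  (forall t, lim_to (u ^~ t) (f t)) -> cocycle_law f.
Proof.
move=> hu uf; split=> [r|x y k r r'|x y a b]; first split=> [k x x' y|k x y y'].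
- apply: (lim_uniq (uf _)); have := limD (limCZ k (uf (x, y, r))) (uf (x', y, r)).
  by congr lim_to; apply/funext => n; have [h _ _] := hu n; rewrite (h r).1.
- apply: (lim_uniq (uf _)); have := limD (limCZ (conjc k) (uf (x, y, r))) (uf (x, y', r)).
  by congr lim_to; apply/funext => n; have [h _ _] := hu n; rewrite (h r).2.
- apply: (lim_uniq (uf _)); have := limD (limCZ k (uf (x, y, r))) (uf (x, y, r')).
  by congr lim_to; apply/funext => n; have [_ h _] := hu n; rewrite h.
- apply: (lim_uniq (uf _)); have := limD (uf (x * a, y, b)) (uf (x, y * star b, a)).
  by congr lim_to; apply/funext => n; have [_ _ h] := hu n; rewrite h.
Qed.

Definition cocycle_bspace : bspace R := BSpace cocycle_weight_ge0 cocycle_law0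
  cocycle_lawD cocycle_lawZ cocycle_law_lim.
Local Notation X := (bdd cocycle_bspace).
Implicit Types g h : X.

Lemma nr_cocycle g x y r : nr (g (x, y, r)) <= nr g * (nr x * nr y * nr r).
Proof. exact: bnorm_ub. Qed.

Lemma cocycleP g : cocycle_law g. Proof. exact: (bfun_law g). Qed.

Definition lcoc_fun a g (t : A * A * A) : R[i] := g (t.1.1, star a * t.1.2, t.2).
Definition rcoc_fun g a (t : A * A * A) : R[i] := g (a * t.1.1, t.1.2, t.2).

Lemma lcoc_law a g : cocycle_law (lcoc_fun a g).
Proof.
have [g1 g2 g3] := cocycleP g.
split=> [r|x y k r r'|x y c d]; rewrite /lcoc_fun /= ?g2 ?g3 ?mulrA//.
by split=> *; rewrite ?(g1 r).1// mulrDr -scaleMr (g1 r).2.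
Qed.

Lemma rcoc_law g a : cocycle_law (rcoc_fun g a).
Proof.
have [g1 g2 g3] := cocycleP g.
split=> [r|x y k r r'|x y c d]; rewrite /rcoc_fun /= ?g2 ?g3 ?mulrA//.
by split=> *; rewrite ?(g1 r).2// mulrDr -scaleMr (g1 r).1.
Qed.

Lemma lcoc_ub a g t : nr (lcoc_fun a g t) <= (nr a * nr g) * cocycle_weight t.
Proof.
case: t => [[x y] r]; apply: le_trans (nr_cocycle _ _ _ _) _; rewrite /cocycle_weight /=.
have h := nr_mul (star a) y; rewrite nr_star in h.
have -> : nr a * nr g * (nr x * nr y * nr r) = nr g * (nr x * (nr a * nr y) * nr r) by ring.
by rewrite ler_wpM2l ?nr_ge0// ler_wpM2r ?nr_ge0// ler_wpM2l ?nr_ge0.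
Qed.

Lemma rcoc_ub g a t : nr (rcoc_fun g a t) <= (nr a * nr g) * cocycle_weight t.
Proof.
case: t => [[x y] r]; apply: le_trans (nr_cocycle _ _ _ _) _; rewrite /cocycle_weight /=.
have h := nr_mul a x.
have -> : nr a * nr g * (nr x * nr y * nr r) = nr g * (nr a * nr x * nr y * nr r) by ring.
by rewrite ler_wpM2l ?nr_ge0// ler_wpM2r ?nr_ge0// ler_wpM2r ?nr_ge0.
Qed.

Definition lcoc a g : X := @Bdd R cocycle_bspace _ (lcoc_law a g) (ex_intro _ _ (lcoc_ub a g)).
Definition rcoc g a : X := @Bdd R cocycle_bspace _ (rcoc_law g a) (ex_intro _ _ (rcoc_ub g a)).

Lemma lcoc_bilinear : bilinear_for ( *:%R : GRing.Scale.law R[i] X)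
  ( *:%R : GRing.Scale.law R[i] X) lcoc.
Proof.
split=> [g k a b|a k g h]; last by apply: bdd_ext.
apply: bdd_ext => -[[x y] r]; rewrite bddE_add bddE_scale /= /lcoc_fun /=.
have [g1 _ _] := cocycleP g.
by rewrite starD starZc mulrDl -scaleMl (g1 r).2 conjcK.
Qed.

Lemma rcoc_bilinear : bilinear_for ( *:%R : GRing.Scale.law R[i] X)
  ( *:%R : GRing.Scale.law R[i] X) rcoc.
Proof.
split=> [a k g h|g k a b]; first by apply: bdd_ext.
apply: bdd_ext => -[[x y] r]; rewrite bddE_add bddE_scale /= /rcoc_fun /=.
by have [g1 _ _] := cocycleP g; rewrite mulrDl -scaleMl (g1 r).1.
Qed.

HB.instance Definition _ := bilinear_isBilinear.Build R[i] A X X *:%R *:%R lcoc lcoc_bilinear.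
HB.instance Definition _ := bilinear_isBilinear.Build R[i] X A X *:%R *:%R rcoc rcoc_bilinear.

Definition coc_eval a g : R[i] := g (1, 1, a).

Lemma coc_eval_bilinear : bilinear_for ( *%R : GRing.Scale.law R[i] R[i])
  ( *%R : GRing.Scale.law R[i] R[i]) coc_eval.
Proof.
split=> [g k a b|a k g h]; last by [].
by rewrite /coc_eval; have [_ -> _] := cocycleP g.
Qed.

HB.instance Definition _ :=
  bilinear_isBilinear.Build R[i] A X R[i] *%R *%R coc_eval coc_eval_bilinear.

Lemma lcoc_bounded : exists K : R, forall a g, `|lcoc a g| <= K%:C * `|a| * `|g|.
Proof.
exists 1 => a g; rewrite mul1r !nrE -rmorphM lecR.
by apply: bnorm_le => [|t]; [rewrite mulr_ge0 ?nr_ge0|exact: lcoc_ub].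
Qed.

Lemma rcoc_bounded : exists K : R, forall a g, `|rcoc g a| <= K%:C * `|a| * `|g|.
Proof.
exists 1 => a g; rewrite mul1r !nrE -rmorphM lecR.
by apply: bnorm_le => [|t]; [rewrite mulr_ge0 ?nr_ge0|exact: rcoc_ub].
Qed.

Lemma lcocM a b g : lcoc (a * b) g = lcoc a (lcoc b g).
Proof. by apply: bdd_ext => t; rewrite /= /lcoc_fun /= starMr mulrA. Qed.
Lemma rcocM a b g : rcoc g (a * b) = rcoc (rcoc g a) b.
Proof. by apply: bdd_ext => t; rewrite /= /rcoc_fun /= mulrA. Qed.
Lemma lrcocA a b g : rcoc (lcoc a g) b = lcoc a (rcoc g b).
Proof. exact: bdd_ext. Qed.

Definition cocycle_bimodule : banach_bimodule A X :=
  @BanachBimodule R A X lcoc rcoc lcocM rcocM lrcocA lcoc_bounded rcoc_bounded.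

Lemma coc_eval_derivation : dual_derivation cocycle_bimodule coc_eval.
Proof.
split=> [|a b g].
  exists (nr (1 : A) * nr (1 : A)) => a g; rewrite !nrE -!rmorphM lecR.
  by apply: le_trans (nr_cocycle _ _ _ _) _; rewrite mulrC.
rewrite /= /coc_eval /= /rcoc_fun /lcoc_fun /= !mulr1.
by have [_ _ ->] := cocycleP g; rewrite !mul1r.
Qed.

End CocycleSpace.

Section NoCoboundary.
Variables (R : realType) (A : cstarAlgType R) (tau : A -> R[i]).
Hypotheses (ham : amenable A) (tau1 : tau 1 = 1).
Hypothesis trtau : forall x y, tau (x * y) = tau (y * x).
Implicit Types (a b x y r : A).

Definition coboundary_fun (W : A -> A -> R[i]) (t : A * A * A) : R[i] :=
  W (t.1.1 * t.2) t.1.2 - W t.1.1 (t.1.2 * star t.2).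

Lemma coboundary_law W : sesqui W -> cocycle_law (coboundary_fun W).
Proof.
move=> [W1 W2]; split=> [r|x y k r r'|x y a b]; rewrite /coboundary_fun /=.
- split=> [k x x' y|k x y y'].
    by rewrite mulrDl -scaleMl !W1; ring.
  by rewrite mulrDl -scaleMl !W2; ring.
- by rewrite mulrDr -scaleMr W1 starD starZc mulrDr -scaleMr W2 conjcK; ring.
- by rewrite starMr !mulrA addrA subrK.
Qed.

Lemma coboundary_ub W (K : R) : 0 <= K -> (forall x y, nr (W x y) <= K * (nr x * nr y)) ->
  forall t, nr (coboundary_fun W t) <= (2 * K) * cocycle_weight t.
Proof.
move=> K0 WK [[x y] r]; rewrite /coboundary_fun /cocycle_weight /=.
have h1 : nr (W (x * r) y) <= K * (nr x * nr y * nr r).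
  apply: le_trans (WK _ _) _; rewrite ler_wpM2l// mulrAC ler_wpM2r ?nr_ge0//.
  exact: nr_mul.
have h2 : nr (W x (y * star r)) <= K * (nr x * nr y * nr r).
  apply: le_trans (WK _ _) _; rewrite ler_wpM2l// -mulrA ler_wpM2l ?nr_ge0//.
  by apply: le_trans (nr_mul _ _) _; rewrite nr_star.
by apply: le_trans (nrB _ _) _; move: h1 h2; lra.
Qed.

(* A virtual trace [phi (gamma_W) - W 1 1] is invariant under unitary
   conjugation of W, and its value at the form of tau is -1.                  *)
Lemma amenable_no_coboundary n (u : 'I_n -> A) (W : 'I_n -> A -> A -> R[i]) (K : R) :
  (forall k, star (u k) * u k = 1) -> (forall k, u k * star (u k) = 1) ->
  (forall k, sesqui (W k)) -> 0 <= K ->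
  (forall k x y, nr (W k x y) <= K * (nr x * nr y)) ->
  ~ forall x y, tau (star y * x) = \sum_k (W k (u k * x) (u k * y) - W k x y).
Proof.
move=> uu uu' sW K0 WK H.
have [phi _ hphi] := ham (coc_eval_derivation A).
pose g k : bdd (cocycle_bspace A) := @Bdd R (cocycle_bspace A) _ (coboundary_law (sW k))
  (ex_intro _ _ (coboundary_ub K0 (WK k))).
pose g' k := lcoc (star (u k)) (rcoc (g k) (u k)).
have e1 k : phi (g k) - phi (g' k) = W k 1 1 - W k (u k) (u k).
  have := hphi (star (u k)) (rcoc (g k) (u k)).
  rewrite /= -rcocM uu' => h.
  have -> : g k = rcoc (g k) 1 by apply: bdd_ext => -[[x y] r]; rewrite /= /rcoc_fun /= mul1r.
  by rewrite -h /coc_eval /= /rcoc_fun /coboundary_fun /= starK !mulr1 mul1r uu'.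
have e2 : \sum_k (phi (g k) - phi (g' k)) = 0.
  rewrite -(eq_bigr _ (fun k _ => linearB phi (g k) (g' k))) -linear_sum.
  have -> : \sum_k (g k - g' k) = 0; last exact: linear0.
  apply: bdd_ext => t.
  have -> : (\sum_k (g k - g' k)) t = \sum_k (g k t - g' k t).
    rewrite (big_morph (fun h : bdd (cocycle_bspace A) => h t)
      (fun h1 h2 => bddE_add h1 h2 t) (bddE0 t)).
    by apply: eq_bigr => k _; rewrite bddE_sub.
  case: t => [[x y] r]; rewrite bddE0.
  have h : tau (star y * (x * r)) - tau (star (y * star r) * x) = 0.
    by rewrite starMr starK [star y * _]mulrA trtau mulrA subrr.
  rewrite !H -sumrB in h; apply: etrans (etrans (congr1 -%R h) (oppr0 _)); rewrite -sumrN.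
  apply: eq_bigr => k _.
  rewrite /= /lcoc_fun /= /rcoc_fun /= starK /coboundary_fun /= !mulrA; ring.
move: e2; under eq_bigr => k _ do rewrite e1.
have h1 : 1 = \sum_k (W k (u k) (u k) - W k 1 1).
  have := H 1 1; rewrite star1 mulr1 tau1 => ->.
  by apply: eq_bigr => k _; rewrite !mulr1.
move=> h2; have h3 : \sum_k (W k (u k) (u k) - W k 1 1) +
    \sum_k (W k 1 1 - W k (u k) (u k)) = 0.
  by rewrite -big_split big1//= => k _; ring.
by move/eqP: h3; rewrite h2 addr0 -h1 oner_eq0.
Qed.

End NoCoboundary.

Section AlmostInvariantFunctional.
Variables (R : realType) (A : cstarAlgType R) (tau : A -> R[i]).
Hypotheses (ham : amenable A) (ptau : pfun tau) (tau1 : tau 1 = 1).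
Hypothesis trtau : forall x y, tau (x * y) = tau (y * x).
Implicit Types (a b x y : A) (Z : seq (A * A)) (V : A -> A -> R[i]).

Definition tnorm x : R := @pn R (pfun_ph ptau) x.

Definition contraction V := sesqui V /\ forall x y, nr (V x y) <= tnorm x * tnorm y.

Definition evalT V Z := \sum_(p <- Z) V p.1 p.2.
Definition conjT a Z : seq (A * A) := [seq (a * p.1, a * p.2) | p <- Z].
Definition trT Z := evalT (fun x y => tau (star y * x)) Z.

Lemma tnorm_ge0 x : 0 <= tnorm x. Proof. exact: pn_ge0. Qed.
Lemma tnorm2 x : tnorm x ^+ 2 = complex.Re (tau (star x * x)).
Proof. by rewrite /tnorm pn2. Qed.

Lemma tnorm_le x : tnorm x <= nr x.
Proof.
rewrite -(ler_pXn2r (ltn0Sn 1)) ?nnegrE ?tnorm_ge0 ?nr_ge0// tnorm2.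
have := pfun_bound x 1 ptau; rewrite !mulr1 star1 tau1 /=.
by rewrite mulr1.
Qed.

Lemma tnorm_unitary (u : A) x : star u * u = 1 -> tnorm (u * x) = tnorm x.
Proof.
by move=> uu; rewrite /tnorm /pn /= starMr -mulrA [star u * _]mulrA uu mul1r.
Qed.

Lemma evalT_cat V Z Z' : evalT V (Z ++ Z') = evalT V Z + evalT V Z'.
Proof. by rewrite /evalT big_cat. Qed.

Lemma evalT_scl V k Z : sesqui V -> evalT V (sclT k Z) = k * evalT V Z.
Proof.
move=> sV; rewrite /evalT big_map mulr_sumr; apply: eq_bigr => p _ /=.
by have := sV.1 (k - 1) p.1 p.1 p.2; rewrite scalerBl scale1r subrK => ->; ring.
Qed.

Lemma conjT_cat a Z Z' : conjT a (Z ++ Z') = conjT a Z ++ conjT a Z'.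
Proof. exact: map_cat. Qed.
Lemma conjT_scl a k Z : conjT a (sclT k Z) = sclT k (conjT a Z).
Proof. by rewrite /conjT /sclT -!map_comp; apply: eq_map => p /=; rewrite scaleMr. Qed.

Lemma sesqui_tau : sesqui (fun x y => tau (star y * x)).
Proof.
split=> [k x x' y|k x y y'].
  by rewrite mulrDr -scaleMr ptau.1.1 ptau.1.2.
by rewrite starD starZc mulrDl -scaleMl ptau.1.1 ptau.1.2.
Qed.

Variables (m : nat) (u : 'I_m -> A).
Hypotheses (uu : forall k, star (u k) * u k = 1) (uu' : forall k, u k * star (u k) = 1).

Definition cform_dom := ('I_m * {V : A -> A -> R[i] | contraction V})%type.

Definition cform_bspace : bspace R.
Proof.
by refine (@BSpace R cform_dom (fun=> 1) (fun=> ler01) setT _ _ _ _).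
Defined.
Local Notation X := (bdd cform_bspace).

Definition hat_fun Z (t : cform_dom) : R[i] :=
  evalT (sval t.2) (conjT (u t.1) Z) - evalT (sval t.2) Z.

Lemma hat_bounded Z : exists C : R, forall t, nr (hat_fun Z t) <= C * 1.
Proof.
exists (2 * \sum_(p <- Z) tnorm p.1 * tnorm p.2) => -[k [V [sV cV]]].
rewrite mulr1 /hat_fun /= mulrDl mul1r; apply: le_trans (nrB _ _) _; apply: lerD.
  rewrite /evalT big_map; apply: le_trans (nr_sum _ _) _.
  by apply: ler_sum => p _; apply: le_trans (cV _ _) _; rewrite !tnorm_unitary.
by apply: le_trans (nr_sum _ _) _; apply: ler_sum => p _; exact: cV.
Qed.

Definition hat Z : X := @Bdd R cform_bspace (hat_fun Z) I (hat_bounded Z).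

Lemma hat_cat Z Z' : hat (Z ++ Z') = hat Z + hat Z'.
Proof.
apply: bdd_ext => t; rewrite bddE_add /= /hat_fun conjT_cat !evalT_cat; ring.
Qed.
Lemma hat_scl k Z : hat (sclT k Z) = k *: hat Z.
Proof.
apply: bdd_ext => -[j [V [sV cV]]]; rewrite bddE_scale /= /hat_fun conjT_scl.
by rewrite !evalT_scl//= mulrBr.
Qed.
Lemma hat_nil : hat [::] = 0.
Proof. by apply: bdd_ext => t; rewrite /= /hat_fun /evalT !big_nil subrr. Qed.
Lemma trT_nil : trT [::] = 0. Proof. exact: big_nil. Qed.
Lemma trT_cat Z Z' : trT (Z ++ Z') = trT Z + trT Z'. Proof. exact: evalT_cat. Qed.
Lemma trT_scl k Z : trT (sclT k Z) = k * trT Z.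
Proof. by apply: evalT_scl; exact: sesqui_tau. Qed.

Definition elem_fun k x y (t : cform_dom) : R[i] := (t.1 == k)%:R * sval t.2 x y.

Lemma elem_ub k x y t : nr (elem_fun k x y t) <= (tnorm x * tnorm y) * 1.
Proof.
case: t => j [V [sV cV]]; rewrite mulr1 /elem_fun /= nrM.
case: eqP => _; first by rewrite nr1C mul1r cV.
by rewrite nr0 mul0r mulr_ge0 ?tnorm_ge0.
Qed.

Definition elem k x y : X := @Bdd R cform_bspace (elem_fun k x y) I (ex_intro _ _ (elem_ub k x y)).

Lemma nr_elem k x y : nr (elem k x y) <= tnorm x * tnorm y.
Proof. by apply: bnorm_le => [|t]; [rewrite mulr_ge0 ?tnorm_ge0|exact: elem_ub]. Qed.

Lemma elem_linear k c x x' y : elem k (c *: x + x') y = c *: elem k x y + elem k x' y.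
Proof.
apply: bdd_ext => -[j [V [sV cV]]]; rewrite bddE_add bddE_scale /= /elem_fun /=.
by rewrite sV.1; ring.
Qed.
Lemma elem_antilinear k c x y y' :
  elem k x (c *: y + y') = conjc c *: elem k x y + elem k x y'.
Proof.
apply: bdd_ext => -[j [V [sV cV]]]; rewrite bddE_add bddE_scale /= /elem_fun /=.
by rewrite sV.2; ring.
Qed.

Lemma hat_elem x y : hat [:: (x, y)] = \sum_k (elem k (u k * x) (u k * y) - elem k x y).
Proof.
apply: bdd_ext => -[j [V cV]].
have -> t : (\sum_k (elem k (u k * x) (u k * y) - elem k x y)) t =
    \sum_k (elem_fun k (u k * x) (u k * y) t - elem_fun k x y t).
  rewrite (big_morph (fun h : X => h t) (fun h1 h2 => bddE_add h1 h2 t) (bddE0 t)).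
  by apply: eq_bigr => k _; rewrite bddE_sub.
rewrite /= /hat_fun /evalT /conjT /= !big_seq1 /= (bigD1 j)//= big1 => [|k kj].
  by rewrite /elem_fun /= eqxx !mul1r addr0.
by rewrite /elem_fun /= eq_sym (negPf kj) !mul0r subrr.
Qed.

Lemma almost_invariant_functional (C : R) : 0 <= C ->
  exists Z, C * nr (hat Z) < complex.Re (trT Z).
Proof.
move=> C0; apply: contrapT => nZ.
have hC Z : complex.Re (trT Z) <= C * nr (hat Z).
  by rewrite leNgt; apply/negP => h; apply: nZ; exists Z.
pose S (Y : X) : set R := [set r | exists Z, C * nr (Y + hat Z) - complex.Re (trT Z) <= r].
have [f [fD fZ fS]] : exists f : X -> R, [/\ (forall x y : X, f (x + y) = f x + f y),
    forall (a : R) (x : X), f (a%:C *: x) = a * f x & forall (x : X) r, S x r -> f x <= r].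
  apply: (hahn_banach_cone (b := fun Y => - (C * nr Y))).
  - by move=> Y; exists (C * nr (Y + hat [::]) - complex.Re (trT [::])), [::].
  - move=> Y r [Z]; apply: le_trans.
    have h1 : nr (hat Z) <= nr (Y + hat Z) + nr Y.
      by have := nrB (Y + hat Z) Y; rewrite addrAC subrr add0r.
    have := hC Z; have := ler_wpM2l C0 h1; lra.
  - move=> Y Y' r s [Z hZ] [Z' hZ']; exists (Z ++ Z').
    rewrite hat_cat addrACA trT_cat raddfD /=.
    by have := ler_wpM2l C0 (nrD (Y + hat Z) (Y' + hat Z')); lra.
  - move=> a Y r a0 [Z hZ]; exists (sclT a%:C Z).
    rewrite hat_scl -scalerDr nrZr ger0_norm ?(ltW a0)// trT_scl.
    have -> : complex.Re (a%:C * trT Z) = a * complex.Re (trT Z).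
      by case: (trT Z) => p q /=; ring.
    by have := ler_wpM2l (ltW a0) hZ; lra.
have f_hat Z : f (hat Z) = complex.Re (trT Z).
  have le Z' : f (hat Z') <= complex.Re (trT Z').
    apply: fS; exists (sclT (-1) Z'); rewrite hat_scl scaleN1r subrr nr0 mulr0 sub0r.
    by rewrite trT_scl mulN1r raddfN opprK.
  apply/eqP; rewrite eq_le le /=.
  have := le (sclT (-1) Z); rewrite hat_scl trT_scl mulN1r raddfN /=.
  have -> : (-1) *: hat Z = (-1)%:C *: hat Z by rewrite rmorphN1.
  by rewrite fZ mulN1r lerN2.
have f_le Y : `|f Y| <= C * nr Y.
  have le Y' : f Y' <= C * nr Y'.
    by apply: fS; exists [::]; rewrite hat_nil addr0 trT_nil subr0.
  rewrite ler_norml le andbT -lerN2 opprK.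
  have <- : f (- Y) = - f Y by have := fZ (-1) Y; rewrite rmorphN1 scaleN1r mulN1r.
  by rewrite -(nrN Y).
pose F Y := (f Y)%:C - 'i * (f ('i *: Y))%:C.
have lF : clinear F := complexify fD fZ.
have F_hat Z : F (hat Z) = trT Z.
  rewrite /F f_hat -hat_scl f_hat trT_scl.
  case: (trT Z) => p q; apply/eqP; rewrite eq_complex /=; apply/andP; split; apply/eqP; ring.
have F_le Y : nr (F Y) <= (2 * C) * nr Y.
  apply: le_trans (nrB _ _) _; rewrite nrM nr_i mul1r !nr_real.
  have := f_le Y; have := f_le ('i *: Y); rewrite nrZ nr_i mul1r; lra.
pose W k x y := F (elem k x y).
refine (@amenable_no_coboundary R A tau ham tau1 trtau m u W (2 * C) uu uu' _ _ _ _).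
- move=> k; split=> [c x x' y|c x y y'].
    by rewrite /W elem_linear lF.1 lF.2.
  by rewrite /W elem_antilinear lF.1 lF.2.
- by rewrite mulr_ge0.
- move=> k x y; apply: le_trans (F_le _) _; rewrite ler_wpM2l ?mulr_ge0//.
  apply: le_trans (nr_elem _ _ _) _.
  by apply: ler_pM; rewrite ?tnorm_ge0 ?tnorm_le.
- move=> x y; have := F_hat [:: (x, y)]; rewrite /trT /evalT big_seq1 /= => <-.
  rewrite hat_elem (big_morph F (lF.1) (_ : F 0 = 0)).
    apply: eq_bigr => k _; rewrite /W.
    by rewrite lF.1 -scaleN1r lF.2 mulN1r.
  by have := lF.2 0 0; rewrite scale0r mul0r.
Qed.

Lemma hat_ub Z k V : contraction V ->
  nr (evalT V (conjT (u k) Z) - evalT V Z) <= nr (hat Z).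
Proof.
move=> cV; have := bnorm_ub (hat Z) (k, exist _ V cV).
by rewrite mulr1.
Qed.

End AlmostInvariantFunctional.

(** * Finite-rank operators and the Powers-Stormer inequality *)

Lemma hermitian_diag (R : realType) n (h : 'M[R[i]]_n) :
  (forall i j, h i j = conjc (h j i)) ->
  exists (P : 'M[R[i]]_n) (d : 'I_n -> R),
    (forall l m, \sum_i P l i * conjc (P m i) = (l == m)%:R) /\
    forall i j, h i j = \sum_l conjc (P l i) * (d l)%:C * P l j.
Proof.
move=> hh.
have hs : h \is hermsymmx.
  by apply/is_hermitianmxP; rewrite expr0 scale1r; apply/matrixP => i j; rewrite !mxE hh.
have /orthomx_spectralP hE := hermitian_normalmx hs.
have uP := spectral_unitarymx h.
have /mxOverP dr := hermitian_spectral_diag_real hs.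
exists (spectralmx h), (fun l => complex.Re (spectral_diag h 0 l)); split=> [l m|i j].
  have := unitarymxP uP => /matrixP/(_ l m); rewrite !mxE => <-.
  by apply: eq_bigr => i _; rewrite !mxE.
rewrite [in LHS]hE invmx_unitary// !mxE; apply: eq_bigr => l _.
by rewrite mul_mx_diag !mxE RRe_real.
Qed.

Section TraceClass.
Variables (R : realType) (A : cstarAlgType R) (tau : A -> R[i]).
Hypothesis ptau : pfun tau.
Implicit Types (x y v w : A) (Z : seq (A * A)) (V : A -> A -> R[i]).
Local Notation tnorm := (tnorm ptau).

Definition bounded_form V := sesqui V /\ exists K : R, forall x y, nr (V x y) <= K * (tnorm x * tnorm y).

Lemma contraction_bounded V : contraction ptau V -> bounded_form V.
Proof. by case=> sV cV; split => //; exists 1 => x y; rewrite mul1r. Qed.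

Lemma sesqui_suml V (I : Type) (r : seq I) (c : I -> R[i]) (a : I -> A) y : sesqui V ->
  V (\sum_(i <- r) c i *: a i) y = \sum_(i <- r) c i * V (a i) y.
Proof.
case=> V1 _; elim: r => [|i r ih]; last by rewrite !big_cons V1 ih.
rewrite !big_nil; have := V1 1 0 0 y; rewrite scale1r addr0 mul1r => h.
by apply: (addrI (V 0 y)); rewrite -h addr0.
Qed.

Lemma sesqui_sumr V (I : Type) (r : seq I) (c : I -> R[i]) (a : I -> A) x : sesqui V ->
  V x (\sum_(i <- r) c i *: a i) = \sum_(i <- r) conjc (c i) * V x (a i).
Proof.
case=> _ V1; elim: r => [|i r ih]; last by rewrite !big_cons V1 ih.
rewrite !big_nil; have := V1 1 x 0 0; rewrite scale1r addr0 cj1 mul1r => h.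
by apply: (addrI (V x 0)); rewrite -h addr0.
Qed.

Lemma bounded_form_null V x x' y y' : bounded_form V -> nullv tau (x - x') ->
  nullv tau (y - y') -> V x y = V x' y'.
Proof.
move=> [[V1 V2] [K VK]] nx ny.
have t0 z : nullv tau z -> tnorm z = 0.
  by move=> nz; rewrite /tnorm /pn /= nz sqrtr0.
have h1 : V (x - x') y = 0 by apply: nr_le0; apply: le_trans (VK _ _) _; rewrite (t0 _ nx) mul0r mulr0.
have h2 : V x' (y - y') = 0 by apply: nr_le0; apply: le_trans (VK _ _) _; rewrite (t0 _ ny) !mulr0.
have := V1 1 (x - x') x' y; rewrite scale1r subrK mul1r h1 add0r => ->.
by have := V2 1 x' (y - y') y'; rewrite scale1r subrK cj1 mul1r h2 add0r.
Qed.

Definition rank_one v w x y := tau (star v * x) * conjc (tau (star w * y)).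

Lemma tau_ip_le x y : nr (tau (star y * x)) <= tnorm x * tnorm y.
Proof. exact: (@ph_CS R (pfun_ph ptau) x y). Qed.

Lemma rank_one_bounded v w : bounded_form (rank_one v w).
Proof.
split; first split=> [k x x' y|k x y y']; rewrite /rank_one.
- by rewrite mulrDr -scaleMr ptau.1.1 ptau.1.2; ring.
- by rewrite mulrDr -scaleMr ptau.1.1 ptau.1.2 cjD cjM; ring.
exists (tnorm v * tnorm w) => x y; rewrite nrM nr_conj.
have -> : tnorm v * tnorm w * (tnorm x * tnorm y) =
  (tnorm x * tnorm v) * (tnorm y * tnorm w) by ring.
by apply: ler_pM; rewrite ?nr_ge0// tau_ip_le.
Qed.

Definition kern Z v w := evalT (rank_one v w) Z.

Lemma diag_list Z : (forall v w, kern Z v w = conjc (kern Z w v)) ->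
  exists n (g : 'I_n -> A) (d : 'I_n -> R), orthonormal tau g /\
    forall V, bounded_form V -> evalT V Z = \sum_l (d l)%:C * V (g l) (g l).
Proof.
move=> hZ.
have [n [e [oe _ he]]] : exists n (e : 'I_n -> A), [/\ orthonormal tau e,
    forall i, setT (e i) & forall b, b \in map fst Z ++ map snd Z -> nullv tau (b - oproj tau e b)].
  exact: gram_schmidt.
pose h := \matrix_(i < n, j < n) kern Z (e i) (e j).
have [P [d [oP hP]]] : exists (P : 'M[R[i]]_n) (d : 'I_n -> R),
    (forall l m, \sum_i P l i * conjc (P m i) = (l == m)%:R) /\
    forall i j, h i j = \sum_l conjc (P l i) * (d l)%:C * P l j.
  by apply: hermitian_diag => i j; rewrite !mxE.
pose g l := \sum_i conjc (P l i) *: e i.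
exists n, g, d; split=> [l m|V bV].
  rewrite /g star_sum mulr_suml (clin_sum _ _ _ ptau.1).
  rewrite eq_sym -(oP m l); apply: eq_bigr => i _.
  rewrite mulr_sumr (clin_sum _ _ _ ptau.1) (bigD1 i)//= big1 => [|j ji].
    by rewrite starZc -scaleMl -scaleMr !(pfunZ ptau) oe eqxx mulr1 addr0 conjcK.
  by rewrite starZc -scaleMl -scaleMr !(pfunZ ptau) oe (negPf ji) !mulr0.
have [sV _] := bV.
have -> : evalT V Z = \sum_i \sum_j h i j * V (e i) (e j).
  rewrite /evalT big_seq.
  have E p : p \in Z -> V p.1 p.2 =
     \sum_i \sum_j rank_one (e i) (e j) p.1 p.2 * V (e i) (e j).
    move=> pZ; rewrite (bounded_form_null (x' := oproj tau e p.1) (y' := oproj tau e p.2) bV).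
    - rewrite /oproj sesqui_suml//; apply: eq_bigr => i _.
      rewrite sesqui_sumr// mulr_sumr; apply: eq_bigr => j _.
      by rewrite /rank_one mulrA.
    - by apply: he; rewrite mem_cat map_f.
    - by apply: he; rewrite mem_cat map_f ?orbT.
  rewrite (eq_bigr _ E) -big_seq exchange_big; apply: eq_bigr => i _.
  rewrite exchange_big; apply: eq_bigr => j _.
  by rewrite mxE /kern /evalT mulr_suml.
under eq_bigr => i _ do under eq_bigr => j _ do rewrite hP mulr_suml.
under eq_bigr => i _ do rewrite exchange_big.
rewrite exchange_big; apply: eq_bigr => l _.
rewrite sesqui_suml// mulr_sumr; apply: eq_bigr => i _.
rewrite sesqui_sumr// !mulr_sumr; apply: eq_bigr => j _.
by rewrite conjcK; ring.
Qed.

Definition diag_form n (g : 'I_n -> A) (s : 'I_n -> R) x y :=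
  \sum_j (s j)%:C * rank_one (g j) (g j) x y.

Lemma diag_form_contraction n (g : 'I_n -> A) s : orthonormal tau g ->
  (forall j, `|s j| <= 1) -> contraction ptau (diag_form g s).
Proof.
move=> og s1; split.
  split=> [k x x' y|k x y y']; rewrite mulr_sumr -big_split; apply: eq_bigr => j _ /=.
    by rewrite (rank_one_bounded _ _).1.1; ring.
  by rewrite (rank_one_bounded _ _).1.2; ring.
move=> x y.
have h : nr (diag_form g s x y) <= \sum_j nr (tau (star (g j) * x)) * nr (tau (star (g j) * y)).
  apply: le_trans (nr_sum _ _) _; apply: ler_sum => j _.
  rewrite nrM nr_real /rank_one nrM nr_conj -[leRHS]mul1r.
  by rewrite ler_wpM2r ?mulr_ge0 ?nr_ge0.
apply: le_trans h _; set S := \sum_j _.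
have S0 : 0 <= S by apply: sumr_ge0 => j _; rewrite mulr_ge0 ?nr_ge0.
rewrite -(ler_pXn2r (ltn0Sn 1)) ?nnegrE ?mulr_ge0 ?tnorm_ge0//.
apply: le_trans (sqr_sum_le _ _ _) _; rewrite exprMn !tnorm2.
by apply: ler_pM; rewrite ?bessel//; apply: sumr_ge0 => j _; exact: sqr_ge0.
Qed.

Lemma diag_form_diag n (g : 'I_n -> A) s x :
  diag_form g s x x = (\sum_j s j * nr (tau (star (g j) * x)) ^+ 2)%:C.
Proof.
by rewrite rmorph_sum; apply: eq_bigr => j _; rewrite rmorphM /= sqr_nr.
Qed.

Lemma diag_form_self n (g : 'I_n -> A) s l : orthonormal tau g ->
  diag_form g s (g l) (g l) = (s l)%:C.
Proof.
move=> og; rewrite /diag_form (bigD1 l)//= big1 => [|j jl].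
  by rewrite /rank_one og eqxx cj1 !mulr1 addr0.
by rewrite /rank_one og eq_sym (negPf jl) mul0r mulr0.
Qed.

End TraceClass.

Section PowersStormer.
Variables (R : realType) (A : cstarAlgType R) (tau : A -> R[i]).
Hypothesis ptau : pfun tau.
Hypothesis trtau : forall x y, tau (x * y) = tau (y * x).
Implicit Types (x y v w : A) (Z : seq (A * A)) (V : A -> A -> R[i]).
Local Notation tnorm := (tnorm ptau).
Local Notation T := (coarse ptau ptau).

(* [(x, y)] stands for the rank-one operator [x y^*] on L^2(tau), which is
   the tensor [x (x) star y] of the coarse bimodule.                          *)
Definition tens Z : seq (A * A) := [seq (p.1, star p.2) | p <- Z].

Lemma cform_tens Z Z' : cform tau tau (tens Z) (tens Z') = \sum_(q <- Z') kern tau Z q.1 q.2.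
Proof.
rewrite /cform big_map exchange_big big_map; apply: eq_bigr => q _.
apply: eq_bigr => p _; rewrite /rank_one /=; congr (_ * _).
by rewrite starK trtau (pfun_ipC ptau).
Qed.

Variables (n : nat) (e f : 'I_n -> A) (r : 'I_n -> R).
Hypotheses (oe : orthonormal tau e) (of_ : orthonormal tau f) (r0 : forall l, 0 <= r l).

Definition diff_list : seq (A * A) :=
  [seq ((r l)%:C *: f l, f l) | l <- enum 'I_n] ++
  [seq ((- r l)%:C *: e l, e l) | l <- enum 'I_n].

Lemma evalT_diff V : sesqui V -> evalT V diff_list =
  \sum_l (r l)%:C * V (f l) (f l) - \sum_l (r l)%:C * V (e l) (e l).
Proof.
move=> sV; have VZ k x y : V (k *: x) y = k * V x y.
  by have := sesqui_suml [:: tt] (fun=> k) (fun=> x) y sV; rewrite !big_seq1.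
rewrite /diff_list evalT_cat /evalT big_map big_enum /= big_map big_enum /= -sumrN; congr (_ + _).
  by apply: eq_bigr => l _; rewrite VZ.
by apply: eq_bigr => l _; rewrite VZ rmorphN /= mulNr.
Qed.

Lemma kern_diff v w : kern tau diff_list v w =
  \sum_l (r l)%:C * rank_one tau v w (f l) (f l) - \sum_l (r l)%:C * rank_one tau v w (e l) (e l).
Proof. by rewrite /kern evalT_diff//; have [] := rank_one_bounded ptau v w. Qed.

Lemma rank_oneC v w x : rank_one tau v w x x = conjc (rank_one tau w v x x).
Proof. by rewrite /rank_one cjM conjcK mulrC. Qed.

Lemma powers_stormer : exists N (g : 'I_N -> A) (s : 'I_N -> R),
  [/\ orthonormal tau g, forall j, `|s j| <= 1 &
  @pn R T (tens diff_list) ^+ 2 <= \sum_l r l ^+ 2 *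
    complex.Re (diag_form tau g s (f l) (f l) - diag_form tau g s (e l) (e l))].
Proof.
have hermD v w : kern tau diff_list v w = conjc (kern tau diff_list w v).
  rewrite !kern_diff cjD cjN !cj_sum; congr (_ - _); apply: eq_bigr => l _;
  by rewrite cjM cjr -rank_oneC.
have [N [g [t [og hg]]]] := diag_list ptau hermD.
have K1 v w : kern tau diff_list v w =
    \sum_j (t j)%:C * (tau (star v * g j) * conjc (tau (star w * g j))).
  by rewrite /kern hg//; exact: rank_one_bounded.
have K2 v j : kern tau diff_list v (g j) = (t j)%:C * tau (star v * g j).
  rewrite K1 (bigD1 j)//= big1 => [|i ij]; first by rewrite og eqxx cj1 mulr1 addr0.
  by rewrite og (negPf ij) conjc0 !mulr0.
have pnE : @pn R T (tens diff_list) ^+ 2 = \sum_j t j ^+ 2.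
  rewrite pn2 /= cform_tens.
  have -> : \sum_(q <- diff_list) kern tau diff_list q.1 q.2 =
      \sum_j (t j)%:C * conjc (kern tau diff_list (g j) (g j)).
    under eq_bigr => q _ do rewrite K1.
    rewrite exchange_big; apply: eq_bigr => j _.
    rewrite /kern /evalT cj_sum mulr_sumr; apply: eq_bigr => q _.
    by rewrite /rank_one cjM conjcK -!(pfun_ipC ptau).
  rewrite raddf_sum; apply: eq_bigr => j _ /=.
  by rewrite K2 og eqxx mulr1 cjr /= mul0r subr0 expr2.
pose al j l := tau (star (g j) * f l); pose be j l := tau (star (g j) * e l).
have cal j l : conjc (al j l) = tau (star (f l) * g j) by rewrite -(pfun_ipC ptau).
have cbe j l : conjc (be j l) = tau (star (e l) * g j) by rewrite -(pfun_ipC ptau).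
pose c k m := tau (star (f k) * e m).
have E1 j k : (r k)%:C * conjc (al j k) - \sum_m (r m)%:C * (c k m * conjc (be j m)) =
    (t j)%:C * conjc (al j k).
  rewrite [in RHS]cal -K2 kern_diff; congr (_ - _).
  rewrite (bigD1 k)//= big1 => [|l lk]; first by rewrite /rank_one of_ eqxx mul1r addr0.
  by rewrite /rank_one of_ (negPf lk) mul0r mulr0.
have E2 j k : \sum_l (r l)%:C * (conjc (c l k) * conjc (al j l)) - (r k)%:C * conjc (be j k) =
    (t j)%:C * conjc (be j k).
  rewrite [in RHS]cbe -K2 kern_diff; congr (_ - _).
    by apply: eq_bigr => l _; rewrite /rank_one /c -(pfun_ipC ptau).
  rewrite [RHS](bigD1 k)//= big1 => [|l lk]; first by rewrite /rank_one oe eqxx mul1r addr0.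
  by rewrite /rank_one oe (negPf lk) mul0r mulr0.
pose Aj j := \sum_l r l * nr (al j l) ^+ 2; pose Bj j := \sum_l r l * nr (be j l) ^+ 2.
have Aj0 j : 0 <= Aj j by apply: sumr_ge0 => l _; rewrite mulr_ge0// sqr_ge0.
have Bj0 j : 0 <= Bj j by apply: sumr_ge0 => l _; rewrite mulr_ge0// sqr_ge0.
have tE j : t j = Aj j - Bj j.
  apply: complexI; have := K2 (g j) j; rewrite og eqxx mulr1 => <-.
  rewrite kern_diff rmorphB !rmorph_sum; congr (_ - _); apply: eq_bigr => l _;
  by rewrite rmorphM /= sqr_nr.
have key j : \sum_l r l ^+ 2 * nr (al j l) ^+ 2 - \sum_l r l ^+ 2 * nr (be j l) ^+ 2 =
    t j * (Aj j + Bj j).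
  pose X := \sum_k \sum_m (r k)%:C * (r m)%:C * (al j k * c k m * conjc (be j m)).
  have S1 : (\sum_l r l ^+ 2 * nr (al j l) ^+ 2)%:C - X = (t j * Aj j)%:C.
    rewrite /X rmorph_sum -sumrB rmorphM rmorph_sum mulr_sumr; apply: eq_bigr => k _.
    rewrite /= [(r k ^+ 2 * _)%:C]rmorphM [(r k * _)%:C]rmorphM /= !sqr_nr.
    transitivity ((r k)%:C * al j k * ((t j)%:C * conjc (al j k))); last by ring.
    rewrite -E1 mulrBr mulr_sumr; congr (_ - _); first by rewrite rmorphXn/=; ring.
    by apply: eq_bigr => m _; ring.
  have S2 : conjc X - (\sum_l r l ^+ 2 * nr (be j l) ^+ 2)%:C = (t j * Bj j)%:C.
    have -> : conjc X = \sum_k \sum_l (r k)%:C * (r l)%:C * (be j k * (conjc (c l k) * conjc (al j l))).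
      rewrite /X cj_sum; under eq_bigr => k _ do rewrite cj_sum.
      rewrite exchange_big; apply: eq_bigr => k _; apply: eq_bigr => l _.
      by rewrite !cjM !cjr conjcK; ring.
    rewrite rmorph_sum -sumrB rmorphM rmorph_sum mulr_sumr; apply: eq_bigr => k _.
    rewrite /= [(r k ^+ 2 * _)%:C]rmorphM [(r k * _)%:C]rmorphM /= !sqr_nr.
    transitivity ((r k)%:C * be j k * ((t j)%:C * conjc (be j k))); last by ring.
    rewrite -E2 mulrBr mulr_sumr; congr (_ - _); last by rewrite rmorphXn/=; ring.
    by apply: eq_bigr => m _; ring.
  have := congr1 (fun z : R[i] => complex.Re z) (congr2 +%R S1 S2).
  by case: (X) => a b /=; lra.
pose s j : R := if t j < 0 then -1 else 1.
have ts j : t j ^+ 2 <= s j * (t j * (Aj j + Bj j)).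
  have := Aj0 j; have := Bj0 j; rewrite {}/s expr2; have := tE j.
  by case: ltP => ht tEj; nra.
exists N, g, s; split => //.
  by move=> j; rewrite /s; case: ifP; rewrite ?normrN normr1.
rewrite pnE; apply: (@le_trans _ _ (\sum_j s j * (t j * (Aj j + Bj j)))).
  by apply: ler_sum => j _; exact: ts.
under eq_bigr => j _ do rewrite -key -sumrB mulr_sumr.
rewrite exchange_big; apply: ler_sum => l _.
rewrite !diag_form_diag -rmorphB /= -sumrB mulr_sumr; apply: ler_sum => j _.
rewrite -/(al j l) -/(be j l); lra.
Qed.

End PowersStormer.

Section SignTrick.
Variables (R : realType) (A : cstarAlgType R) (tau : A -> R[i]).
Hypothesis ptau : pfun tau.
Hypothesis trtau : forall x y, tau (x * y) = tau (y * x).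
Implicit Types (x y v w : A) (V : A -> A -> R[i]).
Local Notation tnorm := (tnorm ptau).
Local Notation T := (coarse ptau ptau).
Variables (n : nat) (e f : 'I_n -> A) (lam : 'I_n -> R) (eps : R).
Hypotheses (oe : orthonormal tau e) (of_ : orthonormal tau f).
Hypothesis hV : forall V, contraction ptau V ->
  nr (\sum_l (lam l)%:C * (V (f l) (f l) - V (e l) (e l))) <= eps.

Let s l : R := if lam l < 0 then -1 else 1.
Let kap := \sum_l `|lam l|.
Let J y := \sum_l ((s l)%:C * tau (star (e l) * y)) *: e l.

Lemma sign_sqr l : s l * s l = 1.
Proof. by rewrite /s; case: ifP => _; rewrite ?mulrNN mulr1. Qed.

Lemma sign_abs l : s l * lam l = `|lam l|.
Proof.
rewrite /s; case: ltP => h; last by rewrite mul1r ger0_norm.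
by rewrite mulN1r ltr0_norm.
Qed.

Lemma sign_le1 l : `|s l| <= 1.
Proof. by rewrite /s; case: ifP; rewrite ?normrN normr1. Qed.

Lemma sign_formE y : tau (star y * J y) = diag_form tau e s y y.
Proof.
rewrite /J mulr_sumr (clin_sum _ _ _ ptau.1); apply: eq_bigr => l _.
by rewrite -scaleMr (pfunZ ptau) /rank_one -(pfun_ipC ptau) mulrA.
Qed.

Lemma tnorm_sign y : tnorm (J y) <= tnorm y.
Proof.
rewrite -(ler_pXn2r (ltn0Sn 1)) ?nnegrE ?tnorm_ge0// !tnorm2.
apply: le_trans (bessel ptau y oe).
have -> : tau (star (J y) * J y) = (\sum_l nr (tau (star (e l) * y)) ^+ 2)%:C; last by [].
rewrite {2}/J mulr_sumr (clin_sum _ _ _ ptau.1) rmorph_sum; apply: eq_bigr => l _ /=.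
rewrite -scaleMr (pfunZ ptau) sqr_nr (pfun_ipC ptau (e l) (J y)) /J (pfunMsum ptau).
rewrite (bigD1 l)//= big1 => [|k kl]; last by rewrite -scaleMr (pfunZ ptau) oe (negPf kl) mulr0.
rewrite -scaleMr (pfunZ ptau) oe eqxx mulr1 addr0 cjM cjr.
by rewrite mulrACA -rmorphM sign_sqr mul1r.
Qed.

Lemma kap_ge0 : 0 <= kap. Proof. exact: sumr_ge0. Qed.

Lemma eps_ge0 : 0 <= eps.
Proof. by apply: le_trans (hV (diag_form_contraction ptau oe sign_le1)); exact: nr_ge0. Qed.

Lemma sign_mass : kap - \sum_l lam l * complex.Re (diag_form tau e s (f l) (f l)) <= eps.
Proof.
apply: le_trans (hV (diag_form_contraction ptau oe sign_le1)).
rewrite -nrN; apply: le_trans (Re_nr _).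
rewrite /kap -sumrB raddfN raddf_sum -sumrN; apply: ler_sum => l _.
rewrite diag_form_self// diag_form_diag -rmorphB -rmorphM /= -sign_abs; lra.
Qed.

Lemma sign_defect : \sum_l `|lam l| * tnorm ((s l)%:C *: f l - J (f l)) ^+ 2 <= 2 * eps.
Proof.
have h l : tnorm ((s l)%:C *: f l - J (f l)) ^+ 2 <=
    2 - 2 * (s l * complex.Re (diag_form tau e s (f l) (f l))).
  have := @pn2_add R (pfun_ph ptau) (-1) ((s l)%:C *: f l) (J (f l)).
  rewrite /= scaleN1r -/(tnorm _) => ->.
  have -> : @pn R (pfun_ph ptau) ((s l)%:C *: f l) ^+ 2 = 1.
    rewrite pn2 /= starZr -scaleMl -scaleMr !(pfunZ ptau) of_ eqxx mulr1.
    by rewrite -rmorphM /= sign_sqr.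
  have h1 : @pn R (pfun_ph ptau) (J (f l)) ^+ 2 <= 1.
    have <- : tnorm (f l) ^+ 2 = 1 by rewrite tnorm2 of_ eqxx.
    by rewrite ler_pXn2r ?nnegrE ?pn_ge0//; exact: tnorm_sign.
  have -> : complex.Re (conjc (-1) * tau (star (J (f l)) * ((s l)%:C *: f l))) =
      - (s l * complex.Re (diag_form tau e s (f l) (f l))).
    rewrite -scaleMr (pfunZ ptau) (pfun_ipC ptau (f l) (J (f l))) sign_formE diag_form_diag.
    by rewrite cjN cj1 cjr mulN1r -rmorphM.
  by rewrite nrN nr1C expr1n mul1r; lra.
apply: (@le_trans _ _ (\sum_l `|lam l| * (2 - 2 * (s l * complex.Re (diag_form tau e s (f l) (f l)))))).
  by apply: ler_sum => l _; rewrite ler_wpM2l.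
have -> : \sum_l `|lam l| * (2 - 2 * (s l * complex.Re (diag_form tau e s (f l) (f l)))) =
  2 * (kap - \sum_l lam l * complex.Re (diag_form tau e s (f l) (f l))).
  rewrite /kap -sumrB mulr_sumr; apply: eq_bigr => l _.
  by rewrite -sign_abs; have := sign_sqr l; move: (s l) (lam l) (complex.Re _) => a b c hs; ring: hs.
by rewrite ler_wpM2l// sign_mass.
Qed.

Lemma abs_form_le V : contraction ptau V ->
  nr (\sum_l (`|lam l|)%:C * (V (f l) (f l) - V (e l) (e l))) <= eps + Num.sqrt (2 * eps * kap).
Proof.
move=> cV; have [sV V1] := cV.
pose V3 x y := V x (J y).
have cV3 : contraction ptau V3.
  split; first split=> [k x x' y|k x y y']; rewrite /V3; first exact: sV.1.
    rewrite -sV.2; congr (V x); rewrite /J scaler_sumr -big_split; apply: eq_bigr => l _ /=.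
    by rewrite mulrDr -scaleMr ptau.1.1 ptau.1.2 scalerA -scalerDl; congr (_ *: _); ring.
  move=> x y; apply: le_trans (V1 _ _) _; rewrite ler_wpM2l ?tnorm_ge0//.
  exact: tnorm_sign.
have V3e l : (lam l)%:C * V3 (e l) (e l) = (`|lam l|)%:C * V (e l) (e l).
  have -> : V3 (e l) (e l) = (s l)%:C * V (e l) (e l).
    rewrite /V3 /J sesqui_sumr// (bigD1 l)//= big1 => [|k kl].
      by rewrite oe eqxx mulr1 cjr addr0.
    by rewrite oe eq_sym (negPf kl) mulr0 conjc0 mul0r.
  by rewrite mulrA -rmorphM /= [_ * s l]mulrC sign_abs.
have V3f l : (`|lam l|)%:C * V (f l) (f l) - (lam l)%:C * V3 (f l) (f l) =
    (lam l)%:C * V (f l) ((s l)%:C *: f l - J (f l)).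
  have := sV.2 (-1) (f l) (J (f l)) ((s l)%:C *: f l).
  rewrite scaleN1r addrC => ->.
  have := sV.2 (s l)%:C (f l) (f l) 0; rewrite !addr0.
  have -> : V (f l) 0 = 0.
    have := sesqui_sumr [::] (fun _ : unit => 0) (fun _ : unit => 0) (f l) sV.
    by rewrite !big_nil.
  by rewrite addr0 => ->; rewrite cjN cj1 cjr -sign_abs rmorphM /V3; ring.
have -> : \sum_l (`|lam l|)%:C * (V (f l) (f l) - V (e l) (e l)) =
    \sum_l (lam l)%:C * (V3 (f l) (f l) - V3 (e l) (e l)) +
    \sum_l (lam l)%:C * V (f l) ((s l)%:C *: f l - J (f l)).
  rewrite -big_split; apply: eq_bigr => l _ /=.
  by rewrite -V3f !mulrBr V3e; ring.
apply: le_trans (nrD _ _) _; apply: lerD; first exact: hV.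
set t := fun l => tnorm ((s l)%:C *: f l - J (f l)).
apply: (@le_trans _ _ (\sum_l `|lam l| * t l)).
  apply: le_trans (nr_sum _ _) _; apply: ler_sum => l _.
  rewrite nrM nr_real ler_wpM2l//; apply: le_trans (V1 _ _) _.
  have -> : tnorm (f l) = 1 by rewrite /tnorm /pn /= of_ eqxx sqrtr1.
  by rewrite mul1r.
set S := \sum_l _.
have S0 : 0 <= S by apply: sumr_ge0 => l _; rewrite mulr_ge0// tnorm_ge0.
rewrite -(ler_pXn2r (ltn0Sn 1)) ?nnegrE ?sqrtr_ge0// sqr_sqrtr; last first.
  by rewrite !mulr_ge0 ?eps_ge0 ?kap_ge0.
have -> : S = \sum_l Num.sqrt `|lam l| * (Num.sqrt `|lam l| * t l).
  by apply: eq_bigr => l _; rewrite mulrA -expr2 sqr_sqrtr.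
apply: le_trans (sqr_sum_le _ _ _) _; rewrite mulrC; apply: ler_pM.
- by apply: sumr_ge0 => l _; exact: sqr_ge0.
- by apply: sumr_ge0 => l _; exact: sqr_ge0.
- apply: le_trans sign_defect; apply: ler_sum => l _.
  by rewrite exprMn sqr_sqrtr.
- by apply: ler_sum => l _; rewrite sqr_sqrtr.
Qed.

Lemma sign_trick :
  @pn R T (tens (diff_list e f (fun l => Num.sqrt `|lam l|))) ^+ 2 <=
  eps + Num.sqrt (2 * eps * kap).
Proof.
have [N [g [t [og t1 h]]]] := powers_stormer ptau trtau oe of_ (fun l => sqrtr_ge0 `|lam l|).
apply: le_trans h _; apply: le_trans (abs_form_le (diag_form_contraction ptau og t1)).
apply: le_trans (Re_nr _); rewrite raddf_sum; apply: ler_sum => l _.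
rewrite sqr_sqrtr// /=; case: (diag_form tau g t (f l) (f l) - _) => a b /=; lra.
Qed.

End SignTrick.

Section Unitaries.
Variables (R : realType) (A : cstarAlgType R).
Implicit Types (x a u v : A).

Definition unitary u := star u * u = 1 /\ u * star u = 1.

Lemma sa_unitary a : sa a -> nr a <= 1 ->
  exists u, unitary u /\ a = (2^-1)%:C *: u + (2^-1)%:C *: star u.
Proof.
move=> sa_ a1.
have a2 : nr (a * a) <= 1.
  by apply: le_trans (nr_mul _ _) _; rewrite mulr_ile1 ?nr_ge0.
have [z [sz _ zz cz]] := sqrt_exists (sa_sq sa_) a2.
pose y := 1 - z; have sy : star y = y by rewrite starB star1 sz.
have yy : y * y = 1 - a * a by [].
have ya : a * y = y * a.
  have za : a * z = z * a by apply: cz; rewrite mulrA.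
  by rewrite /y mulrBr mulrBl mulr1 mul1r za.
clearbody y; exists (a + 'i *: y); split; last first.
  rewrite starD starZc sa_ sy conj_i.
  by cstar_red; repeat split; by field.
have iC : ('i : R[i]) * - 'i = 1 by rewrite mulrN ii opprK.
have iC' : - 'i * ('i : R[i]) = 1 by rewrite mulNr ii opprK.
rewrite /unitary starD starZc sa_ sy conj_i !mulrDl !mulrDr -!scaleMl -!scaleMr.
by rewrite !scalerA ?iC ?iC' yy ya !scale1r scaleNr; split; rewrite addrA ?addrK ?subrK addrC ?subrK.
Qed.

End Unitaries.

Section NonNull.
Variables (R : realType) (A : cstarAlgType R) (tau : A -> R[i]).
Hypotheses (ptau : pfun tau) (tau1 : tau 1 = 1).
Hypothesis trtau : forall x y, tau (x * y) = tau (y * x).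
Implicit Types (x y a u v w : A) (s Z : seq (A * A)) (V : A -> A -> R[i]).
Local Notation T := (coarse ptau ptau).
Local Notation pnT s := (@pn R T s).
Local Notation tnorm := (tnorm ptau).

Lemma pn_commT k x y s :
  pnT (commT (k *: x + y) s) <= nr k * pnT (commT x s) + pnT (commT y s).
Proof.
rewrite -!nr_hin !(hin_commT ptau trtau ptau) -nrZ; apply: le_trans (nrD _ _).
rewrite /commut lactDl lactZl ractDr ractZr scalerBr opprD addrACA//.
Qed.

Definition controlled (L : seq A) x := exists2 C : R, 0 <= C & forall s (eta : R),
  (forall v, v \in L -> pnT (commT v s) <= eta) -> pnT (commT x s) <= C * eta.

Lemma controlled_lin L k x y : controlled L x -> controlled L y -> controlled L (k *: x + y).
Proof.
move=> [C C0 hC] [D D0 hD]; exists (nr k * C + D).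
  by rewrite addr_ge0 ?mulr_ge0 ?nr_ge0.
move=> s eta h; apply: le_trans (pn_commT _ _ _ _) _; rewrite mulrDl -mulrA.
by apply: lerD; [rewrite ler_wpM2l ?nr_ge0 ?hC|exact: hD].
Qed.

Lemma controlled_mem L v : v \in L -> controlled L v.
Proof. by move=> vL; exists 1 => // s eta /(_ _ vL); rewrite mul1r. Qed.

Lemma controlled0 L : controlled L 0.
Proof.
exists 0 => // s eta _.
rewrite mul0r -nr_hin (hin_commT ptau trtau ptau) /commut.
by rewrite (linear0l (lact _)) (linear0 (ract _ _)) subr0 nr0.
Qed.

Lemma controlled_sub L L' x : {subset L <= L'} -> controlled L x -> controlled L' x.
Proof. by move=> sub [C C0 h]; exists C => // s eta hL; apply: h => v /sub; exact: hL. Qed.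

Lemma controlled_sa a : sa a -> exists2 L, (forall v, v \in L -> unitary v) & controlled L a.
Proof.
move=> sa_; have [a0|an0] := eqVneq a 0.
  by exists [::] => //; rewrite a0; exact: controlled0.
have n0 : 0 < nr a by rewrite lt_def nr_eq0 an0 nr_ge0.
pose b := ((nr a)^-1)%:C *: a.
have sb : sa b by exact: saZ.
have b1 : nr b <= 1 by rewrite nrZr ger0_norm ?invr_ge0 ?nr_ge0// mulVf// gt_eqF.
have [u [[u1 u2] bu]] := sa_unitary sb b1.
have -> : a = (nr a)%:C *: ((2^-1)%:C *: u + ((2^-1)%:C *: star u + 0)) + 0.
  by rewrite !addr0 -bu /b scalerA -rmorphM /= mulfV ?gt_eqF// scale1r.
exists [:: u; star u].
  by move=> v; rewrite !inE => /orP[]/eqP->; rewrite /unitary ?starK.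
apply: controlled_lin (controlled0 _).
apply: controlled_lin; first by apply: controlled_mem; rewrite inE eqxx.
by apply: controlled_lin (controlled0 _); apply: controlled_mem; rewrite !inE eqxx orbT.
Qed.

Lemma controlled_unitaries x :
  exists2 L, (forall v, v \in L -> unitary v) & controlled L x.
Proof.
have s1 : sa (re_part x) by exact: sa_re_part.
have s2 : sa (re_part (- 'i *: x)) by exact: sa_re_part.
have [L1 u1 c1] := controlled_sa s1; have [L2 u2 c2] := controlled_sa s2.
exists (L1 ++ L2); first by move=> v; rewrite mem_cat => /orP[/u1|/u2].
have -> : x = 'i *: re_part (- 'i *: x) + re_part x.
  rewrite /re_part starZc cjN conj_i opprK !scalerDr !scalerA.
  have -> : 'i * (2^-1)%:C * - 'i = (2^-1)%:C :> R[i].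
    by rewrite mulrAC mulrN ii opprK mul1r.
  have -> : 'i * (2^-1)%:C * 'i = - (2^-1)%:C :> R[i].
    by rewrite mulrAC ii mulN1r.
  rewrite scaleNr addrACA addNr addr0 -scalerDl -rmorphD /=.
  by rewrite (_ : 2^-1 + 2^-1 = 1) ?scale1r//; field.
apply: controlled_lin.
  by apply: controlled_sub c2 => v vL; rewrite mem_cat vL orbT.
by apply: controlled_sub c1 => v vL; rewrite mem_cat vL.
Qed.

Lemma controlled_seq (Q : seq A) : exists2 L : seq A, (forall v, v \in L -> unitary v) &
  exists2 C : R, 0 <= C & forall s (eta : R), 0 <= eta ->
    (forall v, v \in L -> pnT (commT v s) <= eta) ->
    \sum_(x <- Q) pnT (commT x s) ^+ 2 <= C * eta ^+ 2.
Proof.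
elim: Q => [|x Q [L uL [C C0 hC]]].
  by exists [::] => //; exists 0 => // s eta _ _; rewrite big_nil mul0r.
have [L' uL' [D D0 hD]] := controlled_unitaries x.
exists (L' ++ L); first by move=> v; rewrite mem_cat => /orP[/uL'|/uL].
exists (D ^+ 2 + C) => [|s eta e0 h]; first by rewrite addr_ge0 ?sqr_ge0.
rewrite big_cons mulrDl -exprMn; apply: lerD.
  rewrite ler_pXn2r ?nnegrE ?pn_ge0 ?mulr_ge0//.
  by apply: hD => v vL; apply: h; rewrite mem_cat vL.
by apply: hC => // v vL; apply: h; rewrite mem_cat vL orbT.
Qed.

Definition starL Z : seq (A * A) := [seq (p.2, p.1) | p <- Z].

Lemma kern_star Z v w : kern tau (starL Z) v w = conjc (kern tau Z w v).
Proof.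
rewrite /kern /evalT big_map cj_sum; apply: eq_bigr => p _ /=.
by rewrite /rank_one cjM conjcK mulrC.
Qed.

Lemma evalT_star V Z : evalT V (starL Z) = conjc (evalT (fun x y => conjc (V y x)) Z).
Proof.
by rewrite /evalT big_map cj_sum; apply: eq_bigr => p _ /=; rewrite conjcK.
Qed.

Lemma contraction_star V : contraction ptau V -> contraction ptau (fun x y => conjc (V y x)).
Proof.
move=> [[V1 V2] cV]; split; first split=> [k x x' y|k x y y'].
- by rewrite V2 cjD cjM conjcK.
- by rewrite V1 cjD cjM.
- by move=> x y; rewrite nr_conj mulrC.
Qed.

Lemma pn_rmap_unitary u s : u * star u = 1 -> pnT (rmap u s) = pnT s.
Proof.
by move=> uu; rewrite /pn /= (cform_rmap _ trtau) -rmapM uu rmap1.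
Qed.

Lemma pn_commut_unitary n (e : 'I_n -> A) (r : 'I_n -> R) u : unitary u ->
  let S := tens [seq ((r l)%:C *: e l, e l) | l <- enum 'I_n] in
  pnT (commT u S) = pnT (tens (diff_list e (fun l => u * e l) r)).
Proof.
move=> [u1 u2] S; rewrite -(@pn_rmap_unitary (star u)); last by rewrite starK.
congr (pn _); rewrite /S /commT /sub_T /diff_list /tens /rmap /lmap /sclT.
rewrite !map_cat -!map_comp; congr (_ ++ _); apply: eq_map => l /=.
  by rewrite -scaleMr starMr.
by rewrite -mulrA u2 mulr1 scalerA mulN1r rmorphN.
Qed.

Lemma amenable_no_gap (ham : amenable A) (Q : seq A) (beta : R) : 0 < beta ->
  (forall s, beta ^+ 2 * pnT s ^+ 2 <= \sum_(x <- Q) pnT (commT x s) ^+ 2) -> False.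
Proof.
move=> b0 gap; have [L uL [C C0 hC]] := controlled_seq Q.
pose u (k : 'I_(size L)) := tnth (in_tuple L) k.
have uu k : unitary (u k) by apply: uL; exact: mem_tnth.
have u1 k : star (u k) * u k = 1 by have [] := uu k.
have u2 k : u k * star (u k) = 1 by have [] := uu k.
pose theta := beta ^+ 2 / (4 * C + beta ^+ 2 + 1).
have b2 : 0 < beta ^+ 2 by rewrite exprn_gt0.
have den : 0 < 4 * C + beta ^+ 2 + 1 by lra.
have th0 : 0 < theta by rewrite divr_gt0.
have th1 : theta < 1 by rewrite ltr_pdivrMr// mul1r; lra.
have thC : 2 * C * theta < beta ^+ 2.
  rewrite mulrA ltr_pdivrMr// mulrC ltr_pM2l//; lra.
clearbody theta.
have th2 : 0 < theta ^+ 2 by rewrite exprn_gt0.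
have [Z hZ] := almost_invariant_functional ham ptau tau1 trtau u1 u2
  (divr_ge0 (ler0n R 2) (ltW th2)).
set h := nr (hat ptau u1 Z) in hZ.
have h0 : 0 <= h by exact: nr_ge0.
pose Z' := sclT (2^-1)%:C (Z ++ starL Z).
have half (z : R[i]) : (2^-1)%:C * (z + conjc z) = (complex.Re z)%:C.
  by case: z => a b; apply/eqP; rewrite eq_complex /=; apply/andP; split; apply/eqP; field.
have kZ v w : kern tau Z' v w = conjc (kern tau Z' w v).
  rewrite /kern !evalT_scl; try by have [] := rank_one_bounded ptau v w.
    by rewrite !evalT_cat -!/(kern _ _ _ _) !kern_star cjM cjr cjD conjcK addrC.
  by have [] := rank_one_bounded ptau w v.
have [n [e [lam [oe he]]]] := diag_list ptau kZ.
have trZ : (\sum_l lam l)%:C = (complex.Re (trT tau Z))%:C.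
  have bt : bounded_form ptau (fun x y => tau (star y * x)).
    split; first exact: sesqui_tau.
    by exists 1 => x y; rewrite mul1r; exact: tau_ip_le.
  have := he _ bt; rewrite evalT_scl; last exact: sesqui_tau.
  rewrite evalT_cat evalT_star.
  have -> : evalT (fun x y => conjc (tau (star x * y))) Z = trT tau Z.
    by apply: eq_bigr => p _; rewrite -(pfun_ipC ptau).
  rewrite half => ->; rewrite rmorph_sum; apply: eq_bigr => l _.
  by rewrite oe eqxx mulr1.
set kap := \sum_l `|lam l|.
have kapZ : complex.Re (trT tau Z) <= kap.
  by rewrite -(complexI trZ); apply: ler_sum => l _; exact: ler_norm.
have kap0 : 0 < kap.
  apply: lt_le_trans kapZ; apply: le_lt_trans hZ.
  by rewrite mulr_ge0// divr_ge0// ltW.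
have hk : 2 * h < theta ^+ 2 * kap.
  have := lt_le_trans hZ kapZ; rewrite mulrAC ltr_pdivrMr// mulrC; lra.
pose S := tens [seq ((Num.sqrt `|lam l|)%:C *: e l, e l) | l <- enum 'I_n].
have S2 : pnT S ^+ 2 = kap.
  rewrite pn2 /= cform_tens// big_map big_enum /= raddf_sum; apply: eq_bigr => l _ /=.
  rewrite /kern /evalT big_map big_enum /= (bigD1 l)//= big1 => [|k kl].
    rewrite /rank_one starZr -scaleMl -scaleMr !(pfunZ ptau) oe eqxx cj1 !mulr1 addr0.
    by rewrite -rmorphM /= -expr2 sqr_sqrtr.
  by rewrite /rank_one -scaleMr (pfunZ ptau) oe eq_sym; rewrite [l == k]eq_sym (negPf kl) conjc0 !mulr0.
have step k : pnT (commT (u k) S) ^+ 2 <= 2 * theta * kap.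
  rewrite /S pn_commut_unitary//.
  have of_ : orthonormal tau (fun l => u k * e l).
    by move=> i j; rewrite starMr -mulrA [star (u k) * _]mulrA u1 mul1r oe.
  have hV V : contraction ptau V ->
      nr (\sum_l (lam l)%:C * (V (u k * e l) (u k * e l) - V (e l) (e l))) <= h.
    move=> cV.
    have bu : bounded_form ptau (fun x y => V (u k * x) (u k * y)).
      have [[V1 V2] cV'] := cV; split; first split=> [c x x' y|c x y y'].
      - by rewrite mulrDr -scaleMr V1.
      - by rewrite mulrDr -scaleMr V2.
      by exists 1 => x y; rewrite mul1r; apply: le_trans (cV' _ _) _; rewrite !tnorm_unitary.
    have -> : \sum_l (lam l)%:C * (V (u k * e l) (u k * e l) - V (e l) (e l)) =
        evalT V (conjT (u k) Z') - evalT V Z'.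
      have -> : evalT V (conjT (u k) Z') = evalT (fun x y => V (u k * x) (u k * y)) Z'.
        by rewrite /evalT big_map.
      rewrite !he//; last exact: contraction_bounded.
      by rewrite -sumrB; apply: eq_bigr => l _; rewrite mulrBr.
    have sV : sesqui V by case: cV.
    rewrite conjT_scl !evalT_scl// conjT_cat !evalT_cat.
    have -> : conjT (u k) (starL Z) = starL (conjT (u k) Z).
      by rewrite /conjT /starL -!map_comp.
    rewrite !evalT_star.
    set V' := fun x y => conjc (V y x).
    have cV' : contraction ptau V' by exact: contraction_star.
    have h1 := hat_ub u1 Z k cV; have h2 := hat_ub u1 Z k cV'.
    have -> (a b c d : R[i]) : (2^-1)%:C * (a + conjc b) - (2^-1)%:C * (c + conjc d) =
       (2^-1)%:C * ((a - c) + conjc (b - d)) by rewrite cjD cjN; ring.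
    rewrite nrM nr_real ger0_norm ?invr_ge0//.
    rewrite mulrC ler_pdivrMr//; apply: le_trans (nrD _ _) _; rewrite nr_conj -/h in h1 h2 *.
    by move: h1 h2; lra.
  apply: le_trans (sign_trick trtau oe of_ hV) _; rewrite -/kap.
  have tk0 : 0 <= theta * kap by rewrite mulr_ge0// ltW.
  have h3 : Num.sqrt (2 * h * kap) <= theta * kap.
    rewrite -(ler_pXn2r (ltn0Sn 1)) ?nnegrE ?sqrtr_ge0//.
    rewrite sqr_sqrtr; last by rewrite !mulr_ge0// ltW.
    rewrite exprMn [kap ^+ 2]expr2 mulrA.
    by rewrite ler_wpM2r ?(ltW kap0)// ltW.
  have h4 : theta ^+ 2 * kap <= theta * kap.
    by rewrite ler_wpM2r ?(ltW kap0)// expr2 ler_piMr ?(ltW th0) ?(ltW th1).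
  by move: h3 h4 hk; lra.
have := gap S; rewrite S2 leNgt => /negP; apply.
apply: (@le_lt_trans _ _ (C * (2 * theta * kap))); last first.
  by rewrite mulrA ltr_pM2r//; move: thC; lra.
have t0 : 0 <= 2 * theta * kap by rewrite !mulr_ge0 ?(ltW th0) ?(ltW kap0).
rewrite -(sqr_sqrtr t0); apply: hC; first exact: sqrtr_ge0.
move=> v vL; rewrite -(ler_pXn2r (ltn0Sn 1)) ?nnegrE ?pn_ge0 ?sqrtr_ge0// (sqr_sqrtr t0).
have /tnthP[k ->] : v \in in_tuple L by [].
exact: (step k).
Qed.

End NonNull.

Lemma strong_T_summand (R : realType) (A : cstarAlgType R) : amenable A -> strong_property_T A ->
  forall tau : A -> R[i], pfun tau -> tau 1 = 1 -> (forall x y, tau (x * y) = tau (y * x)) ->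
  exists e, [/\ central_projection e, finite_cut e & tau e != 0].
Proof.
move=> ham /strong_T_gap[Q [beta [b0 gap]]] tau ptau tau1 trtau.
have [t kt] := kaz_limit ptau tau1 trtau b0 gap.
have [e [se ee eC te fe]] : exists e : A,
  [/\ star e = e, e * e = e, forall x, e * x = x * e, tau e != 0 &
    exists n (v : 'I_n -> A), forall x, exists c : 'I_n -> R[i], e * x = \sum_i c i *: v i].
  apply: (@finite_dimensional_summand R A tau t) => //.
  - exact: (kaz_central ptau tau1 trtau b0 gap kt).
  - exact: (kaz_L2_bounded ptau tau1 trtau b0 gap kt).
  - exact: (kaz_HS ptau tau1 trtau b0 gap kt).
  - move=> nt; exact: (amenable_no_gap tau1 trtau ham b0 (kaz_null_gap ptau tau1 trtau b0 gap kt nt)).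
by exists e.
Qed.

(** * Casimir elements *)

Section FiniteDimensional.
Variables (R : realType) (B : cstarAlgType R).
Implicit Types (b x y z : B) (f : B -> R[i]).

Definition faithful f := forall x, nullv f x -> x = 0.

Lemma finite_dimensional_bound n (v : 'I_n -> B) k (e : 'I_k -> B) :
  (forall x, exists c : 'I_n -> R[i], x = \sum_i c i *: v i) ->
  (forall c : 'I_k -> R[i], \sum_i c i *: e i = 0 -> forall i, c i = 0) -> (k <= n)%N.
Proof.
move=> /(_ (e _)) hv; have /choice[M hM] : forall i, exists c : 'I_n -> R[i], e i = \sum_j c j *: v j.
  by move=> i; exact: hv.
move=> ind; rewrite leqNgt; apply/negP => nk.
pose m := \matrix_(i < k, j < n) M i j.
have : kermx m != 0.
  rewrite kermx_eq0 /row_free; apply/negP => /eqP rk.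
  by have := rank_leq_col m; rewrite rk leqNgt nk.
move=> /rowV0Pn[w wk w0].
have wm : w *m m = 0 by apply/sub_kermxP.
move/negP: w0; apply; apply/eqP/rowP => i; rewrite [RHS]mxE; apply: (ind (fun i => w 0 i)).
under eq_bigr => j _ do rewrite hM scaler_sumr.
rewrite exchange_big big1// => j _.
under eq_bigr => l _ do rewrite scalerA.
rewrite -scaler_suml; have := congr1 (fun N : 'rV_n => N 0 j) wm; rewrite !mxE.
by under eq_bigr => l _ do rewrite mxE; move=> ->; rewrite scale0r.
Qed.

Lemma pfun_add f g : pfun f -> pfun g -> pfun (fun x => f x + g x).
Proof.
move=> pf pg; split=> [|x]; last by rewrite addr_ge0 ?pf.2 ?pg.2.
by split=> [x y|k x]; rewrite ?pf.1.1 ?pg.1.1 ?pf.1.2 ?pg.1.2; ring.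
Qed.

Lemma nullv_add f g x : pfun f -> pfun g -> nullv (fun x => f x + g x) x ->
  nullv f x /\ nullv g x.
Proof.
move=> pf pg; rewrite /nullv => /eqP; rewrite paddr_eq0 ?pf.2 ?pg.2//.
by move=> /andP[/eqP-> /eqP->].
Qed.

Lemma nullvD f x y : pfun f -> nullv f x -> nullv f y -> nullv f (x + y).
Proof.
move=> pf nx ny; rewrite /nullv mulrDr (pfunD pf) (null_ip pf _ nx) (null_ip pf _ ny).
exact: addr0.
Qed.

Lemma nullvZ f k x : pfun f -> nullv f x -> nullv f (k *: x).
Proof. by move=> pf nx; rewrite /nullv -scaleMr (pfunZ pf) (null_ip pf _ nx) mulr0. Qed.

Hypothesis fdB : finite_dimensional B.

Lemma faithful_pfun : exists f : B -> R[i], pfun f /\ faithful f.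
Proof.
have [n [v hv]] := fdB; apply: contrapT => nf.
have step k : exists f (e : 'I_k -> B), pfun f /\
    forall c : 'I_k -> R[i], nullv f (\sum_i c i *: e i) -> forall i, c i = 0.
  elim: k => [|k [f [e [pf fe]]]].
    exists (fun=> 0), (fun=> 0); split=> [|c _ []//].
    split=> [|x]; last exact: lexx.
    by split=> [x y|k' x]; rewrite /= ?addr0 ?mulr0.
  have [x [nx x0]] : exists x, nullv f x /\ x <> 0.
    apply: contrapT => H; apply: nf; exists f; split => // x nx.
    by apply: contrapT => x0; apply: H; exists x.
  have [g [pg g1 gx]] := enough_states (introN eqP x0).
  pose h y := f y + g y; have ph : pfun h by exact: pfun_add.
  exists h, (fun i => if unlift ord0 i is Some j then e j else x); split => // c.
  rewrite big_ord_recl unlift_none.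
  under eq_bigr => i _ do rewrite liftK.
  set y := \sum_i _ => /(nullv_add pf pg)[nfy ngy].
  have cS i : c (lift ord0 i) = 0.
    apply: (fe (fun i => c (lift ord0 i))); rewrite -/y.
    have -> : y = (c ord0 *: x + y) + (- c ord0) *: x.
      by rewrite scaleNr addrC addrA addNr add0r.
    by apply: nullvD => //; exact: nullvZ.
  have c0 : c ord0 = 0.
    apply: contrapT => /eqP c0; move: ngy.
    rewrite /y big1 => [|i _]; last by rewrite cS scale0r.
    rewrite addr0 => /(nullvZ (c ord0)^-1 pg); rewrite scalerA mulVf// scale1r /nullv gx.
    rewrite -[0]/((0 : R)%:C) => /complexI/eqP; rewrite sqrf_eq0 nr_eq0.
    by move/eqP.
  by move=> i; case: (unliftP ord0 i) => [j|] ->.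
have [f [e [pf fe]]] := step n.+1.
suff: (n.+1 <= n)%N by rewrite ltnn.
apply: (finite_dimensional_bound (e := e) hv) => c hc.
by apply: fe; rewrite hc /nullv mulr0 (clin0 pf.1).
Qed.

Lemma faithful_basis f : pfun f -> faithful f ->
  exists n (e : 'I_n -> B), orthonormal f e /\ forall x, x = oproj f e x.
Proof.
move=> pf ff; have [m [v hv]] := fdB.
have [n [e [oe _ he]]] : exists n (e : 'I_n -> B), [/\ orthonormal f e,
    forall i, setT (e i) & forall b, b \in [seq v i | i <- enum 'I_m] -> nullv f (b - oproj f e b)].
  exact: gram_schmidt.
exists n, e; split => // x; have [c ->] := hv x.
rewrite [RHS](_ : _ = \sum_i c i *: oproj f e (v i)); last first.
  rewrite /oproj; under [RHS]eq_bigr => i _ do rewrite scaler_sumr.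
  rewrite [RHS]exchange_big; apply: eq_bigr => j _.
  rewrite mulr_sumr (clin_sum _ _ _ pf.1) scaler_suml; apply: eq_bigr => i _.
  by rewrite -scaleMr (pfunZ pf) scalerA.
apply: eq_bigr => i _; congr (_ *: _); apply/eqP; rewrite -subr_eq0; apply/eqP.
by apply: ff; apply: he; rewrite map_f// mem_enum.
Qed.

(* The trace of the left multiplication by x. *)
Lemma faithful_trace : exists tau : B -> R[i],
  [/\ pfun tau, faithful tau, forall x y, tau (x * y) = tau (y * x) &
   forall n (v : 'I_n -> B), (forall x, x = oproj tau v x) ->
     forall x, \sum_i tau (star (v i) * x * v i) = tau x].
Proof.
have [f [pf ff]] := faithful_pfun; have [n [e [oe he]]] := faithful_basis pf ff.
pose tau x := \sum_i f (star (e i) * x * e i).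
have ltau : clinear tau.
  split=> [x y|k x]; rewrite /tau ?mulr_sumr -?big_split; apply: eq_bigr => i _ /=.
    by rewrite mulrDr mulrDl (pfunD pf).
  by rewrite -scaleMr -scaleMl (pfunZ pf).
have E x i : tau (star x * x) = \sum_i f (star (x * e i) * (x * e i)).
  by apply: eq_bigr => j _; rewrite starMr !mulrA.
have ptau : pfun tau.
  split => // x; apply: sumr_ge0 => i _.
  have -> : star (e i) * (star x * x) * e i = star (x * e i) * (x * e i).
    by rewrite starMr !mulrA.
  exact: pf.2.
have ex z x i : f (star z * x * e i) = \sum_j f (star (e j) * (x * e i)) * f (star z * e j).
  rewrite -mulrA {1}(he (x * e i)) /oproj mulr_sumr (clin_sum _ _ _ pf.1).
  by apply: eq_bigr => j _; rewrite -scaleMr (pfunZ pf).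
exists tau; split => //.
- move=> x; rewrite /nullv => tx.
  have h i : x * e i = 0.
    apply: (ff); move/eqP: tx; rewrite /tau psumr_eq0 => [/allP/(_ i)|j _].
      by rewrite mem_index_enum => /(_ isT)/eqP; rewrite /nullv starMr !mulrA.
    by have := pf.2 (x * e j); rewrite starMr !mulrA.
  rewrite -[x]mulr1 (he 1) /oproj mulr_sumr big1// => i _.
  by rewrite -scaleMr h scaler0.
- move=> x y; rewrite /tau.
  have h a b : \sum_i f (star (e i) * (a * b) * e i) =
      \sum_i \sum_j f (star (e j) * (b * e i)) * f (star (e i) * (a * e j)).
    apply: eq_bigr => i _.
    have -> : star (e i) * (a * b) * e i = star (star a * e i) * b * e i.
      by rewrite starMr starK !mulrA.
    by rewrite ex; apply: eq_bigr => j _; congr (_ * f _); rewrite starMr starK mulrA.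
  rewrite !h exchange_big; apply: eq_bigr => i _; apply: eq_bigr => j _; exact: mulrC.
- move=> m v hv x.
  have h i : tau (star (v i) * x * v i) =
      \sum_j f (star (e j) * v i) * tau (star (v i) * (x * e j)).
    rewrite {2}(he (v i)) /oproj mulr_sumr (clin_sum _ _ _ ltau).
    by apply: eq_bigr => j _; rewrite -scaleMr (pfunZ ptau) mulrA.
  under eq_bigr => i _ do rewrite h.
  rewrite exchange_big; apply: eq_bigr => j _.
  rewrite -mulrA [in RHS](hv (x * e j)) /oproj mulr_sumr (clin_sum _ _ _ pf.1).
  by apply: eq_bigr => i _; rewrite -scaleMr (pfunZ pf) mulrC.
Qed.

Lemma casimir : exists n (v : 'I_n -> B) (c : B -> 'I_n -> 'I_n -> R[i]),
  [/\ \sum_i v i * star (v i) = 1,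
      forall b i, b * v i = \sum_j c b j i *: v j &
      forall b j, star (v j) * b = \sum_i c b j i *: star (v i)].
Proof.
have [tau [ptau ft trtau ttau]] := faithful_trace.
have [n [v [ov hv]]] := faithful_basis ptau ft.
exists n, v, (fun b j i => tau (star (v j) * (b * v i))); split.
- apply/eqP; rewrite -subr_eq0; apply/eqP; apply: (ft).
  set z := _ - 1; rewrite /nullv {2}/z mulrBr mulr1 (pfunB ptau) mulr_sumr.
  rewrite (clin_sum _ _ _ ptau.1) -[X in _ - X](ttau _ v hv) -sumrB big1// => i _.
  by rewrite (trtau (star z)) (trtau _ (v i)) mulrA subrr.
- by move=> b i; exact: hv.
- move=> b j; rewrite -[star (v j) * b]starK starMr starK {1}(hv (star b * v j)) /oproj star_sum.
  apply: eq_bigr => i _; rewrite starZc -(pfun_ipC ptau) starMr starK.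
  by rewrite -mulrA.
Qed.

End FiniteDimensional.

Lemma no_trace_witness (R : realType) (C : cstarAlgType R) :
  ~ (exists tau : {scalar C}, tracial_state tau) ->
  exists l : seq (C * C * R), (forall p, p \in l -> 0 < p.2) /\
    forall phi : C -> R[i], pfun phi -> phi 1 = 1 -> exists2 p, p \in l &
      p.2 < nr (phi (p.1.1 * p.1.2 - p.1.2 * p.1.1)).
Proof.
move=> nt; apply: contrapT => nl; apply: nt.
pose S : set (C * R) := [set p | 0 < p.2 /\ exists x y, p.1 = x * y - y * x].
have [tau [ptau tau1 htau]] : exists F, [/\ pfun F, F 1 = 1 & forall p, S p -> nr (F p.1) <= p.2].
  apply: states_compact => l lS; apply: contrapT => nF; apply: nl.
  have [l' [l'0 ll]] : exists l' : seq (C * C * R), (forall p, p \in l' -> 0 < p.2) /\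
      [seq (p.1.1 * p.1.2 - p.1.2 * p.1.1, p.2) | p <- l'] = l.
    elim: l lS {nF} => [|[z r] l ih] lS; first by exists [::].
    have [l' [l'0 <-]] : exists l' : seq (C * C * R), (forall p, p \in l' -> 0 < p.2) /\
        [seq (p.1.1 * p.1.2 - p.1.2 * p.1.1, p.2) | p <- l'] = l.
      by apply: ih => p pl; apply: lS; rewrite inE pl orbT.
    have [/= r0 [x [y ->]]] := lS (z, r) (mem_head _ _).
    exists ((x, y, r) :: l'); split => // p; rewrite inE => /orP[/eqP->//|]; exact: l'0.
  exists l'; split => // phi pphi phi1; apply: contrapT => np; apply: nF.
  exists phi; split => // p; rewrite -ll => /mapP[q ql ->] /=.
  by rewrite leNgt; apply/negP => h; apply: np; exists q.
have [f hf] := clinear_scalar ptau.1; exists f; split.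
- by move=> x; rewrite hf; exact: ptau.2.
- by rewrite hf.
- move=> x y; rewrite !hf; apply/eqP; rewrite -subr_eq0 -(clinB _ _ ptau.1); apply/eqP.
  apply: nr_le0; apply/ler_addgt0Pr => r r0; rewrite add0r.
  by apply: (htau (x * y - y * x, r)); split => //; exists x, y.
Qed.

Section StrongTOfDecomposition.
Variables (R : realType) (A B C : cstarAlgType R) (gB : B -> A) (gC : C -> A).
Hypothesis gBD : forall (k : R[i]) x y, gB (k *: x + y) = k *: gB x + gB y.
Hypothesis gCD : forall (k : R[i]) x y, gC (k *: x + y) = k *: gC x + gC y.
Hypothesis gBM : forall x y, gB (x * y) = gB x * gB y.
Hypothesis gCM : forall x y, gC (x * y) = gC x * gC y.
Hypothesis gCS : forall x, gC (star x) = star (gC x).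
Hypothesis g1 : gB 1 + gC 1 = 1.
Hypothesis gideal : forall a, exists b, forall x, a * gB x = gB (b * x) /\ gB x * a = gB (x * b).

Lemma gB_sum (I : Type) (r : seq I) (c : I -> R[i]) (v : I -> B) :
  gB (\sum_(i <- r) c i *: v i) = \sum_(i <- r) c i *: gB (v i).
Proof.
elim: r => [|i r ih]; last by rewrite !big_cons gBD ih.
rewrite !big_nil; have := gBD 1 0 0; rewrite !scale1r addr0 => h.
by apply: (addrI (gB 0)); rewrite -h addr0.
Qed.

Lemma lact_suml (H : hilbertType R) (M : hilbert_bimodule A H) (I : Type) (r : seq I)
    (c : I -> R[i]) (a : I -> A) xi :
  lact M (\sum_(i <- r) c i *: a i) xi = \sum_(i <- r) c i *: lact M (a i) xi.
Proof.
rewrite (big_morph (fun z => lact M z xi) (fun z w => lactDl M z w xi) (linear0l (lact M) xi)).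
by apply: eq_bigr => i _; rewrite lactZl.
Qed.

Lemma ract_sumr (H : hilbertType R) (M : hilbert_bimodule A H) (I : Type) (r : seq I)
    (c : I -> R[i]) (a : I -> A) xi :
  ract M xi (\sum_(i <- r) c i *: a i) = \sum_(i <- r) c i *: ract M xi (a i).
Proof.
rewrite (big_morph (ract M xi) (fun z w => ractDr M z w xi) (linear0 (ract M xi))).
by apply: eq_bigr => i _; rewrite ractZr.
Qed.

Lemma casimir_central n (v : 'I_n -> B) (c : B -> 'I_n -> 'I_n -> R[i])
    (H : hilbertType R) (M : hilbert_bimodule A H) (xi : H) :
  (forall b i, b * v i = \sum_j c b j i *: v j) ->
  (forall b j, star (v j) * b = \sum_i c b j i *: star (v i)) ->
  central_vectors M (\sum_i ract M (lact M (gB (v i)) xi) (gB (star (v i)))).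
Proof.
move=> h1 h2 a; have [b hb] := gideal a.
rewrite (big_morph (lact M a) (fun x y => lactDr M a x y) (linear0 (lact M a))).
rewrite (big_morph (fun z => ract M z a) (fun x y => ractDl M a x y) (linear0l (ract M) a)).
transitivity (\sum_i \sum_j c b j i *: ract M (lact M (gB (v j)) xi) (gB (star (v i)))).
  apply: eq_bigr => i _; rewrite -lractA -lactM (hb (v i)).1 h1 gB_sum lact_suml.
  rewrite (big_morph (fun z => ract M z (gB (star (v i)))) (fun x y => ractDl M _ x y)
    (linear0l (ract M) _)).
  by apply: eq_bigr => j _; rewrite ractZl.
rewrite exchange_big; apply: eq_bigr => j _.
by rewrite -ractM (hb (star (v j))).2 h2 gB_sum ract_sumr.
Qed.

(* For the vector state of [eta = gC 1 . xi] the commutators of C are nearly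
   null, since x y eta is close to x eta y.                                   *)
Lemma vector_commutator (H : hilbertType R) (M : hilbert_bimodule A H) (xi : H) x y (beta : R) :
  let eta := lact M (gC 1) xi in
  nr (commut M (gC y) xi) <= beta -> nr (commut M (gC (star y)) xi) <= beta ->
  nr (hdot (lact M (gC (x * y - y * x)) eta) eta : R[i]) <=
    2 * nr (gC x) * beta * nr eta.
Proof.
move=> eta h1 h2.
have c1 : nr (gC 1) <= 1.
  have : nr (gC 1) ^+ 2 <= 1 * nr (gC 1).
    have e1 : star (gC 1) * gC 1 = gC 1 by rewrite -gCS -gCM star1 mulr1.
    by rewrite -nr_starM e1 mul1r.
  have := nr_ge0 (gC 1); nra.
have sub a : nr (commut M a xi) <= beta -> gC 1 * a = a -> a * gC 1 = a ->
    nr (commut M a eta) <= beta.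
  move=> ha a1 a2; have -> : commut M a eta = lact M (gC 1) (commut M a xi).
    by rewrite /commut /eta lactBr -!lactM a1 a2 lractA.
  apply: le_trans (lact_le _ _ _) _; apply: le_trans _ ha.
  by rewrite -[leRHS]mul1r ler_wpM2r ?nr_ge0.
have k1 := sub _ h1; have k2 := sub _ h2; move: k1 k2.
rewrite -!gCM !mul1r !mulr1 => /(_ erefl erefl) k1 /(_ erefl erefl) k2.
have gB1 : gC (x * y - y * x) = gC x * gC y - gC y * gC x.
  by rewrite -!gCM -scaleN1r addrC gCD scaleN1r addrC.
rewrite gB1 lactBl hdotBl !lactM.
have -> : hdot (lact M (gC x) (lact M (gC y) eta)) eta - hdot (lact M (gC y) (lact M (gC x) eta)) eta
  = hdot (lact M (gC x) (commut M (gC y) eta)) eta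
    - hdot (lact M (gC x) eta) (commut M (gC (star y)) eta) :> R[i].
  rewrite /commut lactBr hdotBl hdotBr [hdot (lact M (gC y) _) _]lact_star.
  by rewrite -[lact M (gC x) (ract M _ _)]lractA ract_star gCS; ring.
apply: le_trans (nrB _ _) _.
have b1 : nr (hdot (lact M (gC x) (commut M (gC y) eta)) eta : R[i]) <= nr (gC x) * beta * nr eta.
  apply: le_trans (hdot_CS _ _) _; rewrite ler_wpM2r ?nr_ge0//.
  apply: le_trans (lact_le _ _ _) _; by rewrite ler_wpM2l ?nr_ge0.
have b2 : nr (hdot (lact M (gC x) eta) (commut M (gC (star y)) eta) : R[i]) <= nr (gC x) * beta * nr eta.
  apply: le_trans (hdot_CS _ _) _; rewrite mulrAC; apply: ler_pM; rewrite ?nr_ge0//.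
  exact: lact_le.
by move: b1 b2; lra.
Qed.

Lemma vector_state (H : hilbertType R) (M : hilbert_bimodule A H) (xi : H) :
  let eta := lact M (gC 1) xi in eta != 0 ->
  let phi x : R[i] := ((nr eta ^+ 2)^-1)%:C * hdot (lact M (gC x) eta) eta in
  pfun phi /\ phi 1 = 1.
Proof.
move=> eta e0 phi; have n0 : 0 < nr eta ^+ 2 by rewrite exprn_gt0// lt_def nr_eq0 e0 nr_ge0.
split; last first.
  rewrite /phi /eta -lactM -gCM mulr1 -/eta hdot_nr -rmorphM /= mulVf//.
  by rewrite gt_eqF.
split; first split=> [x y|k x]; rewrite /phi.
- have -> : gC (x + y) = gC x + gC y by have := gCD 1 x y; rewrite !scale1r.
  by rewrite lactDl hdotDl mulrDr.
- have -> : gC (k *: x) = k *: gC x.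
    have h0 : gC 0 = 0.
      by have := gCD 1 0 0; rewrite !scale1r addr0 => h; apply: (addrI (gC 0)); rewrite -h addr0.
    by have := gCD k x 0; rewrite !addr0 h0 addr0.
  by rewrite lactZl hdotZl mulrCA.
- move=> x; rewrite /phi gCM gCS lactM lact_star starK hdot_nr -rmorphM /= ler0c.
  by rewrite mulr_ge0 ?invr_ge0 ?sqr_ge0 ?(ltW n0).
Qed.

Theorem strong_T_of_decomposition : finite_dimensional B ->
  ~ (exists tau : {scalar C}, tracial_state tau) -> strong_property_T A.
Proof.
move=> /casimir[n [v [c [v1 vl vr]]]] /no_trace_witness[l [l0 hl]] alpha a0.
pose K := \sum_i nr (gB (v i)).
pose L := \sum_(p <- l) 2 * nr (gC p.1.1) / p.2.
have K0 : 0 <= K by apply: sumr_ge0 => i _; exact: nr_ge0.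
have L0 : 0 <= L.
  rewrite /L big_seq; apply: sumr_ge0 => p pl.
  by rewrite divr_ge0 ?mulr_ge0 ?nr_ge0 ?(ltW (l0 _ pl)).
pose beta := alpha / (4 * (K + L + 1)).
have den : 0 < 4 * (K + L + 1) by lra.
have b0 : 0 < beta by rewrite divr_gt0.
have bE : beta * (4 * (K + L + 1)) = alpha by rewrite mulfVK// gt_eqF.
clearbody beta.
pose Qs : seq A := 1 :: [seq gB (star (v i)) | i <- enum 'I_n] ++
  [seq gC p.1.2 | p <- l] ++ [seq gC (star p.1.2) | p <- l].
exists [set` Qs], beta; split => //.
- by exists 1; rewrite /= inE eqxx.
move=> H M xi [xi1 hxi].
have hQ x : x \in Qs -> nr (commut M x xi) <= beta.
  by move=> /hxi; rewrite nrE ltcR => /ltW.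
pose eta := lact M (gC 1) xi.
pose zeta := \sum_i ract M (lact M (gB (v i)) xi) (gB (star (v i))).
have zc : central_vectors M zeta by exact: casimir_central vl vr.
have he : nr eta < alpha / 2.
  rewrite ltNge; apply/negP => ae.
  have en0 : 0 < nr eta by apply: lt_le_trans ae; rewrite divr_gt0.
  have e0 : eta != 0 by rewrite -nr_eq0 gt_eqF.
  have [pphi phi1] := vector_state e0.
  have [p pl] := hl _ pphi phi1; rewrite ltNge => /negP; apply.
  rewrite nrM nr_real ger0_norm ?invr_ge0 ?sqr_ge0//.
  rewrite mulrC ler_pdivrMr ?exprn_gt0//.
  have m1 : gC p.1.2 \in Qs by rewrite inE !mem_cat map_f ?orbT.
  have m2 : gC (star p.1.2) \in Qs.
    by rewrite inE !mem_cat (map_f (fun p => gC (star p.1.2)) pl) !orbT.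
  apply: le_trans (vector_commutator p.1.1 (hQ _ m1) (hQ _ m2)) _; rewrite -/eta.
  rewrite expr2 mulrA ler_wpM2r ?nr_ge0//.
  have pL : 2 * nr (gC p.1.1) / p.2 <= L.
    rewrite /L (big_rem p pl) /= lerDl big_seq; apply: sumr_ge0 => q ql.
    by rewrite divr_ge0 ?mulr_ge0 ?nr_ge0 ?(ltW (l0 _ (mem_rem ql))).
  have p0 := l0 _ pl; rewrite ler_pdivrMr// in pL.
  have h3 : 2 * nr (gC p.1.1) * beta <= L * p.2 * beta by rewrite ler_wpM2r ?(ltW b0).
  apply: le_trans h3 _; rewrite [L * p.2]mulrC -mulrA ler_wpM2l ?(ltW p0)//.
  by apply: le_trans ae; move: bE; nra.
have hz : nr (lact M (gB 1) xi - zeta) <= K * beta.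
  have -> : lact M (gB 1) xi = \sum_i lact M (gB (v i)) (lact M (gB (star (v i))) xi).
    rewrite -v1; have -> : \sum_i v i * star (v i) = \sum_i 1 *: (v i * star (v i)).
      by apply: eq_bigr => i _; rewrite scale1r.
    rewrite gB_sum lact_suml; apply: eq_bigr => i _.
    by rewrite scale1r gBM lactM.
  rewrite /zeta -sumrB mulr_suml; apply: le_trans (nr_sum _ _) _; apply: ler_sum => i _.
  rewrite lractA -lactBr; apply: le_trans (lact_le _ _ _) _.
  rewrite ler_wpM2l ?nr_ge0//; apply: hQ.
  by rewrite inE !mem_cat map_f ?orbT ?mem_enum.
rewrite nrE ltcR; apply: (@le_lt_trans _ _ (nr (xi - zeta))).
  by apply: orth_proj_le => //; exact: central_closed.
have -> : xi - zeta = (lact M (gB 1) xi - zeta) + eta.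
  by rewrite addrAC /eta -lactDl g1 lact1.
apply: le_lt_trans (nrD _ _) _; move: hz he bE; nra.
Qed.

End StrongTOfDecomposition.

Theorem proposition5p3 (R : realType) (A : cstarAlgType R)
    (hsep : separable_space A) (ham : amenable A) :
  strong_property_T A <->
  exists B C : cstarAlgType R,
    [/\ star_isomorphic A (B * C)%type,
        finite_dimensional B &
        ~ (exists tau : {scalar C}, tracial_state tau)].
Proof.
split=> [sT|[B [C [[F [[G FK GK] lF F1 FM FS]] fdB ntC]]]].
  exact: trace_dichotomy (strong_T_summand ham sT).
have Finj := can_inj FK.
have FD x y : F (x + y) = F x + F y by have := lF 1 x y; rewrite !scale1r.
pose gB b := G (b, 0); pose gC c := G (0, c).
apply: (@strong_T_of_decomposition R A B C gB gC) => //.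
- move=> k x y; apply: Finj; rewrite lF !GK; congr pair => /=.
  by rewrite scaler0 addr0.
- move=> k x y; apply: Finj; rewrite lF !GK; congr pair => /=.
  by rewrite scaler0 addr0.
- by move=> x y; apply: Finj; rewrite FM !GK; congr pair => /=; rewrite mulr0.
- by move=> x y; apply: Finj; rewrite FM !GK; congr pair => /=; rewrite mulr0.
- by move=> x; apply: Finj; rewrite FS !GK; congr pair => /=; rewrite star0.
- by apply: Finj; rewrite FD !GK F1; congr pair => /=; rewrite ?addr0 ?add0r.
- move=> a; exists (F a).1 => x; split; apply: Finj; rewrite FM !GK; congr pair => /=.
    by rewrite mulr0.
  by rewrite mul0r.
Qed.
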